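(* Let $\mathcal{C}$ be a fusion category over $\mathbb{C}$. There is a long exact sequence of groups $$\ast \to \mathrm{Hom}(U(\mathcal{C}),\mathbb{C}^\times) \to \pi_1\underline{\underline{\mathrm{BrPic}}}(\mathcal{C}) \xrightarrow{\ \delta\ } \mathrm{Inv}(\mathcal{C}) \xrightarrow{\ F_-\ } \mathrm{Eq}(\mathcal{C}) \xrightarrow{\ M_-\ } \mathrm{Out}(\mathcal{C}) \to \ast ,$$ where, under the identification $\pi_1\underline{\underline{\mathrm{BrPic}}}(\mathcal{C})\cong\mathrm{Inv}(Z(\mathcal{C}))$, the map $\delta$ is induced by the forgetful functor $Z(\mathcal{C})\to\mathcal{C}$.
   Context: A fusion category over $\mathbb{C}$ is a finite $\mathbb{C}$-linear semisimple rigid monoidal category with simple unit $\mathbf 1$. $\ast$ denotes the trivial group. $U(\mathcal{C})$ is the universal grading group of $\mathcal{C}$. $\underline{\underline{\mathrm{BrPic}}}(\mathcal{C})$ is the categorical $2$-group of invertible $\mathcal{C}$-$\mathcal{C}$-bimodule categories, their bimodule equivalences, and isomorphisms of these; $\pi_1\underline{\underline{\mathrm{BrPic}}}(\mathcal{C})$ is the group of isomorphism classes of $\mathcal C$-$\mathcal C$-bimodule auto-equivalences of the regular bimodule $\mathcal{C}$. It is identified with $\mathrm{Inv}(Z(\mathcal{C}))$, the group of isomorphism classes of invertible objects of the Drinfeld center $Z(\mathcal{C})$ (a central invertible object corresponds to the functor of tensoring with it). $\mathrm{Inv}(\mathcal{C})$ is the group of isomorphism classes of invertible objects of $\mathcal{C}$.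 $\mathrm{Eq}(\mathcal{C})$ is the group of tensor auto-equivalences of $\mathcal{C}$ up to monoidal natural isomorphism. $\mathrm{Out}(\mathcal{C})$ is the group of equivalence classes of invertible $\mathcal{C}$-$\mathcal{C}$-bimodule categories which are equivalent to $\mathcal{C}$ as left module categories; it is identified with the group of tensor auto-equivalences modulo inner ones. The first nontrivial map sends a character $\chi$ of $U(\mathcal{C})$ to the unit object $\mathbf 1$ with the half-braiding which on a simple object $X$ is the scalar $\chi(\deg X)$ (times the canonical isomorphism $\mathbf 1\otimes X\cong X\otimes\mathbf 1$). The map $F_-$ sends $g$ to the tensor auto-equivalence $F_g:X\mapsto g\otimes X\otimes g^*$. The map $M_-$ sends a tensor auto-equivalence $F$ to the bimodule category $M_F=\mathcal{C}$ with actions $X\otimes_{M_F}m\otimes_{M_F}Y:=X\otimes m\otimes F(Y)$. *)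

(* Defs.v *)
From mathcomp Require Import all_boot all_order all_algebra.
From mathcomp Require Import reals complex.

Set Implicit Arguments.
Unset Strict Implicit.
Unset Printing Implicit Defensive.

Import GRing.Theory.
Local Open Scope ring_scope.

Declare Scope cat_scope.
Delimit Scope cat_scope with cat.
Local Open Scope cat_scope.

Record lincat (k : fieldType) := LinCat {
  ob :> Type;
  mor : ob -> ob -> lmodType k;
  id_mor : forall X, mor X X;
  mcomp : forall X Y Z, mor Y Z -> mor X Y -> mor X Z;
  comp_idl : forall X Y (f : mor X Y), mcomp (id_mor Y) f = f;
  comp_idr : forall X Y (f : mor X Y), mcomp f (id_mor X) = f;
  compA : forall X Y Z W (h : mor Z W) (g : mor Y Z) (f : mor X Y),
    mcomp h (mcomp g f) = mcomp (mcomp h g) f;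
  comp_linl : forall X Y Z (a : k) (g g' : mor Y Z) (f : mor X Y),
    mcomp (a *: g + g') f = a *: mcomp g f + mcomp g' f;
  comp_linr : forall X Y Z (a : k) (g : mor Y Z) (f f' : mor X Y),
    mcomp g (a *: f + f') = a *: mcomp g f + mcomp g f'
}.

Arguments mor {k} _ _ _.
Arguments id_mor {k l} X.
Arguments mcomp {k l X Y Z} g f.

Notation "g ∘ f" := (mcomp g f) (at level 40, left associativity) : cat_scope.

Section LinearCategories.
Variable k : fieldType.
Implicit Types A B D : lincat k.

Record iso A (X Y : A) := Iso {
  fwd :> mor A X Y;
  bwd : mor A Y X;
  fwdK : bwd ∘ fwd = id_mor X;
  bwdK : fwd ∘ bwd = id_mor Y
}.

Definition is_iso A (X Y : A) (f : mor A X Y) : Prop :=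
  exists g : mor A Y X, g ∘ f = id_mor X /\ f ∘ g = id_mor Y.

Definition isomorphic A (X Y : A) : Prop := exists f : mor A X Y, is_iso f.

Definition mono A (X Y : A) (f : mor A X Y) : Prop :=
  forall Z (g h : mor A Z X), f ∘ g = f ∘ h -> g = h.

Definition epi A (X Y : A) (f : mor A X Y) : Prop :=
  forall Z (g h : mor A Y Z), g ∘ f = h ∘ f -> g = h.

Definition is_zero A (Z : A) : Prop :=
  forall X, (forall f : mor A X Z, f = 0) /\ (forall f : mor A Z X, f = 0).

Definition is_kernel A (X Y K : A) (f : mor A X Y) (i : mor A K X) : Prop :=
  f ∘ i = 0 /\
  forall T (g : mor A T X), f ∘ g = 0 -> exists! h : mor A T K, i ∘ h = g.

Definition is_cokernel A (X Y Q : A) (f : mor A X Y) (p : mor A Y Q) : Prop :=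
  p ∘ f = 0 /\
  forall T (g : mor A Y T), g ∘ f = 0 -> exists! h : mor A Q T, h ∘ p = g.

Definition is_direct_sum A n (Xs : 'I_n -> A) (S : A) : Prop :=
  exists (i : forall j, mor A (Xs j) S) (p : forall j, mor A S (Xs j)),
  [/\ forall j, p j ∘ i j = id_mor (Xs j),
      forall j l, j != l -> p l ∘ i j = 0
    & \sum_(j < n) (i j ∘ p j) = id_mor S].

(* The case n = 0 of the first clause provides a zero object. *)
Definition abelian_cat A : Prop :=
  [/\ forall n (Xs : 'I_n -> A), exists S, is_direct_sum Xs S,
      forall (X Y : A) (f : mor A X Y), exists K (i : mor A K X), is_kernel f i,
      forall (X Y : A) (f : mor A X Y), exists Q (p : mor A Y Q), is_cokernel f p,
      forall (X Y : A) (f : mor A X Y), mono f ->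
        exists Z (g : mor A Y Z), is_kernel g f
    & forall (X Y : A) (f : mor A X Y), epi f ->
        exists Z (g : mor A Z X), is_cokernel g f].

Definition simple_ob A (X : A) : Prop :=
  ~ is_zero X /\
  forall Y (i : mor A Y X), mono i -> is_zero Y \/ is_iso i.

Definition finite_semisimple A : Prop :=
  [/\ abelian_cat A,
      forall X Y : A, exists n (b : 'I_n -> mor A X Y),
        forall f, exists c : 'I_n -> k, f = \sum_(j < n) c j *: b j,
      exists n (S : 'I_n -> A), forall X, simple_ob X -> exists j, isomorphic X (S j)
    & forall X : A, exists n (Xs : 'I_n -> A),
        (forall j, simple_ob (Xs j)) /\ is_direct_sum Xs X].

Record functor A B := Functor {
  fob :> A -> B;
  fmap : forall X Y, mor A X Y -> mor B (fob X) (fob Y);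
  fmap_id : forall X, fmap (id_mor X) = id_mor (fob X);
  fmap_comp : forall X Y Z (g : mor A Y Z) (f : mor A X Y),
    fmap (g ∘ f) = fmap g ∘ fmap f;
  fmap_lin : forall X Y a (f g : mor A X Y),
    fmap (a *: f + g) = a *: fmap f + fmap g
}.

Definition fid A : functor A A.
Proof. by exists id (fun X Y f => f). Defined.

Definition fcomp A B D (G : functor B D) (F : functor A B) : functor A D.
Proof.
exists (fun X => G (F X)) (fun X Y f => fmap G (fmap F f)).
- by move=> X; rewrite !fmap_id.
- by move=> X Y Z g f; rewrite !fmap_comp.
- by move=> X Y a f g; rewrite !fmap_lin.
Defined.

Definition natural A B (F G : functor A B)
    (eta : forall X, mor B (F X) (G X)) : Prop :=
  forall X Y (f : mor A X Y), eta Y ∘ fmap F f = fmap G f ∘ eta X.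

Definition natural_iso A B (F G : functor A B)
    (eta : forall X, mor B (F X) (G X)) : Prop :=
  natural eta /\ forall X, is_iso (eta X).

Definition equivalence A B (F : functor A B) : Prop :=
  exists G : functor B A,
    (exists eta, @natural_iso _ _ (fcomp G F) (fid A) eta) /\
    (exists eps, @natural_iso _ _ (fcomp F G) (fid B) eps).

Record bifunctor A B D := Bifunctor {
  bob :> A -> B -> D;
  bmap : forall X X' Y Y', mor A X X' -> mor B Y Y' -> mor D (bob X Y) (bob X' Y');
  bmap_id : forall X Y, bmap (id_mor X) (id_mor Y) = id_mor (bob X Y);
  bmap_comp : forall X X' X'' Y Y' Y'' (f' : mor A X' X'') (f : mor A X X')
      (g' : mor B Y' Y'') (g : mor B Y Y'),
    bmap (f' ∘ f) (g' ∘ g) = bmap f' g' ∘ bmap f g;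
  bmap_linl : forall X X' Y Y' a (f f' : mor A X X') (g : mor B Y Y'),
    bmap (a *: f + f') g = a *: bmap f g + bmap f' g;
  bmap_linr : forall X X' Y Y' a (f : mor A X X') (g g' : mor B Y Y'),
    bmap f (a *: g + g') = a *: bmap f g + bmap f g'
}.

Definition fix_right A B D (T : bifunctor A B D) (Y : B) : functor A D.
Proof.
exists (fun X => T X Y) (fun X X' f => bmap T f (id_mor Y)).
- by move=> X; rewrite bmap_id.
- by move=> X X' X'' g f; rewrite -bmap_comp comp_idl.
- by move=> X X' a f g; rewrite bmap_linl.
Defined.

Definition fix_left A B D (T : bifunctor A B D) (Y : A) : functor B D.
Proof.
exists (fun X => T Y X) (fun X X' f => bmap T (id_mor Y) f).
- by move=> X; rewrite bmap_id.
- by move=> X X' X'' g f; rewrite -bmap_comp comp_idl.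
- by move=> X X' a f g; rewrite bmap_linr.
Defined.

Definition bicomp_right A B B' D (T : bifunctor A B D) (F : functor B' B) :
  bifunctor A B' D.
Proof.
exists (fun X Y => T X (F Y)) (fun X X' Y Y' f g => bmap T f (fmap F g)).
- by move=> X Y; rewrite fmap_id bmap_id.
- by move=> *; rewrite fmap_comp bmap_comp.
- by move=> *; rewrite bmap_linl.
- by move=> *; rewrite fmap_lin bmap_linr.
Defined.

End LinearCategories.

Arguments fmap {k A B} _ {X Y} _.
Arguments bmap {k A B D} _ {X X' Y Y'} _ _.

Record moncat (k : fieldType) := MonCat {
  mon_cat :> lincat k;
  unit_ob : mon_cat;
  tens : bifunctor mon_cat mon_cat mon_cat;
  asc : forall X Y Z, iso (tens (tens X Y) Z) (tens X (tens Y Z));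
  lun : forall X, iso (tens unit_ob X) X;
  run : forall X, iso (tens X unit_ob) X;
  asc_nat : forall X X' Y Y' Z Z'
      (f : mor mon_cat X X') (g : mor mon_cat Y Y') (h : mor mon_cat Z Z'),
    asc X' Y' Z' ∘ bmap tens (bmap tens f g) h =
    bmap tens f (bmap tens g h) ∘ asc X Y Z;
  lun_nat : forall X Y (f : mor mon_cat X Y),
    lun Y ∘ bmap tens (id_mor unit_ob) f = f ∘ lun X;
  run_nat : forall X Y (f : mor mon_cat X Y),
    run Y ∘ bmap tens f (id_mor unit_ob) = f ∘ run X;
  pentagon : forall X Y Z W,
    asc X Y (tens Z W) ∘ asc (tens X Y) Z W =
    bmap tens (id_mor X) (asc Y Z W) ∘ asc X (tens Y Z) W
      ∘ bmap tens (asc X Y Z) (id_mor W);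
  triangle : forall X Y,
    bmap tens (id_mor X) (lun Y) ∘ asc X unit_ob Y = bmap tens (run X) (id_mor Y)
}.

Arguments unit_ob {k m}.
Arguments tens {k} m.
Arguments asc {k m} X Y Z.
Arguments lun {k m} X.
Arguments run {k m} X.

Notation "X ⊗ Y" := (tens _ X Y) (at level 40, left associativity) : cat_scope.
Notation "f ⊗' g" := (bmap (tens _) f g) (at level 40, left associativity) : cat_scope.

Record left_dual (k : fieldType) (C : moncat k) (X : C) := LeftDual {
  dual_ob : C;
  ev : mor C (dual_ob ⊗ X) unit_ob;
  coev : mor C unit_ob (X ⊗ dual_ob);
  zigzag : run X ∘ (id_mor X ⊗' ev) ∘ asc X dual_ob X ∘ (coev ⊗' id_mor X)
             ∘ bwd (lun X) = id_mor X;
  zagzig : lun dual_ob ∘ (ev ⊗' id_mor dual_ob) ∘ bwd (asc dual_ob X dual_ob)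
             ∘ (id_mor dual_ob ⊗' coev) ∘ bwd (run dual_ob) = id_mor dual_ob
}.

(* The second clause says that X has a right dual. *)
Definition rigid (k : fieldType) (C : moncat k) : Prop :=
  forall X : C, inhabited (left_dual X) /\
    exists (Y : C) (d : left_dual Y), dual_ob d = X.

Record fusion (k : fieldType) := Fusion {
  fus_mon :> moncat k;
  fus_semisimple : finite_semisimple fus_mon;
  fus_rigid : rigid fus_mon;
  fus_unit : simple_ob (unit_ob : fus_mon)
}.

(* [class_group eqv prod] is a group of which the elements are the classes of
   [T] modulo [eqv], and in which [x][y] = [z] holds exactly when [prod x y z];
   it is unique up to unique isomorphism. Tensor products of bimodule categories
   are only defined up to equivalence, hence the ternary relation. *)
Record class_group (T : Type) (eqv : T -> T -> Prop) (prod : T -> T -> T -> Prop) :=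
  ClassGroup {
    class_group_sort :> groupType;
    cls : T -> class_group_sort;
    cls_surj : forall g, exists x, cls x = g;
    cls_eq : forall x y, cls x = cls y <-> eqv x y;
    cls_mul : forall x y z, (cls x * cls y)%g = cls z <-> prod x y z
  }.

Arguments cls {T eqv prod} c _.

Section Grading.
Variables (k : fieldType) (C : moncat k).

(* The component of degree g consists of the direct sums of simple objects of
   degree g; the value of [deg] on objects that are not simple is irrelevant. *)
Definition grading (G : groupType) (deg : C -> G) : Prop :=
  (forall X Y, simple_ob X -> isomorphic X Y -> deg X = deg Y) /\
  (forall X Y Z (i : mor C Z (X ⊗ Y)),
     simple_ob X -> simple_ob Y -> simple_ob Z -> mono i -> deg Z = (deg X * deg Y)%g).

Definition faithful_grading (G : groupType) (deg : C -> G) : Prop :=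
  grading deg /\ forall g, exists X, simple_ob X /\ deg X = g.

Definition universal_grading (U : groupType) (deg : C -> U) : Prop :=
  faithful_grading deg /\
  forall (G : groupType) (deg' : C -> G), faithful_grading deg' ->
    exists p : {multiplicative U -> G},
      (forall X, simple_ob X -> deg' X = p (deg X)) /\
      forall q : {multiplicative U -> G},
        (forall X, simple_ob X -> deg' X = q (deg X)) -> q =1 p.

End Grading.

Record mult_char (U : groupType) (k : fieldType) := Character {
  char_fun :> U -> k;
  char_neq0 : forall u, char_fun u != 0;
  charM : forall u v, char_fun (u * v)%g = char_fun u * char_fun v
}.

Definition HomGroup (U : groupType) (k : fieldType) :=
  @class_group (mult_char U k) (fun c d => c =1 d)
    (fun c d e => forall u, c u * d u = e u).

Section Invertible.
Variables (k : fieldType) (C : moncat k).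

Definition invertible (X : C) : Prop :=
  exists Y, isomorphic (X ⊗ Y) unit_ob /\ isomorphic (Y ⊗ X) unit_ob.

Record inv_obj := InvObj { inv_ob :> C; inv_obP : invertible inv_ob }.

Definition InvGroup := @class_group inv_obj (fun g h => isomorphic g h)
  (fun g h l => isomorphic (g ⊗ h) l).

End Invertible.

Section MonoidalFunctors.
Variables (k : fieldType).
Implicit Types C D E : moncat k.

Record monfun C D := MonFun {
  mon_fun :> functor C D;
  mon_J : forall X Y, mor D (mon_fun X ⊗ mon_fun Y) (mon_fun (X ⊗ Y));
  mon_eps : mor D unit_ob (mon_fun unit_ob)
}.

Definition monoidal C D (F : monfun C D) : Prop :=
  [/\ (forall X Y, is_iso (mon_J F X Y)) /\ is_iso (mon_eps F),
      forall X X' Y Y' (f : mor C X X') (g : mor C Y Y'),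
        mon_J F X' Y' ∘ (fmap F f ⊗' fmap F g) = fmap F (f ⊗' g) ∘ mon_J F X Y,
      forall X Y Z,
        fmap F (asc X Y Z) ∘ mon_J F (X ⊗ Y) Z ∘ (mon_J F X Y ⊗' id_mor (F Z)) =
        mon_J F X (Y ⊗ Z) ∘ (id_mor (F X) ⊗' mon_J F Y Z) ∘ asc (F X) (F Y) (F Z),
      forall X, fmap F (lun X) ∘ mon_J F unit_ob X ∘ (mon_eps F ⊗' id_mor (F X)) =
        lun (F X)
    & forall X, fmap F (run X) ∘ mon_J F X unit_ob ∘ (id_mor (F X) ⊗' mon_eps F) =
        run (F X)].

Definition monfun_comp C D E (G : monfun D E) (F : monfun C D) : monfun C E :=
  @MonFun C E (fcomp G F)
    (fun X Y => fmap G (mon_J F X Y) ∘ mon_J G (F X) (F Y))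
    (fmap G (mon_eps F) ∘ mon_eps G).

Definition monfun_iso C D (F G : monfun C D) : Prop :=
  exists eta : forall X, mor D (F X) (G X),
    [/\ natural_iso eta,
        forall X Y, eta (X ⊗ Y) ∘ mon_J F X Y = mon_J G X Y ∘ (eta X ⊗' eta Y)
      & eta unit_ob ∘ mon_eps F = mon_eps G].

Record tensor_auteq C := TensorAuteq {
  ta_fun :> monfun C C;
  ta_monoidal : monoidal ta_fun;
  ta_equivalence : equivalence ta_fun
}.

Definition EqGroup C := @class_group (tensor_auteq C) (fun F G => monfun_iso F G)
  (fun F G H => monfun_iso (monfun_comp F G) H).

(* The functor X |-> (g ⊗ X) ⊗ g^*; its tensor structure contracts the inner
   g^* ⊗ g by the evaluation. *)
Definition conj_functor C (g : C) (d : left_dual g) : monfun C C :=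
  let g' := dual_ob d in
  let contract (Y : C) : mor C (g' ⊗ ((g ⊗ Y) ⊗ g')) (Y ⊗ g') :=
    (lun Y ⊗' id_mor g') ∘ ((ev d ⊗' id_mor Y) ⊗' id_mor g')
      ∘ (bwd (asc g' g Y) ⊗' id_mor g') ∘ bwd (asc g' (g ⊗ Y) g') in
  @MonFun C C (fcomp (fix_right (tens C) g') (fix_left (tens C) g))
    (fun X Y => (asc g X Y ⊗' id_mor g') ∘ bwd (asc (g ⊗ X) Y g')
                  ∘ (id_mor (g ⊗ X) ⊗' contract Y) ∘ asc (g ⊗ X) g' ((g ⊗ Y) ⊗ g'))
    ((bwd (run g) ⊗' id_mor g') ∘ coev d).

End MonoidalFunctors.

Section Center.
Variables (k : fieldType) (C : moncat k).

Record half_braided := HalfBraided {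
  hb_ob : C;
  hb_br : forall X, mor C (hb_ob ⊗ X) (X ⊗ hb_ob)
}.
Implicit Types Z W : half_braided.

Definition half_braiding Z : Prop :=
  [/\ forall X Y (f : mor C X Y),
        hb_br Z Y ∘ (id_mor (hb_ob Z) ⊗' f) = (f ⊗' id_mor (hb_ob Z)) ∘ hb_br Z X,
      forall X, is_iso (hb_br Z X)
    & forall X Y, hb_br Z (X ⊗ Y) =
        bwd (asc X Y (hb_ob Z)) ∘ (id_mor X ⊗' hb_br Z Y) ∘ asc X (hb_ob Z) Y
          ∘ (hb_br Z X ⊗' id_mor Y) ∘ bwd (asc (hb_ob Z) X Y)].

Definition hb_tensor Z W : half_braided :=
  @HalfBraided (hb_ob Z ⊗ hb_ob W) (fun X =>
    asc X (hb_ob Z) (hb_ob W) ∘ (hb_br Z X ⊗' id_mor (hb_ob W))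
      ∘ bwd (asc (hb_ob Z) X (hb_ob W)) ∘ (id_mor (hb_ob Z) ⊗' hb_br W X)
      ∘ asc (hb_ob Z) (hb_ob W) X).

Definition hb_unit : half_braided :=
  @HalfBraided unit_ob (fun X => bwd (run X) ∘ lun X).

Definition hb_isomorphic Z W : Prop :=
  exists f : mor C (hb_ob Z) (hb_ob W), is_iso f /\
    forall X, hb_br W X ∘ (f ⊗' id_mor X) = (id_mor X ⊗' f) ∘ hb_br Z X.

Record inv_center := InvCenter {
  ic_hb :> half_braided;
  ic_central : half_braiding ic_hb;
  ic_invertible : exists W, [/\ half_braiding W, hb_isomorphic (hb_tensor ic_hb W) hb_unit
                              & hb_isomorphic (hb_tensor W ic_hb) hb_unit]
}.

Definition InvZGroup := @class_group inv_center (fun x y => hb_isomorphic x y)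
  (fun x y z => hb_isomorphic (hb_tensor x y) z).

End Center.

Section Bimodules.
Variables (k : fieldType) (C : moncat k).

(* A category with left and right actions of C and constraint morphisms; the
   axioms are in [is_bimodule]. *)
Record bimod := Bimod {
  bm_cat :> lincat k;
  lact : bifunctor C bm_cat bm_cat;
  ract : bifunctor bm_cat C bm_cat;
  la : forall X Y m, mor bm_cat (lact (X ⊗ Y) m) (lact X (lact Y m));
  lu : forall m, mor bm_cat m (lact unit_ob m);
  ra : forall m X Y, mor bm_cat (ract (ract m X) Y) (ract m (X ⊗ Y));
  ru : forall m, mor bm_cat m (ract m unit_ob);
  mid : forall X m Y, mor bm_cat (ract (lact X m) Y) (lact X (ract m Y))
}.

End Bimodules.

Arguments lact {k C} b.
Arguments ract {k C} b.
Arguments la {k C} b X Y m.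
Arguments lu {k C} b m.
Arguments ra {k C} b m X Y.
Arguments ru {k C} b m.
Arguments mid {k C} b X m Y.

Notation "X ▷ m" := (lact _ X m) (at level 40, left associativity) : cat_scope.
Notation "m ◁ X" := (ract _ m X) (at level 40, left associativity) : cat_scope.
Notation "f ▷' g" := (bmap (lact _) f g) (at level 40, left associativity) : cat_scope.
Notation "f ◁' g" := (bmap (ract _) f g) (at level 40, left associativity) : cat_scope.

Section BimoduleTheory.
Variables (k : fieldType) (C : moncat k).
Implicit Types M N P : bimod C.

Definition left_module M : Prop :=
  [/\ forall X X' Y Y' m m' (f : mor C X X') (g : mor C Y Y') (h : mor M m m'),
        la M X' Y' m' ∘ ((f ⊗' g) ▷' h) = (f ▷' (g ▷' h)) ∘ la M X Y m,
      forall m m' (h : mor M m m'), lu M m' ∘ h = (id_mor unit_ob ▷' h) ∘ lu M m,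
      (forall X Y m, is_iso (la M X Y m)) /\ (forall m, is_iso (lu M m)),
      forall X Y Z m,
        la M X Y (Z ▷ m) ∘ la M (X ⊗ Y) Z m =
        (id_mor X ▷' la M Y Z m) ∘ la M X (Y ⊗ Z) m ∘ (asc X Y Z ▷' id_mor m)
    & forall X m, la M X unit_ob m ∘ (bwd (run X) ▷' id_mor m) = id_mor X ▷' lu M m].

Definition right_module M : Prop :=
  [/\ forall m m' X X' Y Y' (h : mor M m m') (f : mor C X X') (g : mor C Y Y'),
        ra M m' X' Y' ∘ ((h ◁' f) ◁' g) = (h ◁' (f ⊗' g)) ∘ ra M m X Y,
      forall m m' (h : mor M m m'), ru M m' ∘ h = (h ◁' id_mor unit_ob) ∘ ru M m,
      (forall m X Y, is_iso (ra M m X Y)) /\ (forall m, is_iso (ru M m)),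
      forall m X Y Z,
        ra M m X (Y ⊗ Z) ∘ ra M (m ◁ X) Y Z =
        (id_mor m ◁' asc X Y Z) ∘ ra M m (X ⊗ Y) Z ∘ (ra M m X Y ◁' id_mor Z)
    & forall m X, ra M m unit_ob X ∘ (ru M m ◁' id_mor X) = id_mor m ◁' bwd (lun X)].

Definition middle_associative M : Prop :=
  [/\ forall X X' m m' Y Y' (f : mor C X X') (h : mor M m m') (g : mor C Y Y'),
        mid M X' m' Y' ∘ ((f ▷' h) ◁' g) = (f ▷' (h ◁' g)) ∘ mid M X m Y,
      forall X m Y, is_iso (mid M X m Y),
      forall X Y m Z,
        la M X Y (m ◁ Z) ∘ mid M (X ⊗ Y) m Z =
        (id_mor X ▷' mid M Y m Z) ∘ mid M X (Y ▷ m) Z ∘ (la M X Y m ◁' id_mor Z)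
    & forall X m Y Z,
        mid M X m (Y ⊗ Z) ∘ ra M (X ▷ m) Y Z =
        (id_mor X ▷' ra M m Y Z) ∘ mid M X (m ◁ Y) Z ∘ (mid M X m Y ◁' id_mor Z)].

Definition is_bimodule M : Prop :=
  [/\ finite_semisimple M, left_module M, right_module M & middle_associative M].

Definition regular_bimod : bimod C :=
  @Bimod k C C (tens C) (tens C) (fun X Y m => asc X Y m) (fun m => bwd (lun m))
    (fun m X Y => asc m X Y) (fun m => bwd (run m)) (fun X m Y => asc X m Y).

(* C with the actions X ⊗ m and m ⊗ F(Y). *)
Definition twist (F : monfun C C) : bimod C :=
  @Bimod k C C (tens C) (bicomp_right (tens C) F)
    (fun X Y m => asc X Y m) (fun m => bwd (lun m))
    (fun m X Y => (id_mor m ⊗' mon_J F X Y) ∘ asc m (F X) (F Y))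
    (fun m => (id_mor m ⊗' mon_eps F) ∘ bwd (run m))
    (fun X m Y => asc X m (F Y)).

Definition left_module_functor M N (T : functor M N)
    (s : forall X m, mor N (T (X ▷ m)) (X ▷ T m)) : Prop :=
  [/\ forall X X' m m' (f : mor C X X') (h : mor M m m'),
        s X' m' ∘ fmap T (f ▷' h) = (f ▷' fmap T h) ∘ s X m,
      forall X m, is_iso (s X m),
      forall X Y m, la N X Y (T m) ∘ s (X ⊗ Y) m =
        (id_mor X ▷' s Y m) ∘ s X (Y ▷ m) ∘ fmap T (la M X Y m)
    & forall m, s unit_ob m ∘ fmap T (lu M m) = lu N (T m)].

Definition right_module_functor M N (T : functor M N)
    (t : forall m X, mor N (T m ◁ X) (T (m ◁ X))) : Prop :=
  [/\ forall m m' X X' (h : mor M m m') (f : mor C X X'),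
        t m' X' ∘ (fmap T h ◁' f) = fmap T (h ◁' f) ∘ t m X,
      forall m X, is_iso (t m X),
      forall m X Y, fmap T (ra M m X Y) ∘ t (m ◁ X) Y ∘ (t m X ◁' id_mor Y) =
        t m (X ⊗ Y) ∘ ra N (T m) X Y
    & forall m, t m unit_ob ∘ ru N (T m) = fmap T (ru M m)].

Record bimodfun M N := BimodFun {
  bf_fun :> functor M N;
  bf_l : forall X m, mor N (bf_fun (X ▷ m)) (X ▷ bf_fun m);
  bf_r : forall m X, mor N (bf_fun m ◁ X) (bf_fun (m ◁ X))
}.

Definition bimodule_functor M N (T : bimodfun M N) : Prop :=
  [/\ left_module_functor (bf_l T), right_module_functor (bf_r T)
    & forall X m Y,
        (id_mor X ▷' bf_r T m Y) ∘ mid N X (T m) Y ∘ (bf_l T X m ◁' id_mor Y) =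
        bf_l T X (m ◁ Y) ∘ fmap T (mid M X m Y) ∘ bf_r T (X ▷ m) Y].

Definition bimodfun_comp M N P (S : bimodfun N P) (T : bimodfun M N) :
    bimodfun M P :=
  @BimodFun M P (fcomp S T)
    (fun X m => bf_l S X (T m) ∘ fmap S (bf_l T X m))
    (fun m X => fmap S (bf_r T m X) ∘ bf_r S (T m) X).

Definition bimodfun_iso M N (S T : bimodfun M N) : Prop :=
  exists eta : forall m, mor N (S m) (T m),
    [/\ natural_iso eta,
        forall X m, bf_l T X m ∘ eta (X ▷ m) = (id_mor X ▷' eta m) ∘ bf_l S X m
      & forall m X, bf_r T m X ∘ (eta m ◁' id_mor X) = eta (m ◁ X) ∘ bf_r S m X].

Definition bimodule_equivalent M N : Prop :=
  exists T : bimodfun M N, bimodule_functor T /\ equivalence T.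

Definition left_module_equivalent M N : Prop :=
  exists (T : functor M N) (s : forall X m, mor N (T (X ▷ m)) (X ▷ T m)),
    left_module_functor s /\ equivalence T.

Definition binatural (A B D : lincat k) (S T : A -> B -> D)
    (Sm : forall X X' Y Y', mor A X X' -> mor B Y Y' -> mor D (S X Y) (S X' Y'))
    (Tm : forall X X' Y Y', mor A X X' -> mor B Y Y' -> mor D (T X Y) (T X' Y'))
    (eta : forall X Y, mor D (S X Y) (T X Y)) : Prop :=
  forall X X' Y Y' (f : mor A X X') (g : mor B Y Y'),
    eta X' Y' ∘ Sm X X' Y Y' f g = Tm X X' Y Y' f g ∘ eta X Y.

Definition balanced M N (E : lincat k) (B : bifunctor M N E)
    (b : forall m X n, mor E (B (m ◁ X) n) (B m (X ▷ n))) : Prop :=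
  [/\ forall m m' X X' n n' (f : mor M m m') (h : mor C X X') (g : mor N n n'),
        b m' X' n' ∘ bmap B (f ◁' h) g = bmap B f (h ▷' g) ∘ b m X n,
      forall m X n, is_iso (b m X n)
    & forall m X Y n,
        b m X (Y ▷ n) ∘ b (m ◁ X) Y n =
        bmap B (id_mor m) (la N X Y n) ∘ b m (X ⊗ Y) n ∘ bmap B (ra M m X Y) (id_mor n)].

(* Composition with (B, b) is an equivalence from the category of functors
   P -> E to the category of balanced bifunctors M x N -> E, for every finite
   semisimple E: it is essentially surjective, then fully faithful. *)
Definition universal_balanced M N P (B : bifunctor M N P)
    (b : forall m X n, mor P (B (m ◁ X) n) (B m (X ▷ n))) : Prop :=
  forall E : lincat k, finite_semisimple E ->
    (forall (D : bifunctor M N E) (d : forall m X n, mor E (D (m ◁ X) n) (D m (X ▷ n))),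
       balanced d ->
       exists (G : functor P E) (eta : forall m n, mor E (G (B m n)) (D m n)),
         [/\ @binatural M N E (fun m n => G (B m n)) D
               (fun _ _ _ _ f g => fmap G (bmap B f g))
               (fun _ _ _ _ f g => bmap D f g) eta,
             forall m n, is_iso (eta m n)
           & forall m X n,
               eta m (X ▷ n) ∘ fmap G (b m X n) = d m X n ∘ eta (m ◁ X) n]) /\
    (forall (G G' : functor P E) (theta : forall m n, mor E (G (B m n)) (G' (B m n))),
       @binatural M N E (fun m n => G (B m n)) (fun m n => G' (B m n))
         (fun _ _ _ _ f g => fmap G (bmap B f g))
         (fun _ _ _ _ f g => fmap G' (bmap B f g)) theta ->
       (forall m X n,
          theta m (X ▷ n) ∘ fmap G (b m X n) =
          fmap G' (b m X n) ∘ theta (m ◁ X) n) ->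
       exists eta : forall p, mor E (G p) (G' p),
         [/\ natural eta, forall m n, eta (B m n) = theta m n
           & forall eta' : forall p, mor E (G p) (G' p), natural eta' ->
               (forall m n, eta' (B m n) = theta m n) -> forall p, eta' p = eta p]).

(* P is M ⊠_C N as a bimodule category: the universal balanced bifunctor
   B : M x N -> P is a left module functor in M and a right module functor in N,
   compatibly with the balancing and with each other. *)
Definition relative_tensor M N P : Prop :=
  exists (B : bifunctor M N P)
         (b : forall m X n, mor P (B (m ◁ X) n) (B m (X ▷ n)))
         (l : forall X m n, mor P (B (X ▷ m) n) (X ▷ B m n))
         (r : forall m n X, mor P (B m n ◁ X) (B m (n ◁ X))),
  [/\ balanced b /\ universal_balanced b,
      (forall n, @left_module_functor M P (fix_right B n) (fun X m => l X m n)) /\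
      (forall X m n n' (g : mor N n n'),
         l X m n' ∘ bmap B (id_mor (X ▷ m)) g = (id_mor X ▷' bmap B (id_mor m) g) ∘ l X m n),
      (forall m, @right_module_functor N P (fix_left B m) (fun n X => r m n X)) /\
      (forall m m' n X (f : mor M m m'),
         r m' n X ∘ (bmap B f (id_mor n) ◁' id_mor X) = bmap B f (id_mor (n ◁ X)) ∘ r m n X),
      (forall X m Y n,
         (id_mor X ▷' b m Y n) ∘ l X (m ◁ Y) n ∘ bmap B (mid M X m Y) (id_mor n) =
         l X m (Y ▷ n) ∘ b (X ▷ m) Y n) /\
      (forall m X n Y,
         bmap B (id_mor m) (mid N X n Y) ∘ r m (X ▷ n) Y ∘ (b m X n ◁' id_mor Y) =
         b m X (n ◁ Y) ∘ r (m ◁ X) n Y)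
    & forall X m n Y,
        (id_mor X ▷' r m n Y) ∘ mid P X (B m n) Y ∘ (l X m n ◁' id_mor Y) =
        l X m (n ◁ Y) ∘ r (X ▷ m) n Y].

Definition invertible_bimodule M : Prop :=
  is_bimodule M /\
  exists N, [/\ is_bimodule N, relative_tensor M N regular_bimod
              & relative_tensor N M regular_bimod].

Record out_bimod := OutBimod {
  ob_bimod :> bimod C;
  ob_invertible : invertible_bimodule ob_bimod;
  ob_left : left_module_equivalent ob_bimod regular_bimod
}.

Definition OutGroup := @class_group out_bimod (fun x y => bimodule_equivalent x y)
  (fun x y z => relative_tensor x y z).

Record bimod_auteq := BimodAuteq {
  ba_fun :> bimodfun regular_bimod regular_bimod;
  ba_bimodule : bimodule_functor ba_fun;
  ba_equivalence : equivalence ba_fun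
}.

Definition Pi1BrPicGroup := @class_group bimod_auteq (fun S T => bimodfun_iso S T)
  (fun S T V => bimodfun_iso (bimodfun_comp S T) V).

(* The functor X |-> Z ⊗ X; it commutes with the left action by the half-braiding. *)
Definition tensoring (Z : half_braided C) : bimodfun regular_bimod regular_bimod :=
  @BimodFun regular_bimod regular_bimod (fix_left (tens C) (hb_ob Z))
    (fun X m => asc X (hb_ob Z) m ∘ (hb_br Z X ⊗' id_mor m) ∘ bwd (asc (hb_ob Z) X m))
    (fun m X => asc (hb_ob Z) m X).

End BimoduleTheory.

(* Main.v *)
(* Let T be a bimodule functor from the twist of C by F to a bimodule category M, and
   c = T(1). The isomorphisms c ◁ Y ≅ T(F Y) ≅ F(Y) ▷ c form a half-braiding on c twisted
   by F, and T is recovered as X |-> X ▷ c. For M = C and F = id this identifies the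
   bimodule auto-equivalences of C with the invertible objects of Z(C). For M = C and F
   an auto-equivalence it says that the twist of C by F is trivial exactly when some
   invertible g satisfies g ⊗ Y ≅ F(Y) ⊗ g naturally and coherently, that is, when F is
   conjugation by g; and conjugation by g is trivial exactly when g has a half-braiding.

   If M is equivalent to C as a left module category, then its right action is given by a
   tensor functor F, so M is the twist of C by F. The relative tensor product of the
   twists by F and G is the twist by their composite FG: over the twist by F, a balanced
   bifunctor is determined by its restriction to the unit. Invertibility of M therefore
   makes F an equivalence.

   A half-braiding on the unit object is a monoidal automorphism of the identity functor.
   By Schur's lemma it is given by a nonzero scalar on each simple object, and these
   scalars multiply along subobjects of tensor products. They thus define a faithful
   grading by the group of their values, which factors through the universal one. *)
Require Import Defs.
From HB Require Import structures.
From mathcomp Require Import all_boot all_order all_algebra.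
From mathcomp Require Import reals complex boolp.

Set Implicit Arguments.
Unset Strict Implicit.
Unset Printing Implicit Defensive.

Import GRing.Theory.
Local Open Scope ring_scope.
Local Open Scope cat_scope.

(** * Groups of classes *)

(** Each map is specified by a relation on representatives: [conjugates F g] for $F_-$, equivalence
    to a twist for $M_-$, the value at the unit for $\delta$. Choices of duals, inverses and
    products then never have to be compared by hand.

    Two obstacles shape the rest. Diagrams in $C$ are long, so they are checked in a strict model,
    the functors $X\otimes -$. Structure on a new functor is found by solving an equation under a
    fully faithful functor, and its axioms are checked after applying that functor. The relative
    tensor product is given only by a universal property with finite semisimple targets; to compare
    two of them as bimodules, the constraints and their axioms must be extended from the objects
    [B m n] to the whole category.

    An inverse $N$ of $M$ is not given as a left module equivalent to $C$. It becomes one because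
    $N\boxtimes_C M$ has the underlying left module category of $N$ once $M$ is a twist. So $N$ is
    the twist by some $G$; both $FG$ and $GF$ have trivial twists, hence are conjugations and
    equivalences, and this forces $F$ to be one. *)

Section ClassGroups.
Variables (T : Type) (eqv : T -> T -> Prop) (prod : T -> T -> T -> Prop).

(** A class is the predicate [eqv x] itself, so that equality of classes follows from
    extensionality; representatives are recovered by choice. *)
Definition class_of := {P : T -> Prop | exists x, P = eqv x}.
HB.instance Definition _ := gen_eqMixin class_of.
HB.instance Definition _ := gen_choiceMixin class_of.

Hypothesis eqv_refl : forall x, eqv x x.
Hypothesis eqv_sym : forall x y, eqv x y -> eqv y x.
Hypothesis eqv_trans : forall x y z, eqv x y -> eqv y z -> eqv x z.
Hypothesis prod_total : forall x y, exists z, prod x y z.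
Hypothesis prod_fun : forall x y z z', prod x y z -> (prod x y z' <-> eqv z z').
Hypothesis prod_congr : forall x x' y y' z,
  eqv x x' -> eqv y y' -> prod x y z -> prod x' y' z.
Hypothesis prodA : forall x y z a b c,
  prod x y a -> prod a z b -> prod y z c -> prod x c b.
Variable e : T.
Hypothesis prod1 : forall x, prod e x x.
Hypothesis prodV : forall x, exists y, prod y x e.

Definition to_class (x : T) : class_of := exist _ (eqv x) (ex_intro _ x erefl).

Lemma to_classP x y : to_class x = to_class y <-> eqv x y.
Proof.
split=> [/(congr1 sval) /= ->|exy]; first exact: eqv_refl.
apply: eq_exist => /=; apply: funext => z; apply: propext.
by split=> [|]; apply: eqv_trans => //; apply: eqv_sym.
Qed.

Definition class_repr (c : class_of) : T := sval (cid (svalP c)).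

Lemma class_reprK c : to_class (class_repr c) = c.
Proof.
rewrite /class_repr; case: c => P /= eP.
by apply: eq_exist => /=; case: cid => x /= ->.
Qed.

Definition prod_fn x y : T := sval (cid (prod_total x y)).
Lemma prod_fnP x y : prod x y (prod_fn x y).
Proof. by rewrite /prod_fn; case: cid. Qed.

Definition class_mul (c d : class_of) : class_of :=
  to_class (prod_fn (class_repr c) (class_repr d)).
Definition class_inv (c : class_of) : class_of :=
  to_class (sval (cid (prodV (class_repr c)))).

Lemma class_mulE x y z : class_mul (to_class x) (to_class y) = to_class z <-> prod x y z.
Proof.
have ex := (to_classP _ _).1 (class_reprK (to_class x)).
have ey := (to_classP _ _).1 (class_reprK (to_class y)).
rewrite /class_mul to_classP -(prod_fun _ (prod_fnP _ _)).
split; apply: prod_congr => //; exact: eqv_sym.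
Qed.

Lemma class_mulA : associative class_mul.
Proof.
move=> c d f; rewrite -(class_reprK c) -(class_reprK d) -(class_reprK f).
move: (class_repr c) (class_repr d) (class_repr f) => x y z.
have pxy := prod_fnP x y; have pyz := prod_fnP y z.
have pa := prod_fnP (prod_fn x y) z.
rewrite ((class_mulE _ _ _).2 pyz) ((class_mulE _ _ _).2 pxy).
rewrite ((class_mulE _ _ _).2 pa); apply/class_mulE.
exact: prodA pxy pa pyz.
Qed.

Lemma class_mul1 : left_id (to_class e) class_mul.
Proof. by move=> c; rewrite -(class_reprK c); apply/class_mulE. Qed.

Lemma class_mulV : left_inverse (to_class e) class_inv class_mul.
Proof.
move=> c; rewrite -{2}(class_reprK c); apply/class_mulE.
by case: cid.
Qed.

(** The usual trick: multiply [c * d] on the left by the unit, written as the product of [d] with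
    its own left inverse, and cancel [d] against [c]. *)
Lemma class_mulVr : right_inverse (to_class e) class_inv class_mul.
Proof.
move=> c; set d := class_inv c.
rewrite -[class_mul c d]class_mul1 -{1}(class_mulV d) -class_mulA.
by rewrite [class_mul d (class_mul c d)]class_mulA class_mulV class_mul1 class_mulV.
Qed.

Lemma class_mulr1 : right_id (to_class e) class_mul.
Proof. by move=> c; rewrite -(class_mulV c) class_mulA class_mulVr class_mul1. Qed.

Definition build_class_group : class_group eqv prod.
Proof.
pose G : groupType := HB.pack class_of
  (isGroup.Build class_of class_mulA class_mul1 class_mulr1 class_mulV class_mulVr).
apply: (@ClassGroup T eqv prod G to_class).
- by move=> g; exists (class_repr g); exact: class_reprK.
- exact: to_classP.
- exact: class_mulE.
Qed.

End ClassGroups.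

(** If $xy\sim e$ and $yz\sim e$, then $x\sim x(yz)\sim (xy)z\sim z$, hence $yx\sim yz\sim e$. This
    serves for bimodule auto-equivalences, where the counit of a quasi-inverse supplies a right
    inverse. *)
Lemma left_inverse_of_right (T : Type) (eqv : T -> T -> Prop) (op : T -> T -> T) (e : T) :
  (forall x, eqv x x) -> (forall x y, eqv x y -> eqv y x) ->
  (forall x y z, eqv x y -> eqv y z -> eqv x z) ->
  (forall x x' y y', eqv x x' -> eqv y y' -> eqv (op x y) (op x' y')) ->
  (forall x y z, eqv (op (op x y) z) (op x (op y z))) ->
  (forall x, eqv (op e x) x) -> (forall x, eqv (op x e) x) ->
  (forall x, exists y, eqv (op x y) e) ->
  forall x y, eqv (op x y) e -> eqv (op y x) e.
Proof.
move=> refl sym trans congr assoc op1l op1r opV x y xy; have [z yz] := opV y.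
have xz : eqv x z.
  apply: (trans _ (op x (op y z))).
    by apply: (trans _ (op x e)); [exact: sym|apply: congr => //; exact: sym].
  apply: (trans _ (op (op x y) z)); first exact: sym.
  by apply: (trans _ (op e z)); [exact: congr|exact: op1l].
by apply: (trans _ (op y z)) => //; exact: congr.
Qed.

Lemma build_class_group_op (T : Type) (eqv : T -> T -> Prop) (op : T -> T -> T) (e : T) :
  (forall x, eqv x x) -> (forall x y, eqv x y -> eqv y x) ->
  (forall x y z, eqv x y -> eqv y z -> eqv x z) ->
  (forall x x' y y', eqv x x' -> eqv y y' -> eqv (op x y) (op x' y')) ->
  (forall x y z, eqv (op (op x y) z) (op x (op y z))) ->
  (forall x, eqv (op e x) x) -> (forall x, exists y, eqv (op y x) e) ->
  class_group eqv (fun x y z => eqv (op x y) z).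
Proof.
move=> refl sym trans congr assoc op1 opV.
apply: (@build_class_group _ _ _ refl sym trans _ _ _ _ e op1 opV).
- by move=> x y; exists (op x y).
- by move=> x y z z' xyz; split; apply: trans => //; apply: sym.
- by move=> x x' y y' z exx' eyy'; apply: trans; apply: congr; apply: sym.
- move=> x y z a b c ea eb ec; apply: (trans _ (op a z)) => //.
  apply: (trans _ (op (op x y) z)); last exact: congr ea (refl _).
  apply: (trans _ (op x (op y z))); last exact: sym.
  exact: congr (refl _) (sym _ _ ec).
Qed.

(* The elements of [T] may live in a universe too large for the quotient of [T]
   itself to carry a group structure; [T'] is a small set of representatives. *)
Lemma transport_class_group (T' : Type) (eqv' : T' -> T' -> Prop) (prod' : T' -> T' -> T' -> Prop)
    (G : class_group eqv' prod') (T : Type) (eqv : T -> T -> Prop) (prod : T -> T -> T -> Prop)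
    (rep : T' -> T -> Prop) :
  (forall x, exists y, rep y x) -> (forall y, exists x, rep y x) ->
  (forall x x' y y', rep y x -> rep y' x' -> (eqv' y y' <-> eqv x x')) ->
  (forall x1 x2 x3 y1 y2 y3, rep y1 x1 -> rep y2 x2 -> rep y3 x3 ->
     (prod' y1 y2 y3 <-> prod x1 x2 x3)) ->
  class_group eqv prod.
Proof.
move=> repx repy eqvP prodP.
pose f x := sval (cid (repx x)).
have fP x : rep (f x) x by rewrite /f; case: cid.
apply: (@ClassGroup T eqv prod G (fun x => cls G (f x))).
- move=> g; have [y <-] := cls_surj g; have [x yx] := repy y; exists x.
  apply/(cls_eq G).
  (* Reflexivity at [x] is inherited from equality in [G] through the representative [y]. *)
  have exx : eqv x x by apply/(eqvP _ _ _ _ yx yx)/(cls_eq G).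
  exact/(eqvP _ _ _ _ (fP x) yx).
- by move=> x x'; rewrite cls_eq; exact: eqvP.
- by move=> x y z; rewrite cls_mul; exact: prodP.
Qed.

Section ClassGroupTheory.
Variables (T : Type) (eqv : T -> T -> Prop) (prod : T -> T -> T -> Prop).
Variable G : class_group eqv prod.

(** The identity is the only idempotent of a group, so the unit class is recognized from the product
    relation alone, in whichever group of classes is at hand. *)
Lemma cls1P x : cls G x = 1%g <-> prod x x x.
Proof.
rewrite -(cls_mul G); split=> [->|]; first by rewrite mulg1.
by move/(congr1 (fun y => (cls G x)^-1 * y)%g); rewrite mulKg mulVg.
Qed.

(** The maps of the exact sequence are all built from this: a map of representatives respecting both
    relations descends, since the class of [f x] is independent of the representative that choice
    picks. *)
Lemma cls_lift (T' : Type) (eqv' : T' -> T' -> Prop) (prod' : T' -> T' -> T' -> Prop)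
    (H : class_group eqv' prod') (f : T -> T') :
  (forall x y, eqv x y -> eqv' (f x) (f y)) ->
  (forall x y z, prod x y z -> prod' (f x) (f y) (f z)) ->
  exists phi : {multiplicative G -> H}, forall x, phi (cls G x) = cls H (f x).
Proof.
move=> feqv fprod.
pose phi (g : G) : H := cls H (f (sval (cid (cls_surj g)))).
have phiE x : phi (cls G x) = cls H (f x).
  by rewrite /phi; case: cid => y /= /cls_eq exy; apply/cls_eq/feqv.
have phiM : {morph phi : x y / (x * y)%g}.
  move=> g h; have [x <-] := cls_surj g; have [y <-] := cls_surj h.
  have [z ez] := cls_surj (cls G x * cls G y)%g.
  rewrite -ez !phiE; apply: esym; apply/(cls_mul H)/fprod.
  by apply/(cls_mul G).
pose mphi := isMultiplicative.Build G H phi phiM.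
pose psi : {multiplicative G -> H} := HB.pack phi mphi.
by exists psi.
Qed.

End ClassGroupTheory.

(** * Linear categories *)

Section Categories.
Variable k : fieldType.
Implicit Types A B D : lincat k.

Definition mcompA := @Defs.compA k.

(** Precomposition with a generalized element gives every composite a tail. Equations stated with a
    tail can then be rewritten at any position of a right-nested composite, which is what [by_elt]
    prepares. *)
Lemma eltP A (X Y : A) (f g : mor A X Y) :
  (forall W (x : mor A W X), f ∘ x = g ∘ x) -> f = g.
Proof. by move=> h; rewrite -(comp_idr f) -(comp_idr g). Qed.

Lemma elt2 A (X Y Y' Z : A) (a : mor A Y Z) (b : mor A X Y) (c : mor A Y' Z) (d : mor A X Y') :
  a ∘ b = c ∘ d -> forall W (x : mor A W X), a ∘ (b ∘ x) = c ∘ (d ∘ x).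
Proof. by move=> e W x; rewrite !mcompA e. Qed.

Lemma compDl A (X Y Z : A) (g h : mor A Y Z) (f : mor A X Y) :
  (g + h) ∘ f = g ∘ f + h ∘ f.
Proof. by have := comp_linl 1 g h f; rewrite !scale1r. Qed.

Lemma compDr A (X Y Z : A) (g : mor A Y Z) (f h : mor A X Y) :
  g ∘ (f + h) = g ∘ f + g ∘ h.
Proof. by have := comp_linr 1 g f h; rewrite !scale1r. Qed.

Lemma comp0l A (X Y Z : A) (f : mor A X Y) : (0 : mor A Y Z) ∘ f = 0.
Proof. by apply: (addrI (0 ∘ f)); rewrite -compDl !addr0. Qed.

Lemma comp0r A (X Y Z : A) (f : mor A Y Z) : f ∘ (0 : mor A X Y) = 0.
Proof. by apply: (addrI (f ∘ 0)); rewrite -compDr !addr0. Qed.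

Lemma compZl A (X Y Z : A) a (g : mor A Y Z) (f : mor A X Y) :
  (a *: g) ∘ f = a *: (g ∘ f).
Proof. by have := comp_linl a g 0 f; rewrite comp0l !addr0. Qed.

Lemma compZr A (X Y Z : A) a (g : mor A Y Z) (f : mor A X Y) :
  g ∘ (a *: f) = a *: (g ∘ f).
Proof. by have := comp_linr a g f 0; rewrite comp0r !addr0. Qed.

Lemma comp_suml A (X Y Z : A) I (r : seq I) (F : I -> mor A Y Z) (f : mor A X Y) :
  (\sum_(i <- r) F i) ∘ f = \sum_(i <- r) (F i ∘ f).
Proof.
elim: r => [|i r IH]; first by rewrite !big_nil comp0l.
by rewrite !big_cons compDl IH.
Qed.

Lemma comp_sumr A (X Y Z : A) I (r : seq I) (F : I -> mor A X Y) (f : mor A Y Z) :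
  f ∘ (\sum_(i <- r) F i) = \sum_(i <- r) (f ∘ F i).
Proof.
elim: r => [|i r IH]; first by rewrite !big_nil comp0r.
by rewrite !big_cons compDr IH.
Qed.

(* The value 0 at morphisms that are not isomorphisms is junk. *)
Definition inv A (X Y : A) (f : mor A X Y) : mor A Y X :=
  match pselect (is_iso f) with left h => sval (cid h) | right _ => 0 end.

Lemma invK A (X Y : A) (f : mor A X Y) : is_iso f -> inv f ∘ f = id_mor X.
Proof. by rewrite /inv; case: pselect => // h _; case: cid => ? []. Qed.

Lemma Kinv A (X Y : A) (f : mor A X Y) : is_iso f -> f ∘ inv f = id_mor Y.
Proof. by rewrite /inv; case: pselect => // h _; case: cid => ? []. Qed.

Lemma invKe A (X Y W : A) (f : mor A X Y) (x : mor A W X) :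
  is_iso f -> inv f ∘ (f ∘ x) = x.
Proof. by move=> h; rewrite mcompA invK // comp_idl. Qed.

Lemma Kinve A (X Y W : A) (f : mor A X Y) (x : mor A W Y) :
  is_iso f -> f ∘ (inv f ∘ x) = x.
Proof. by move=> h; rewrite mcompA Kinv // comp_idl. Qed.

Lemma fwdKe A (X Y W : A) (i : iso X Y) (x : mor A W X) : bwd i ∘ (i ∘ x) = x.
Proof. by rewrite mcompA fwdK comp_idl. Qed.

Lemma is_iso_id A (X : A) : is_iso (id_mor X).
Proof. by exists (id_mor X); rewrite comp_idl. Qed.

Lemma is_iso_fwd A (X Y : A) (i : iso X Y) : is_iso i.
Proof. by exists (bwd i); rewrite fwdK bwdK. Qed.

Lemma is_iso_bwd A (X Y : A) (i : iso X Y) : is_iso (bwd i).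
Proof. by exists i; rewrite fwdK bwdK. Qed.

Lemma is_iso_inv A (X Y : A) (f : mor A X Y) : is_iso f -> is_iso (inv f).
Proof. by move=> h; exists f; rewrite invK // Kinv. Qed.

Lemma is_iso_comp A (X Y Z : A) (g : mor A Y Z) (f : mor A X Y) :
  is_iso g -> is_iso f -> is_iso (g ∘ f).
Proof.
move=> [g' [g1 g2]] [f' [f1 f2]]; exists (f' ∘ g').
by rewrite !mcompA -(mcompA f') g1 comp_idr f1 -(mcompA g) f2 comp_idr g2.
Qed.

Lemma iso_epi A (X Y Z : A) (f : mor A X Y) (g h : mor A Y Z) :
  is_iso f -> g ∘ f = h ∘ f -> g = h.
Proof.
by move=> [f' [_ f2]] e; rewrite -(comp_idr g) -(comp_idr h) -f2 !mcompA e.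
Qed.

Lemma iso_mono A (X Y Z : A) (f : mor A Y Z) (g h : mor A X Y) :
  is_iso f -> f ∘ g = f ∘ h -> g = h.
Proof.
by move=> [f' [f1 _]] e; rewrite -(comp_idl g) -(comp_idl h) -f1 -!mcompA e.
Qed.

Lemma is_iso_compKl A (X Y Z : A) (g : mor A Y Z) (f : mor A X Y) :
  is_iso g -> is_iso (g ∘ f) -> is_iso f.
Proof.
move=> ig igf; have -> : f = inv g ∘ (g ∘ f) by rewrite invKe.
by apply: is_iso_comp => //; apply: is_iso_inv.
Qed.

Lemma is_iso_compKr A (X Y Z : A) (g : mor A Y Z) (f : mor A X Y) :
  is_iso f -> is_iso (g ∘ f) -> is_iso g.
Proof.
move=> i igf; have -> : g = (g ∘ f) ∘ inv f by rewrite -mcompA Kinv // comp_idr.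
by apply: is_iso_comp => //; apply: is_iso_inv.
Qed.

Lemma is_iso_fmap A B (F : functor A B) (X Y : A) (f : mor A X Y) :
  is_iso f -> is_iso (fmap F f).
Proof. by move=> [g [e1 e2]]; exists (fmap F g); rewrite -!fmap_comp e1 e2 !fmap_id. Qed.

Lemma is_iso_bmap A B D (T : bifunctor A B D) X X' Y Y' (f : mor A X X') (g : mor B Y Y') :
  is_iso f -> is_iso g -> is_iso (bmap T f g).
Proof.
move=> [f' [e1 e2]] [g' [e3 e4]]; exists (bmap T f' g').
by rewrite -!bmap_comp e1 e2 e3 e4 !bmap_id.
Qed.

Lemma inv_eq A (X Y : A) (f : mor A X Y) (g : mor A Y X) :
  is_iso f -> g ∘ f = id_mor X -> inv f = g.
Proof. by move=> i e; apply: (iso_epi i); rewrite invK. Qed.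

Lemma inv_fwd A (X Y : A) (i : iso X Y) : inv i = bwd i.
Proof. by apply: inv_eq; [exact: is_iso_fwd|exact: fwdK]. Qed.

Lemma isomorphic_refl A (X : A) : isomorphic X X.
Proof. by exists (id_mor X); exact: is_iso_id. Qed.

Lemma isomorphic_sym A (X Y : A) : isomorphic X Y -> isomorphic Y X.
Proof. by move=> [f i]; exists (inv f); exact: is_iso_inv. Qed.

Lemma isomorphic_trans A (X Y Z : A) : isomorphic X Y -> isomorphic Y Z -> isomorphic X Z.
Proof. by move=> [f i] [g j]; exists (g ∘ f); exact: is_iso_comp. Qed.

Lemma isomorphic_fmap A B (F : functor A B) (X Y : A) :
  isomorphic X Y -> isomorphic (F X) (F Y).
Proof. by move=> [f i]; exists (fmap F f); exact: is_iso_fmap. Qed.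

Lemma isomorphic_bmap A B D (T : bifunctor A B D) X X' Y Y' :
  isomorphic X X' -> isomorphic Y Y' -> isomorphic (T X Y) (T X' Y').
Proof. by move=> [f i] [g j]; exists (bmap T f g); exact: is_iso_bmap. Qed.

Section Linear.
Variables (A B : lincat k) (F : functor A B) (X Y : A).

Lemma fmapD (f g : mor A X Y) : fmap F (f + g) = fmap F f + fmap F g.
Proof. by have := fmap_lin F 1 f g; rewrite !scale1r. Qed.

Lemma fmap0 : fmap F (0 : mor A X Y) = 0.
Proof. by apply: (addrI (fmap F 0)); rewrite -fmapD !addr0. Qed.

Lemma fmap_sum I (r : seq I) (f : I -> mor A X Y) :
  fmap F (\sum_(i <- r) f i) = \sum_(i <- r) fmap F (f i).
Proof.
elim: r => [|i r IH]; first by rewrite !big_nil fmap0.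
by rewrite !big_cons fmapD IH.
Qed.

End Linear.

Section Bifunctors.
Variables (A B D : lincat k) (T : bifunctor A B D).

Lemma bmapLc X Y Z W (g : mor A Y Z) (f : mor A X Y) :
  bmap T (g ∘ f) (id_mor W) = bmap T g (id_mor W) ∘ bmap T f (id_mor W).
Proof. by rewrite -bmap_comp comp_idl. Qed.

Lemma bmapRc X Y Z W (g : mor B Y Z) (f : mor B X Y) :
  bmap T (id_mor W) (g ∘ f) = bmap T (id_mor W) g ∘ bmap T (id_mor W) f.
Proof. by rewrite -bmap_comp comp_idl. Qed.

Lemma bmapLR X X' Y Y' (f : mor A X X') (g : mor B Y Y') :
  bmap T f g = bmap T f (id_mor Y') ∘ bmap T (id_mor X) g.
Proof. by rewrite -bmap_comp comp_idl comp_idr. Qed.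

Lemma bmapRL X X' Y Y' (f : mor A X X') (g : mor B Y Y') :
  bmap T f g = bmap T (id_mor X') g ∘ bmap T f (id_mor Y).
Proof. by rewrite -bmap_comp comp_idl comp_idr. Qed.

Lemma bmap_swap X X' Y Y' (f : mor A X X') (g : mor B Y Y') W (x : mor D W _) :
  bmap T f (id_mor Y') ∘ (bmap T (id_mor X) g ∘ x) =
  bmap T (id_mor X') g ∘ (bmap T f (id_mor Y) ∘ x).
Proof. by rewrite !mcompA -bmapLR -bmapRL. Qed.

Lemma bmapL3 X X' X'' X''' Y Y' (a : mor A X'' X''') (b : mor B Y Y')
    (c : mor A X' X'') (d : mor A X X') W (x : mor D W _) :
  bmap T a b ∘ (bmap T c (id_mor Y) ∘ (bmap T d (id_mor Y) ∘ x)) =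
  bmap T (a ∘ (c ∘ d)) b ∘ x.
Proof. by rewrite !mcompA -!bmap_comp !comp_idr. Qed.

Lemma bmapR3 X X' Y Y' Y'' Y''' (a : mor A X X') (b : mor B Y'' Y''')
    (c : mor B Y' Y'') (d : mor B Y Y') W (x : mor D W _) :
  bmap T a b ∘ (bmap T (id_mor X) c ∘ (bmap T (id_mor X) d ∘ x)) =
  bmap T a (b ∘ (c ∘ d)) ∘ x.
Proof. by rewrite !mcompA -!bmap_comp !comp_idr. Qed.

Lemma bmapDl X X' Y Y' (f f' : mor A X X') (g : mor B Y Y') :
  bmap T (f + f') g = bmap T f g + bmap T f' g.
Proof. by have := bmap_linl T 1 f f' g; rewrite !scale1r. Qed.

Lemma bmapDr X X' Y Y' (f : mor A X X') (g g' : mor B Y Y') :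
  bmap T f (g + g') = bmap T f g + bmap T f g'.
Proof. by have := bmap_linr T 1 f g g'; rewrite !scale1r. Qed.

Lemma bmap0l X X' Y Y' (g : mor B Y Y') : bmap T (0 : mor A X X') g = 0.
Proof. by apply: (addrI (bmap T 0 g)); rewrite -bmapDl !addr0. Qed.

Lemma bmap0r X X' Y Y' (f : mor A X X') : bmap T f (0 : mor B Y Y') = 0.
Proof. by apply: (addrI (bmap T f 0)); rewrite -bmapDr !addr0. Qed.

Lemma bmapZl X X' Y Y' a (f : mor A X X') (g : mor B Y Y') :
  bmap T (a *: f) g = a *: bmap T f g.
Proof. by have := bmap_linl T a f 0 g; rewrite bmap0l !addr0. Qed.

Lemma bmapZr X X' Y Y' a (f : mor A X X') (g : mor B Y Y') :
  bmap T f (a *: g) = a *: bmap T f g.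
Proof. by have := bmap_linr T a f g 0; rewrite bmap0r !addr0. Qed.

End Bifunctors.

Definition faithful A B (F : functor A B) : Prop :=
  forall X Y (f g : mor A X Y), fmap F f = fmap F g -> f = g.
Definition full A B (F : functor A B) : Prop :=
  forall X Y (g : mor B (F X) (F Y)), exists f, fmap F f = g.
Definition ess_surj A B (F : functor A B) : Prop :=
  forall Y : B, exists X : A, isomorphic (F X) Y.

Lemma ff_is_iso A B (F : functor A B) X Y (f : mor A X Y) :
  faithful F -> full F -> is_iso (fmap F f) -> is_iso f.
Proof.
move=> faF fuF [g [e1 e2]]; have [h eh] := fuF _ _ g.
by exists h; split; apply: faF; rewrite fmap_comp eh fmap_id.
Qed.

Lemma natural_iso_inv A B (F G : functor A B) (eta : forall X, mor B (F X) (G X)) :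
  natural_iso eta -> @natural_iso _ _ _ G F (fun X => inv (eta X)).
Proof.
move=> [nat i]; split=> [X Y f|X]; last exact: is_iso_inv.
apply: (iso_mono (i Y)); rewrite !mcompA Kinv // comp_idl nat.
by rewrite -mcompA Kinv // comp_idr.
Qed.

Lemma natural_iso_faithful A B (F G : functor A B) eta :
  @natural_iso _ _ _ F G eta -> faithful F -> faithful G.
Proof.
move=> [nat i] fa X Y f g e; apply: fa; apply: (iso_mono (i Y)).
by rewrite !nat e.
Qed.

Lemma natural_iso_full A B (F G : functor A B) eta :
  @natural_iso _ _ _ F G eta -> full F -> full G.
Proof.
move=> [nat i] fu X Y g; have [f ef] := fu _ _ (inv (eta Y) ∘ g ∘ eta X).
exists f; apply: (iso_epi (i X)).
by rewrite -nat ef !mcompA Kinv // comp_idl.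
Qed.

Lemma natural_iso_ess_surj A B (F G : functor A B) eta :
  @natural_iso _ _ _ F G eta -> ess_surj F -> ess_surj G.
Proof.
move=> [nat i] es Y; have [X iX] := es Y; exists X.
by apply: isomorphic_trans iX; apply: isomorphic_sym; exists (eta X).
Qed.

Lemma equivalence_faithful A B (F : functor A B) : equivalence F -> faithful F.
Proof.
move=> [G [[eta heta] _]].
have := natural_iso_faithful (natural_iso_inv heta) (fun X Y f g e => e).
by move=> fa X Y f g e; apply: fa => /=; rewrite e.
Qed.

Lemma equivalence_full A B (F : functor A B) : equivalence F -> full F.
Proof.
move=> h; have [G [[eta heta] [eps heps]]] := h.
have GF := natural_iso_full (natural_iso_inv heta) (fun X Y g => ex_intro _ g erefl).
(* [G] is an equivalence with the same data in exchanged roles. Its faithfulness reduces fullness of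
   [F] to that of [GF]. *)
have faG : faithful G.
  apply: (@equivalence_faithful _ _ G); exists F; split; first by exists eps.
  by exists eta.
by move=> X Y g; have [f ef] := GF _ _ (fmap G g); exists f; apply: faG.
Qed.

Lemma equivalence_ess_surj A B (F : functor A B) : equivalence F -> ess_surj F.
Proof. by move=> [G [_ [eps heps]]] Y; exists (G Y), (eps Y); apply: heps.2. Qed.

Section QuasiInverse.
Variables (A B : lincat k) (F : functor A B).
Hypotheses (faF : faithful F) (fuF : full F) (esF : ess_surj F).

(** Objects are chosen by essential surjectivity; the action on morphisms is then the only one
    making [eps] natural, and faithfulness of [F] turns this uniqueness into functoriality and
    linearity. *)
Lemma quasi_inverse : exists (G : functor B A) (eps : forall Y, mor B (F (G Y)) Y),
  @natural_iso _ _ _ (fcomp F G) (fid B) eps.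
Proof.
pose G0 Y := sval (cid (esF Y)).
have [eps ieps] : exists eps : forall Y, mor B (F (G0 Y)) Y, forall Y, is_iso (eps Y).
  have h Y : exists f : mor B (F (G0 Y)) Y, is_iso f by rewrite /G0; case: cid.
  by exists (fun Y => sval (cid (h Y))) => Y; case: cid.
pose G1 Y Y' (f : mor B Y Y') : mor A (G0 Y) (G0 Y') :=
  sval (cid (fuF (inv (eps Y') ∘ f ∘ eps Y))).
have G1E Y Y' (f : mor B Y Y') : fmap F (G1 _ _ f) = inv (eps Y') ∘ f ∘ eps Y.
  by rewrite /G1; case: cid.
have Gid Y : G1 _ _ (id_mor Y) = id_mor (G0 Y).
  by apply: faF; rewrite G1E comp_idr invK // fmap_id.
have Gcomp X Y Z (g : mor B Y Z) (f : mor B X Y) : G1 _ _ (g ∘ f) = G1 _ _ g ∘ G1 _ _ f.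
  by apply: faF; rewrite fmap_comp !G1E -!mcompA Kinve.
have Glin X Y a (f g : mor B X Y) : G1 _ _ (a *: f + g) = a *: G1 _ _ f + G1 _ _ g.
  by apply: faF; rewrite fmap_lin !G1E comp_linr comp_linl.
exists (Functor Gid Gcomp Glin), eps; split=> // X Y f /=.
by rewrite G1E -mcompA Kinve.
Qed.

Lemma ff_es_equivalence : equivalence F.
Proof.
have [G [eps heps]] := quasi_inverse; exists G; split; last by exists eps.
pose eta X : mor A (G (F X)) X := sval (cid (fuF (eps (F X)))).
have etaE X : fmap F (eta X) = eps (F X) by rewrite /eta; case: cid.
exists eta; split=> [X Y f|X] /=.
  by apply: faF; rewrite !fmap_comp !etaE; apply: heps.1.
by apply: (ff_is_iso faF fuF); rewrite etaE; apply: heps.2.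
Qed.

End QuasiInverse.

Lemma equivalence_id A : equivalence (fid A).
Proof. by apply: ff_es_equivalence => [X Y f g|X Y g|X] //; [exists g|exists X; exact: isomorphic_refl]. Qed.

Lemma equivalence_comp A B D (G : functor B D) (F : functor A B) :
  equivalence G -> equivalence F -> equivalence (fcomp G F).
Proof.
move=> eG eF; apply: ff_es_equivalence.
- by move=> X Y f g /(equivalence_faithful eG)/(equivalence_faithful eF).
- move=> X Y g; have [f <-] := equivalence_full eG g.
  by have [h <-] := equivalence_full eF f; exists h.
- move=> Z; have [Y iY] := equivalence_ess_surj eG Z.
  have [X iX] := equivalence_ess_surj eF Y; exists X.
  by apply: isomorphic_trans iY; apply: (isomorphic_fmap G iX).
Qed.

Lemma equivalence_cancel_l A B D (G : functor B D) (F : functor A B) :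
  equivalence G -> equivalence (fcomp G F) -> equivalence F.
Proof.
move=> eG eGF; apply: ff_es_equivalence.
- by move=> X Y f g e; apply: (equivalence_faithful eGF); rewrite /= e.
- move=> X Y g; have [f /= ef] := equivalence_full eGF (fmap G g).
  by exists f; apply: (equivalence_faithful eG).
- move=> Y; have [X [f i]] := equivalence_ess_surj eGF (G Y); exists X.
  have [g eg] := equivalence_full eG f; exists g.
  by apply: (ff_is_iso (equivalence_faithful eG) (equivalence_full eG)); rewrite eg.
Qed.

(** Faithfulness of [F] comes from [GF] and essential surjectivity from [FG]. Fullness needs both:
    [GF] is full, and [G] is faithful because [FG] is. *)
Lemma equivalence_two_sided A (F G : functor A A) :
  equivalence (fcomp G F) -> equivalence (fcomp F G) -> equivalence F.
Proof.
move=> eGF eFG.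
have faG : faithful G.
  by move=> X Y f g e; apply: (equivalence_faithful eFG); rewrite /= e.
apply: ff_es_equivalence.
- by move=> X Y f g e; apply: (equivalence_faithful eGF); rewrite /= e.
- move=> X Y g; have [f /= ef] := equivalence_full eGF (fmap G g).
  by exists f; apply: faG.
- by move=> Y; have [X i] := equivalence_ess_surj eFG Y; exists (G X).
Qed.

Lemma equivalence_natural_iso A B (F G : functor A B) eta :
  @natural_iso _ _ _ F G eta -> equivalence F -> equivalence G.
Proof.
move=> h eF; apply: ff_es_equivalence.
- exact: natural_iso_faithful h (equivalence_faithful eF).
- exact: natural_iso_full h (equivalence_full eF).
- exact: natural_iso_ess_surj h (equivalence_ess_surj eF).
Qed.

End Categories.

Ltac by_elt := apply: eltP => ? ?; rewrite -?mcompA.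

(** * Strictification *)

Section Strictification.
Variables (k : fieldType) (C : moncat k).

(** Kelly's argument: [unit_ob ⊗ -] is faithful since [lun] is a natural isomorphism, and after
    applying it the claim follows from a pentagon with two unit entries, the triangle axiom and
    naturality. *)
Lemma lun_tens (X Y : C) : lun (X ⊗ Y) ∘ asc unit_ob X Y = lun X ⊗' id_mor Y.
Proof.
have cancel1 (Z W : C) (f g : mor C Z W) :
    id_mor unit_ob ⊗' f = id_mor unit_ob ⊗' g -> f = g.
  move=> e; apply: (iso_epi (is_iso_fwd (lun Z))).
  by rewrite -!lun_nat e.
apply: cancel1; apply: (iso_epi (is_iso_fwd (asc unit_ob (unit_ob ⊗ X) Y))).
apply: (@iso_epi _ _ _ _ _ (asc unit_ob unit_ob X ⊗' id_mor Y)).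
  by apply: is_iso_bmap; [exact: is_iso_fwd|exact: is_iso_id].
rewrite -asc_nat -[RHS]mcompA -bmapLc triangle bmapRc.
rewrite -!mcompA (mcompA (_ ⊗' fwd (asc _ _ _))) -pentagon mcompA triangle.
by rewrite -bmap_id -asc_nat.
Qed.

(** The strict model consists of endofunctors: an object is replaced by $X\otimes -$ and the tensor
    product by composition. A tree records a bracketed word, [act] is the endofunctor it denotes,
    and units act as the identity, so they disappear. *)
Inductive tree := Leaf of C | One | Node of tree & tree.

Fixpoint tree_ob (a : tree) : C :=
  match a with
  | Leaf X => X | One => unit_ob | Node a b => tree_ob a ⊗ tree_ob b
  end.

Fixpoint act (a : tree) (T : C) : C :=
  match a with Leaf X => X ⊗ T | One => T | Node a b => act a (act b T) end.

Fixpoint actm (a : tree) (T T' : C) (f : mor C T T') : mor C (act a T) (act a T') :=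
  match a return mor C (act a T) (act a T') with
  | Leaf X => id_mor X ⊗' f | One => f | Node a b => actm a (actm b f)
  end.

Fixpoint flatten (a : tree) (T : C) : mor C (tree_ob a ⊗ T) (act a T) :=
  match a return mor C (tree_ob a ⊗ T) (act a T) with
  | Leaf X => id_mor (X ⊗ T) | One => lun T
  | Node a b => flatten a (act b T) ∘ (id_mor (tree_ob a) ⊗' flatten b T)
                  ∘ asc (tree_ob a) (tree_ob b) T
  end.

(* Reassociates [f ⊗' id_mor T] so that its source and target become right-nested
   products; under this translation associators and unitors become identities. *)
Definition hat (a b : tree) (f : mor C (tree_ob a) (tree_ob b)) (T : C) :
    mor C (act a T) (act b T) :=
  locked (flatten b T ∘ (f ⊗' id_mor T) ∘ inv (flatten a T)).

Lemma actm_comp a T T' T'' (g : mor C T' T'') (f : mor C T T') :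
  actm a (g ∘ f) = actm a g ∘ actm a f.
Proof.
elim: a T T' T'' g f => [X|//|a IHa b IHb] T T' T'' g f /=; first exact: bmapRc.
by rewrite IHb IHa.
Qed.

Lemma is_iso_flatten a T : is_iso (flatten a T).
Proof.
elim: a T => [X|//|a IHa b IHb] T /=; first exact: is_iso_id.
  exact: is_iso_fwd.
apply: is_iso_comp; last exact: is_iso_fwd.
by apply: is_iso_comp => //; apply: is_iso_bmap => //; apply: is_iso_id.
Qed.

Lemma flatten_nat a T T' (f : mor C T T') :
  flatten a T' ∘ (id_mor (tree_ob a) ⊗' f) = actm a f ∘ flatten a T.
Proof.
elim: a T T' f => [X|//|a IHa b IHb] T T' f /=; first by rewrite comp_idl comp_idr.
  exact: lun_nat.
rewrite -mcompA -bmap_id asc_nat !mcompA -(mcompA (flatten a _)) -bmapRc IHb.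
by rewrite bmapRc !mcompA IHa.
Qed.

(** The tail [unit_ob] already suffices, because [- ⊗ unit_ob] is faithful by naturality of [run].
    All tails are offered since the rewriting rules shift them. *)
Lemma hat_eq a b f g : (forall T, @hat a b f T = hat g T) -> f = g.
Proof.
move=> /(_ unit_ob); rewrite /hat -!lock => e.
have {}e := iso_mono (is_iso_flatten b _)
  (iso_epi (is_iso_inv (is_iso_flatten a _)) e).
by apply: (iso_epi (is_iso_fwd (run _))); rewrite -!run_nat e.
Qed.

Lemma hat_flatten a b f T : @hat a b f T ∘ flatten a T = flatten b T ∘ (f ⊗' id_mor T).
Proof. by rewrite /hat -lock -mcompA invK ?comp_idr //; apply: is_iso_flatten. Qed.

Lemma hatP a b f T h :
  h ∘ flatten a T = flatten b T ∘ (f ⊗' id_mor T) -> @hat a b f T = h.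
Proof. by rewrite -hat_flatten => /(iso_epi (is_iso_flatten a T)). Qed.

Lemma hat_id a T : hat (a := a) (b := a) (id_mor (tree_ob a)) T = id_mor (act a T).
Proof. by apply: hatP; rewrite bmap_id comp_idl comp_idr. Qed.

Lemma hat_comp a b c g f T :
  hat (a := a) (b := c) (g ∘ f) T = hat (a := b) (b := c) g T ∘ hat (a := a) (b := b) f T.
Proof. by apply: hatP; rewrite -mcompA hat_flatten mcompA hat_flatten bmapLc -mcompA. Qed.

Lemma hat_lw c a b f T :
  hat (a := Node c a) (b := Node c b) (id_mor (tree_ob c) ⊗' f) T = actm c (hat f T).
Proof.
apply: hatP => /=.
rewrite -!mcompA (mcompA (actm c _)) -flatten_nat -!mcompA; congr (_ ∘ _).
by rewrite mcompA -bmapRc hat_flatten asc_nat bmapRc mcompA.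
Qed.

Lemma hat_rw c a b f T :
  hat (a := Node a c) (b := Node b c) (f ⊗' id_mor (tree_ob c)) T = hat f (act c T).
Proof.
apply: hatP => /=; rewrite !mcompA hat_flatten -[RHS]mcompA asc_nat bmap_id.
by rewrite -!mcompA; congr (_ ∘ _); rewrite !mcompA -bmapLR -bmapRL.
Qed.

Lemma hat_tens a b c d f g T :
  hat (a := Node a c) (b := Node b d) (f ⊗' g) T =
  hat f (act d T) ∘ actm a (hat g T).
Proof. by rewrite bmapLR (@hat_comp _ (Node a d)) hat_rw hat_lw. Qed.

(** This is the pentagon together with naturality of the associator. In the same way [hat_lun] rests
    on [lun_tens] and [hat_run] on the triangle axiom. *)
Lemma hat_asc a b c T :
  hat (a := Node (Node a b) c) (b := Node a (Node b c))
    (asc (tree_ob a) (tree_ob b) (tree_ob c)) T = id_mor _.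
Proof.
apply: hatP => /=; rewrite comp_idl -!mcompA; congr (_ ∘ _).
rewrite !bmapRc -!mcompA (mcompA (id_mor _ ⊗' (asc _ _ _ : mor _ _ _))) -pentagon.
by rewrite -bmap_id !mcompA -(mcompA _ (asc _ _ _ : mor _ _ _)) asc_nat !mcompA.
Qed.

Lemma hat_inv a b f T : is_iso f ->
  hat (a := b) (b := a) (inv f) T = inv (hat (a := a) (b := b) f T).
Proof.
move=> i; apply/esym/inv_eq; last by rewrite -hat_comp invK // hat_id.
rewrite /hat -lock; apply: is_iso_comp; last exact/is_iso_inv/is_iso_flatten.
by apply: is_iso_comp; [exact: is_iso_flatten|apply: is_iso_bmap => //; exact: is_iso_id].
Qed.

Lemma is_iso_hat a b f T : is_iso f -> is_iso (@hat a b f T).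
Proof.
move=> i; exists (hat (inv f) T).
by rewrite -!hat_comp invK // Kinv // !hat_id.
Qed.

Lemma hat_bwd a b (f : iso (tree_ob a) (tree_ob b)) T (h : mor C (act a T) (act b T)) :
  @hat a b f T = h -> hat (bwd f) T = inv h.
Proof. by move=> <-; rewrite -inv_fwd hat_inv //; exact: is_iso_fwd. Qed.

Lemma inv_id (X : C) : inv (id_mor X) = id_mor X.
Proof. by apply: inv_eq; [exact: is_iso_id|rewrite comp_idl]. Qed.

Lemma hat_ascV a b c T :
  hat (b := Node (Node a b) c) (a := Node a (Node b c))
    (bwd (asc (tree_ob a) (tree_ob b) (tree_ob c))) T = id_mor _.
Proof. by rewrite (@hat_bwd (Node (Node a b) c) (Node a (Node b c)) _ _ _ (hat_asc a b c T)) inv_id. Qed.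

Lemma hat_lun a T : hat (a := Node One a) (b := a) (lun (tree_ob a)) T = id_mor _.
Proof.
apply: hatP => /=; rewrite comp_idl.
by rewrite lun_nat -mcompA lun_tens.
Qed.

Lemma hat_run a T : hat (a := Node a One) (b := a) (run (tree_ob a)) T = id_mor _.
Proof. by apply: hatP => /=; rewrite comp_idl -mcompA triangle. Qed.

Lemma hat_lunV a T : hat (b := Node One a) (a := a) (bwd (lun (tree_ob a))) T = id_mor _.
Proof. by rewrite (@hat_bwd (Node One a) a _ _ _ (hat_lun a T)) inv_id. Qed.

Lemma hat_runV a T : hat (b := Node a One) (a := a) (bwd (run (tree_ob a))) T = id_mor _.
Proof. by rewrite (@hat_bwd (Node a One) a _ _ _ (hat_run a T)) inv_id. Qed.

(** A morphism acting on the first factors commutes with one acting on the tail: this is the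
    interchange law of the strict model. The tactics below do not apply it, so proofs that need it
    invoke it with explicit trees. *)
Lemma hat_nat a b f T T' (h : mor C T T') W (x : mor C W _) :
  @hat a b f T' ∘ (actm a h ∘ x) = actm b h ∘ (hat f T ∘ x).
Proof.
rewrite !mcompA; congr (_ ∘ _); apply: (iso_epi (is_iso_flatten a T)).
rewrite -!mcompA hat_flatten -flatten_nat !mcompA hat_flatten -flatten_nat.
by rewrite -!mcompA -bmapLR -bmapRL.
Qed.

Lemma hat_leaf (X Y : C) (f : mor C X Y) T :
  hat (a := Leaf X) (b := Leaf Y) f T = f ⊗' id_mor T.
Proof. by apply: hatP; rewrite comp_idl comp_idr. Qed.

End Strictification.

Arguments Leaf {k C} _.
Arguments One {k C}.
Arguments Node {k C} _ _.
Arguments hat {k C} a b f T : simpl never.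

Ltac reify X :=
  lazymatch X with
  | bob (tens _) ?Y ?Z => let a := reify Y in let b := reify Z in constr:(Node a b)
  | @unit_ob _ ?C => constr:(@One _ C)
  | _ => constr:(Leaf X)
  end.

Ltac hat_step a b f T :=
  lazymatch f with
  | @mcomp _ _ _ ?Y _ ?g ?h =>
      let m := reify Y in rewrite (@hat_comp _ _ a m b g h T)
  | @id_mor _ _ _ => rewrite (@hat_id _ _ a T)
  | @bmap _ _ _ _ (tens _) _ _ _ _ ?g ?h =>
      lazymatch a with
      | Node ?a1 ?a2 =>
        lazymatch b with
        | Node ?b1 ?b2 =>
          lazymatch h with
          | id_mor _ => rewrite (@hat_rw _ _ a2 a1 b1 g T)
          | _ =>
            lazymatch g with
            | id_mor _ => rewrite (@hat_lw _ _ a1 a2 b2 h T)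
            | _ => rewrite (@hat_tens _ _ a1 b1 a2 b2 g h T)
            end
          end
        end
      end
  | fwd (asc _ _ _) =>
      lazymatch a with Node (Node ?a1 ?a2) ?a3 => rewrite (@hat_asc _ _ a1 a2 a3 T) end
  | bwd (asc _ _ _) =>
      lazymatch b with Node (Node ?a1 ?a2) ?a3 => rewrite (@hat_ascV _ _ a1 a2 a3 T) end
  | fwd (lun _) => rewrite (@hat_lun _ _ b T)
  | bwd (lun _) => rewrite (@hat_lunV _ _ a T)
  | fwd (run _) => rewrite (@hat_run _ _ b T)
  | bwd (run _) => rewrite (@hat_runV _ _ a T)
  end.

Ltac hats :=
  repeat match goal with
  | |- context [@hat _ _ ?a ?b ?f ?T] => progress (hat_step a b f T)
  end;
  cbn [act actm tree_ob];
  rewrite ?actm_comp ?bmapRc ?comp_idl ?comp_idr ?bmap_id ?comp_idl ?comp_idr -?mcompA.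

(** Passing to [hat] at an arbitrary tail erases associators and unitors, so only the morphisms that
    carry content remain to be compared. *)
Ltac strictify_in T :=
  lazymatch goal with
  | |- @eq ?S ?f ?g =>
    lazymatch S with
    | context [@mor _ _ ?X ?Y] =>
      let a := reify X in let b := reify Y in
      apply: (@hat_eq _ _ a b f g) => T; hats
    end
  end.

Tactic Notation "strictify" := let T := fresh "T" in strictify_in T.
Tactic Notation "strictify" ident(T) := strictify_in T.

(* Turns an equation [E] between morphisms of C into its right-nested form. *)
Ltac hat_hyp E T H :=
  lazymatch type of E with
  | @eq ?S ?f ?g =>
    lazymatch S with
    | context [@mor _ _ ?X ?Y] =>
      let a := reify X in let b := reify Y in
      have H : @hat _ _ a b f T = @hat _ _ a b g T; [by rewrite E | move: H; hats => H]
    end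
  end.

(** * Bimodule categories *)

Section ModuleTheory.
Variables (k : fieldType) (C : moncat k).
Implicit Types M N P : bimod C.

Lemma inv_square (A : lincat k) (X Y Z W : A) (a : mor A X Y) (b : mor A Z W)
    (i : mor A X Z) (j : mor A Y W) :
  is_iso i -> is_iso j ->
  (forall V (x : mor A V X), j ∘ (a ∘ x) = b ∘ (i ∘ x)) ->
  forall V (x : mor A V Z), inv j ∘ (b ∘ x) = a ∘ (inv i ∘ x).
Proof.
by move=> hi hj e V x; apply: (iso_mono hj); rewrite Kinve // e Kinve.
Qed.

Lemma triangleV (X Y : C) :
  asc X unit_ob Y ∘ (bwd (run X) ⊗' id_mor Y) = id_mor X ⊗' bwd (lun Y).
Proof. by strictify. Qed.

Section Left.
Variables (M : bimod C) (hM : left_module M).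

Lemma is_iso_la X Y m : is_iso (la M X Y m).
Proof. by case: hM => _ _ []. Qed.

Lemma is_iso_lu m : is_iso (lu M m).
Proof. by case: hM => _ _ []. Qed.

Lemma la_nat1 X X' (f : mor C X X') Y m W (x : mor M W _) :
  la M X' Y m ∘ (((f ⊗' id_mor Y) ▷' id_mor m) ∘ x) =
  (f ▷' id_mor (Y ▷ m)) ∘ (la M X Y m ∘ x).
Proof. by case: hM => h _ _ _ _; rewrite !mcompA h bmap_id. Qed.

Lemma la_nat2 X Y Y' (f : mor C Y Y') m W (x : mor M W _) :
  la M X Y' m ∘ (((id_mor X ⊗' f) ▷' id_mor m) ∘ x) =
  (id_mor X ▷' (f ▷' id_mor m)) ∘ (la M X Y m ∘ x).
Proof. by case: hM => h _ _ _ _; rewrite !mcompA h. Qed.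

Lemma la_nat3 X Y m m' (f : mor M m m') W (x : mor M W _) :
  la M X Y m' ∘ ((id_mor (X ⊗ Y) ▷' f) ∘ x) =
  (id_mor X ▷' (id_mor Y ▷' f)) ∘ (la M X Y m ∘ x).
Proof. by case: hM => h _ _ _ _; rewrite !mcompA -bmap_id h. Qed.

Lemma laV_nat1 X X' (f : mor C X X') Y m W (x : mor M W _) :
  inv (la M X' Y m) ∘ ((f ▷' id_mor (Y ▷ m)) ∘ x) =
  ((f ⊗' id_mor Y) ▷' id_mor m) ∘ (inv (la M X Y m) ∘ x).
Proof. by apply: inv_square; [exact: is_iso_la|exact: is_iso_la|exact: la_nat1]. Qed.

Lemma laV_nat2 X Y Y' (f : mor C Y Y') m W (x : mor M W _) :
  inv (la M X Y' m) ∘ ((id_mor X ▷' (f ▷' id_mor m)) ∘ x) =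
  ((id_mor X ⊗' f) ▷' id_mor m) ∘ (inv (la M X Y m) ∘ x).
Proof. by apply: inv_square; [exact: is_iso_la|exact: is_iso_la|exact: la_nat2]. Qed.

Lemma laV_nat3 X Y m m' (f : mor M m m') W (x : mor M W _) :
  inv (la M X Y m') ∘ ((id_mor X ▷' (id_mor Y ▷' f)) ∘ x) =
  (id_mor (X ⊗ Y) ▷' f) ∘ (inv (la M X Y m) ∘ x).
Proof. by apply: inv_square; [exact: is_iso_la|exact: is_iso_la|exact: la_nat3]. Qed.

Lemma lu_nat m m' (f : mor M m m') W (x : mor M W _) :
  lu M m' ∘ (f ∘ x) = (id_mor unit_ob ▷' f) ∘ (lu M m ∘ x).
Proof. by case: hM => _ h _ _ _; rewrite !mcompA h. Qed.

Lemma la_pentagon X Y Z m W (x : mor M W _) :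
  la M X Y (Z ▷ m) ∘ (la M (X ⊗ Y) Z m ∘ x) =
  (id_mor X ▷' la M Y Z m) ∘ (la M X (Y ⊗ Z) m ∘ ((asc X Y Z ▷' id_mor m) ∘ x)).
Proof. by case: hM => _ _ _ h _; rewrite !mcompA h. Qed.

Lemma laV_pentagon X Y Z m W (x : mor M W _) :
  (asc X Y Z ▷' id_mor m) ∘ (inv (la M (X ⊗ Y) Z m) ∘ (inv (la M X Y (Z ▷ m)) ∘ x)) =
  inv (la M X (Y ⊗ Z) m) ∘ ((id_mor X ▷' inv (la M Y Z m)) ∘ x).
Proof.
apply: (iso_mono (is_iso_la X (Y ⊗ Z) m)).
apply: (iso_mono (is_iso_bmap (lact M) (is_iso_id X) (is_iso_la Y Z m))).
rewrite -la_pentagon !(Kinve _ (is_iso_la _ _ _)) mcompA -bmapRc Kinv ?bmap_id ?comp_idl //.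
exact: is_iso_la.
Qed.

Lemma la_unit X m W (x : mor M W _) :
  la M X unit_ob m ∘ ((bwd (run X) ▷' id_mor m) ∘ x) = (id_mor X ▷' lu M m) ∘ x.
Proof. by case: hM => _ _ _ _ h; rewrite !mcompA h. Qed.

(** By [lu], the action of the unit object is isomorphic to the identity functor. *)
Lemma unit_act_faithful m m' (f g : mor M m m') :
  id_mor unit_ob ▷' f = id_mor unit_ob ▷' g -> f = g.
Proof.
by move=> e; apply: (iso_mono (is_iso_lu m')); by_elt; rewrite !lu_nat e.
Qed.

(** The module version of [lun_tens]: this second unit triangle follows from the pentagon and the
    unit axiom of modules, once everything is acted upon by the unit object. *)
Lemma la_unit2 X m W (x : mor M W _) :
  la M unit_ob X m ∘ ((bwd (lun X) ▷' id_mor m) ∘ x) = lu M (X ▷ m) ∘ x.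
Proof.
rewrite !mcompA; congr (_ ∘ _); apply: unit_act_faithful.
apply: (iso_epi (is_iso_la unit_ob X m)); rewrite bmapRc.
by_elt; rewrite -la_unit -la_nat1 la_pentagon -la_nat2 !mcompA; congr (_ ∘ _).
by rewrite -!mcompA -bmapLc triangleV.
Qed.

End Left.

Section Right.
Variables (M : bimod C) (hM : right_module M).

Lemma is_iso_ra m X Y : is_iso (ra M m X Y).
Proof. by case: hM => _ _ []. Qed.

Lemma is_iso_ru m : is_iso (ru M m).
Proof. by case: hM => _ _ []. Qed.

Lemma ra_nat1 m m' (f : mor M m m') X Y W (x : mor M W _) :
  ra M m' X Y ∘ (((f ◁' id_mor X) ◁' id_mor Y) ∘ x) =
  (f ◁' id_mor (X ⊗ Y)) ∘ (ra M m X Y ∘ x).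
Proof. by case: hM => h _ _ _ _; rewrite !mcompA h bmap_id. Qed.

Lemma ra_nat2 m X X' (f : mor C X X') Y W (x : mor M W _) :
  ra M m X' Y ∘ (((id_mor m ◁' f) ◁' id_mor Y) ∘ x) =
  (id_mor m ◁' (f ⊗' id_mor Y)) ∘ (ra M m X Y ∘ x).
Proof. by case: hM => h _ _ _ _; rewrite !mcompA h. Qed.

Lemma ra_nat3 m X Y Y' (f : mor C Y Y') W (x : mor M W _) :
  ra M m X Y' ∘ ((id_mor (m ◁ X) ◁' f) ∘ x) =
  (id_mor m ◁' (id_mor X ⊗' f)) ∘ (ra M m X Y ∘ x).
Proof. by case: hM => h _ _ _ _; rewrite !mcompA -bmap_id h. Qed.

Lemma ru_nat m m' (f : mor M m m') W (x : mor M W _) :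
  ru M m' ∘ (f ∘ x) = (f ◁' id_mor unit_ob) ∘ (ru M m ∘ x).
Proof. by case: hM => _ h _ _ _; rewrite !mcompA h. Qed.

Lemma ra_pentagon m X Y Z W (x : mor M W _) :
  ra M m X (Y ⊗ Z) ∘ (ra M (m ◁ X) Y Z ∘ x) =
  (id_mor m ◁' asc X Y Z) ∘ (ra M m (X ⊗ Y) Z ∘ ((ra M m X Y ◁' id_mor Z) ∘ x)).
Proof. by case: hM => _ _ _ h _; rewrite !mcompA h. Qed.

Lemma ra_unit m X W (x : mor M W _) :
  ra M m unit_ob X ∘ ((ru M m ◁' id_mor X) ∘ x) = (id_mor m ◁' bwd (lun X)) ∘ x.
Proof. by case: hM => _ _ _ _ h; rewrite !mcompA h. Qed.

Lemma act_unit_faithful m m' (f g : mor M m m') :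
  f ◁' id_mor unit_ob = g ◁' id_mor unit_ob -> f = g.
Proof.
by move=> e; apply: (iso_mono (is_iso_ru m')); by_elt; rewrite !ru_nat e.
Qed.

(** The counterpart of [la_unit2] for right actions. For the twist by [F] it contains the right unit
    axiom of [F], see [right_module_monoidal]. *)
Lemma ra_unit2 m X W (x : mor M W _) :
  ra M m X unit_ob ∘ (ru M (m ◁ X) ∘ x) = (id_mor m ◁' bwd (run X)) ∘ x.
Proof.
rewrite !mcompA; congr (_ ∘ _); apply: act_unit_faithful.
apply: (iso_mono (is_iso_ra m (X ⊗ unit_ob) unit_ob)).
apply: (@iso_mono _ _ _ _ _ (id_mor m ◁' asc X unit_ob unit_ob)).
  by apply: is_iso_bmap; [exact: is_iso_id|exact: is_iso_fwd].
rewrite bmapLc; by_elt; rewrite -ra_pentagon ra_unit ra_nat3 ra_nat2.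
by rewrite !mcompA -bmapRc triangleV.
Qed.

End Right.

Section Middle.
Variables (M : bimod C) (hL : left_module M) (hR : right_module M).
Hypothesis hM : middle_associative M.

Lemma is_iso_mid X m Y : is_iso (mid M X m Y).
Proof. by case: hM. Qed.

Lemma mid_nat1 X X' (f : mor C X X') m Y W (x : mor M W _) :
  mid M X' m Y ∘ (((f ▷' id_mor m) ◁' id_mor Y) ∘ x) =
  (f ▷' id_mor (m ◁ Y)) ∘ (mid M X m Y ∘ x).
Proof. by case: hM => h _ _ _; rewrite !mcompA h bmap_id. Qed.

Lemma mid_nat2 X m m' (f : mor M m m') Y W (x : mor M W _) :
  mid M X m' Y ∘ (((id_mor X ▷' f) ◁' id_mor Y) ∘ x) =
  (id_mor X ▷' (f ◁' id_mor Y)) ∘ (mid M X m Y ∘ x).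
Proof. by case: hM => h _ _ _; rewrite !mcompA h. Qed.

Lemma mid_nat3 X m Y Y' (f : mor C Y Y') W (x : mor M W _) :
  mid M X m Y' ∘ ((id_mor (X ▷ m) ◁' f) ∘ x) =
  (id_mor X ▷' (id_mor m ◁' f)) ∘ (mid M X m Y ∘ x).
Proof. by case: hM => h _ _ _; rewrite !mcompA -bmap_id h. Qed.

Lemma mid_la X Y m Z W (x : mor M W _) :
  la M X Y (m ◁ Z) ∘ (mid M (X ⊗ Y) m Z ∘ x) =
  (id_mor X ▷' mid M Y m Z) ∘
    (mid M X (Y ▷ m) Z ∘ ((la M X Y m ◁' id_mor Z) ∘ x)).
Proof. by case: hM => _ _ h _; rewrite !mcompA h. Qed.

Lemma mid_laV X Y m Z W (x : mor M W _) :
  mid M (X ⊗ Y) m Z ∘ ((inv (la M X Y m) ◁' id_mor Z) ∘ x) =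
  inv (la M X Y (m ◁ Z)) ∘
    ((id_mor X ▷' mid M Y m Z) ∘ (mid M X (Y ▷ m) Z ∘ x)).
Proof.
apply: (iso_mono (is_iso_la hL X Y (m ◁ Z))).
rewrite (Kinve _ (is_iso_la hL _ _ _)) mid_la mcompA.
rewrite [in LHS](mcompA (la M _ _ _ ◁' _)) -bmapLc Kinv ?bmap_id ?comp_idl -?mcompA //.
exact: is_iso_la.
Qed.

Lemma mid_ra X m Y Z W (x : mor M W _) :
  mid M X m (Y ⊗ Z) ∘ (ra M (X ▷ m) Y Z ∘ x) =
  (id_mor X ▷' ra M m Y Z) ∘
    (mid M X (m ◁ Y) Z ∘ ((mid M X m Y ◁' id_mor Z) ∘ x)).
Proof. by case: hM => _ _ _ h; rewrite !mcompA h. Qed.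

(** The axioms of [middle_associative] mention no units. Compatibility with [lu] follows from
    compatibility with [la] at the unit object, and [mid_ru] follows likewise from [ra]. *)
Lemma mid_lu m Y W (x : mor M W _) :
  mid M unit_ob m Y ∘ ((lu M m ◁' id_mor Y) ∘ x) = lu M (m ◁ Y) ∘ x.
Proof.
rewrite !mcompA; congr (_ ∘ _); apply: (unit_act_faithful hL).
apply: (iso_epi (is_iso_mid unit_ob m Y)); rewrite bmapRc.
by_elt; rewrite -mid_nat2 -(la_unit hL) -mid_nat1 mid_la.
congr (_ ∘ (_ ∘ _)); rewrite !mcompA -!bmapLc; congr (bmap _ _ _ ∘ _).
by apply: eltP => ? y; rewrite -mcompA (la_unit hL).
Qed.

Lemma mid_ru X m W (x : mor M W _) :
  mid M X m unit_ob ∘ (ru M (X ▷ m) ∘ x) = (id_mor X ▷' ru M m) ∘ x.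
Proof.
rewrite !mcompA; congr (_ ∘ _); apply: (act_unit_faithful hR).
apply: (iso_mono (is_iso_mid X (m ◁ unit_ob) unit_ob)).
apply: (@iso_mono _ _ _ _ _ (id_mor X ▷' ra M m unit_ob unit_ob)).
  by apply: is_iso_bmap; [exact: is_iso_id|exact: is_iso_ra].
rewrite bmapLc; by_elt; rewrite -mid_ra (ra_unit hR) mid_nat3 mid_nat2.
rewrite [RHS]mcompA -bmapRc; congr (bmap _ _ _ ∘ _).
by apply: eltP => ? y; rewrite -mcompA (ra_unit hR).
Qed.

End Middle.
End ModuleTheory.

(** * Module functors and bimodule functors: reflection of axioms, composition, inverses *)

Section ModuleFunctors.
Variables (k : fieldType) (C : moncat k).
Implicit Types M N P : bimod C.

Section Left.
Variables (M N : bimod C) (T : functor M N) (s : forall X m, mor N (T (X ▷ m)) (X ▷ T m)).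
Hypothesis hs : left_module_functor s.

Lemma is_iso_mfl X m : is_iso (s X m).
Proof. by case: hs. Qed.

Lemma mfl_nat1 X X' (f : mor C X X') m W (x : mor N W _) :
  s X' m ∘ (fmap T (f ▷' id_mor m) ∘ x) = (f ▷' id_mor (T m)) ∘ (s X m ∘ x).
Proof. by case: hs => h _ _ _; rewrite !mcompA h fmap_id. Qed.

Lemma mfl_nat2 X m m' (f : mor M m m') W (x : mor N W _) :
  s X m' ∘ (fmap T (id_mor X ▷' f) ∘ x) = (id_mor X ▷' fmap T f) ∘ (s X m ∘ x).
Proof. by case: hs => h _ _ _; rewrite !mcompA h. Qed.

Lemma mfl_la X Y m W (x : mor N W _) :
  la N X Y (T m) ∘ (s (X ⊗ Y) m ∘ x) =
  (id_mor X ▷' s Y m) ∘ (s X (Y ▷ m) ∘ (fmap T (la M X Y m) ∘ x)).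
Proof. by case: hs => _ _ h _; rewrite !mcompA h. Qed.

Lemma mfl_laV (hM : left_module M) (hN : left_module N) X Y m W (x : mor N W _) :
  inv (la N X Y (T m)) ∘ ((id_mor X ▷' s Y m) ∘ (s X (Y ▷ m) ∘ x)) =
  s (X ⊗ Y) m ∘ (fmap T (inv (la M X Y m)) ∘ x).
Proof.
apply: (iso_mono (is_iso_la hN X Y (T m))).
rewrite (Kinve _ (is_iso_la hN _ _ _)) mfl_la (mcompA (fmap T _)) -fmap_comp Kinv.
  by rewrite fmap_id comp_idl.
exact: is_iso_la.
Qed.

Lemma mfl_lu m W (x : mor N W _) :
  s unit_ob m ∘ (fmap T (lu M m) ∘ x) = lu N (T m) ∘ x.
Proof. by case: hs => _ _ _ h; rewrite !mcompA h. Qed.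

End Left.

Section Right.
Variables (M N : bimod C) (T : functor M N) (t : forall m X, mor N (T m ◁ X) (T (m ◁ X))).
Hypothesis ht : right_module_functor t.

Lemma is_iso_mfr m X : is_iso (t m X).
Proof. by case: ht. Qed.

Lemma mfr_nat1 m m' (f : mor M m m') X W (x : mor N W _) :
  t m' X ∘ ((fmap T f ◁' id_mor X) ∘ x) = fmap T (f ◁' id_mor X) ∘ (t m X ∘ x).
Proof. by case: ht => h _ _ _; rewrite !mcompA h. Qed.

Lemma mfr_nat2 m X X' (f : mor C X X') W (x : mor N W _) :
  t m X' ∘ ((id_mor (T m) ◁' f) ∘ x) = fmap T (id_mor m ◁' f) ∘ (t m X ∘ x).
Proof. by case: ht => h _ _ _; rewrite !mcompA -h fmap_id. Qed.

Lemma mfr_ra m X Y W (x : mor N W _) :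
  fmap T (ra M m X Y) ∘ (t (m ◁ X) Y ∘ ((t m X ◁' id_mor Y) ∘ x)) =
  t m (X ⊗ Y) ∘ (ra N (T m) X Y ∘ x).
Proof. by case: ht => _ _ h _; rewrite !mcompA h. Qed.

Lemma mfr_ru m W (x : mor N W _) :
  t m unit_ob ∘ (ru N (T m) ∘ x) = fmap T (ru M m) ∘ x.
Proof. by case: ht => _ _ _ h; rewrite !mcompA h. Qed.

End Right.

(** Conjugation by [t] turns [T] of each axiom of [M] into the same axiom of [N]; faithfulness then
    gives the equations, and fullness in addition the invertibility of the constraints. Its use is
    to obtain properties of a functor [F] by reflecting them from a known bimodule to the twist by
    [F]. *)
Lemma right_module_reflect M N (T : functor M N) (t : forall m X, mor N (T m ◁ X) (T (m ◁ X))) :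
  right_module N -> right_module_functor t -> faithful T -> full T -> right_module M.
Proof.
move=> hN ht faT fuT; have it := is_iso_mfr ht.
have i2 m X Y : is_iso (t m X ◁' id_mor Y) by exact: is_iso_bmap (it _ _) (is_iso_id _).
have nat m m' (f : mor M m m') X X' (g : mor C X X') W (x : mor N W _) :
    t m' X' ∘ ((fmap T f ◁' g) ∘ x) = fmap T (f ◁' g) ∘ (t m X ∘ x).
  by case: ht => h _ _ _; rewrite !mcompA h.
split.
- move=> m m' X X' Y Y' h f g; apply: faT.
  apply: (iso_epi (it _ _)); apply: (iso_epi (i2 _ _ _)); by_elt.
  rewrite !fmap_comp -!mcompA (mfr_ra ht) -!nat.
  have [n _ _ _ _] := hN; rewrite [in RHS](mcompA (_ ◁' (f ⊗' g))) -n -mcompA -(mfr_ra ht).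
  congr (_ ∘ (_ ∘ _)); rewrite !mcompA -!bmap_comp !comp_idr comp_idl.
  by case: ht => h' _ _ _; rewrite h'.
- move=> m m' h; apply: faT; by_elt; rewrite !fmap_comp -?mcompA -!(mfr_ru ht) -nat.
  by rewrite -(ru_nat hN).
- split=> [m X Y|m]; apply: (ff_is_iso faT fuT).
    apply: (is_iso_compKr (it (m ◁ X) Y)); apply: (is_iso_compKr (i2 m X Y)).
    have -> : fmap T (ra M m X Y) ∘ t (m ◁ X) Y ∘ (t m X ◁' id_mor Y) =
        t m (X ⊗ Y) ∘ ra N (T m) X Y by case: ht.
    by apply: is_iso_comp => //; exact: is_iso_ra.
  have <- : t m unit_ob ∘ ru N (T m) = fmap T (ru M m) by case: ht.
  by apply: is_iso_comp => //; exact: is_iso_ru.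
- move=> m X Y Z; apply: faT; apply: (iso_epi (it _ _)).
  apply: (@iso_epi _ _ _ _ _ (t (m ◁ X) Y ◁' id_mor Z)).
    exact: is_iso_bmap (it _ _) (is_iso_id _).
  apply: (@iso_epi _ _ _ _ _ ((t m X ◁' id_mor Y) ◁' id_mor Z)).
    exact: is_iso_bmap (i2 _ _ _) (is_iso_id _).
  by_elt; rewrite !fmap_comp -!mcompA (mfr_ra ht) (ra_nat1 hN) (mfr_ra ht) (ra_pentagon hN).
  rewrite -(mfr_nat1 ht) bmapL3.
  have -> : fmap T (ra M m X Y) ∘ (t (m ◁ X) Y ∘ (t m X ◁' id_mor Y)) =
    t m (X ⊗ Y) ∘ ra N (T m) X Y by case: ht => _ _ h _; rewrite mcompA h.
  by rewrite bmapLc -?mcompA (mfr_ra ht) -nat fmap_id.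
- move=> m X; apply: faT; apply: (iso_epi (it _ _)); by_elt.
  rewrite !fmap_comp -!mcompA -(mfr_nat1 ht) -(nat _ _ (id_mor m)) fmap_id -(ra_unit hN).
  have <- : t m unit_ob ∘ ru N (T m) = fmap T (ru M m) by case: ht.
  by rewrite bmapLc -mcompA (mfr_ra ht).
Qed.

Lemma bf_mid M N (T : bimodfun M N) : bimodule_functor T -> forall X m Y W (x : mor N W _),
  (id_mor X ▷' bf_r T m Y) ∘ (mid N X (T m) Y ∘ ((bf_l T X m ◁' id_mor Y) ∘ x)) =
  bf_l T X (m ◁ Y) ∘ (fmap T (mid M X m Y) ∘ (bf_r T (X ▷ m) Y ∘ x)).
Proof. by move=> [_ _ h] X m Y W x; rewrite !mcompA h. Qed.

Definition bimodfun_id M : bimodfun M M :=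
  @BimodFun _ _ M M (fid M) (fun X m => id_mor (X ▷ m)) (fun m X => id_mor (m ◁ X)).

Lemma bimodfun_id_bimodule M : bimodule_functor (bimodfun_id M).
Proof.
split; first split => *; rewrite /= ?bmap_id ?comp_idl ?comp_idr //; try exact: is_iso_id.
  by split => *; rewrite /= ?bmap_id ?comp_idl ?comp_idr //; exact: is_iso_id.
by move=> *; rewrite /= !bmap_id !comp_idl !comp_idr.
Qed.

Lemma bimodfun_comp_bimodule M N P (S : bimodfun N P) (T : bimodfun M N) :
  bimodule_functor S -> bimodule_functor T -> bimodule_functor (bimodfun_comp S T).
Proof.
move=> hS hT; have [lS rS mS] := hS; have [lT rT mT] := hT; split.
- split=> /=.
  + move=> X X' m m' f h; case: lT => nT _ _ _; case: lS => nS _ _ _.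
    by rewrite -mcompA -fmap_comp nT fmap_comp !mcompA nS.
  + move=> X m; apply: is_iso_comp; first exact: is_iso_mfl lS _ _.
    exact/is_iso_fmap/(is_iso_mfl lT).
  + move=> X Y m; by_elt; rewrite (mfl_la lS) bmapRc.
    rewrite -!mcompA -(mfl_nat2 lS); congr (_ ∘ (_ ∘ _)).
    rewrite !mcompA -!fmap_comp; congr (fmap S _ ∘ _).
    by apply: eltP => ? y; rewrite -!mcompA (mfl_la lT).
  + move=> m; rewrite -mcompA -fmap_comp.
    have -> : bf_l T unit_ob m ∘ fmap T (lu M m) = lu N (T m).
      by apply: eltP => ? y; rewrite -!mcompA (mfl_lu lT).
    by apply: eltP => ? y; rewrite -!mcompA (mfl_lu lS).
- split=> /=.
  + move=> m m' X X' h f; case: rT => nT _ _ _; case: rS => nS _ _ _.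
    by rewrite -mcompA nS !mcompA -!fmap_comp nT.
  + move=> m X; apply: is_iso_comp; last exact: is_iso_mfr rS _ _.
    exact/is_iso_fmap/(is_iso_mfr rT).
  + move=> m X Y; rewrite bmapLc; by_elt; rewrite (mfr_nat1 rS) -(mfr_ra rS).
    rewrite !mcompA -!fmap_comp; congr (fmap S _ ∘ _ ∘ _ ∘ _).
    by apply: eltP => ? y; rewrite -!mcompA (mfr_ra rT).
  + move=> m; rewrite -mcompA.
    have -> : bf_r S (T m) unit_ob ∘ ru P (S (T m)) = fmap S (ru N (T m)).
      by apply: eltP => ? y; rewrite -!mcompA (mfr_ru rS).
    rewrite -fmap_comp; congr (fmap S _).
    by apply: eltP => ? y; rewrite -!mcompA (mfr_ru rT).
- move=> X m Y /=; rewrite bmapRc bmapLc; by_elt.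
  rewrite (bf_mid hS) (mfr_nat1 rS) -(mfl_nat2 lS); congr (_ ∘ _).
  rewrite !mcompA -!fmap_comp; congr (fmap S _ ∘ _ ∘ _).
  by apply: eltP => ? y; rewrite -!mcompA (bf_mid hT).
Qed.

Section Inverse.
Variables (M N : bimod C) (T : bimodfun M N).
Hypotheses (hNl : left_module N) (hNr : right_module N) (hNm : middle_associative N).
Hypotheses (hT : bimodule_functor T) (eT : equivalence T).

(** The constraints [l] and [r] of [G] are the only ones for which the counit [eps] respects both
    actions: this condition prescribes their images under [T], and [T] is full. Each axiom of [G] is
    then checked after applying [T] and composing with invertible maps built from [eps] and the
    constraints of [T]. *)
Lemma bimodule_functor_inverse : exists (G : bimodfun N M) (eps : forall n, mor N (T (G n)) n),
  [/\ bimodule_functor G, equivalence G, @natural_iso _ _ _ (fcomp T G) (fid N) eps,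
      forall X n, (id_mor X ▷' eps n) ∘ (bf_l T X (G n) ∘ fmap T (bf_l G X n)) = eps (X ▷ n)
    & forall n X, eps (n ◁ X) ∘ (fmap T (bf_r G n X) ∘ bf_r T (G n) X) = eps n ◁' id_mor X].
Proof.
have [lT rT mT] := hT.
have faT := equivalence_faithful eT; have fuT := equivalence_full eT.
have [G [eps heps]] := quasi_inverse faT fuT (equivalence_ess_surj eT).
have [neps ieps] := heps.
have {}ieps (n : N) : is_iso (eps n) := ieps n.
have {}neps X Y f W (x : mor N W _) : eps Y ∘ (fmap T (fmap G f) ∘ x) = f ∘ (eps X ∘ x).
  by rewrite mcompA neps mcompA.
have iL X n : is_iso ((id_mor X ▷' eps n) ∘ bf_l T X (G n)).
  apply: is_iso_comp; last exact: is_iso_mfl lT _ _.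
  exact: is_iso_bmap (is_iso_id _) (ieps _).
have iR n X : is_iso (bf_r T (G n) X) by exact: is_iso_mfr rT _ _.
have [l lE] : exists l : forall X n, mor M (G (X ▷ n)) (X ▷ G n), forall X n,
    fmap T (l X n) = inv ((id_mor X ▷' eps n) ∘ bf_l T X (G n)) ∘ eps (X ▷ n).
  pose h X n := cid (fuT _ _ (inv ((id_mor X ▷' eps n) ∘ bf_l T X (G n)) ∘ eps (X ▷ n))).
  by exists (fun X n => sval (h X n)) => X n; case: (h X n).
have [r rE] : exists r : forall n X, mor M (G n ◁ X) (G (n ◁ X)), forall n X,
    fmap T (r n X) = inv (eps (n ◁ X)) ∘ (eps n ◁' id_mor X) ∘ inv (bf_r T (G n) X).
  pose h n X := cid (fuT _ _ (inv (eps (n ◁ X)) ∘ (eps n ◁' id_mor X) ∘ inv (bf_r T (G n) X))).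
  by exists (fun n X => sval (h n X)) => n X; case: (h n X).
have lP X n W (x : mor N W _) :
    (id_mor X ▷' eps n) ∘ (bf_l T X (G n) ∘ (fmap T (l X n) ∘ x)) = eps (X ▷ n) ∘ x.
  by rewrite lE -mcompA mcompA Kinve.
have rP n X W (x : mor N W _) :
    eps (n ◁ X) ∘ (fmap T (r n X) ∘ (bf_r T (G n) X ∘ x)) = (eps n ◁' id_mor X) ∘ x.
  by rewrite rE -!mcompA Kinve // invKe.
have lP' X n : (id_mor X ▷' eps n) ∘ (bf_l T X (G n) ∘ fmap T (l X n)) = eps (X ▷ n).
  by rewrite -[LHS]comp_idr -!mcompA lP comp_idr.
have rP' n X : eps (n ◁ X) ∘ (fmap T (r n X) ∘ bf_r T (G n) X) = eps n ◁' id_mor X.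
  by rewrite -[LHS]comp_idr -!mcompA rP comp_idr.
exists (BimodFun l r), eps; split=> //=; last first.
  apply: (@equivalence_cancel_l _ _ _ _ T) => //.
  exact: equivalence_natural_iso (natural_iso_inv heps) (equivalence_id N).
have epsL X n n' (h : mor N n n') W (x : mor N W _) :
    (id_mor X ▷' eps n') ∘ ((id_mor X ▷' fmap T (fmap G h)) ∘ x) =
    (id_mor X ▷' h) ∘ ((id_mor X ▷' eps n) ∘ x).
  rewrite !mcompA -!bmapRc; congr (bmap _ _ _ ∘ _).
  by rewrite -[LHS]comp_idr -mcompA neps comp_idr.
have epsR X n n' (h : mor N n n') W (x : mor N W _) :
    (eps n' ◁' id_mor X) ∘ ((fmap T (fmap G h) ◁' id_mor X) ∘ x) =
    (h ◁' id_mor X) ∘ ((eps n ◁' id_mor X) ∘ x).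
  rewrite !mcompA -!bmapLc; congr (bmap _ _ _ ∘ _).
  by rewrite -[LHS]comp_idr -mcompA neps comp_idr.
have lPL Y X n W (x : mor N W _) :
    (id_mor Y ▷' (id_mor X ▷' eps n)) ∘ ((id_mor Y ▷' bf_l T X (G n)) ∘
      ((id_mor Y ▷' fmap T (l X n)) ∘ x)) = (id_mor Y ▷' eps (X ▷ n)) ∘ x.
  by rewrite !mcompA -!bmapRc -mcompA lP'.
have lPR Y X n W (x : mor N W _) :
    ((id_mor X ▷' eps n) ◁' id_mor Y) ∘ ((bf_l T X (G n) ◁' id_mor Y) ∘
      ((fmap T (l X n) ◁' id_mor Y) ∘ x)) = (eps (X ▷ n) ◁' id_mor Y) ∘ x.
  by rewrite !mcompA -!bmapLc -mcompA lP'.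
have rPL Y X n W (x : mor N W _) :
    (id_mor Y ▷' eps (n ◁ X)) ∘ ((id_mor Y ▷' fmap T (r n X)) ∘
      ((id_mor Y ▷' bf_r T (G n) X) ∘ x)) = (id_mor Y ▷' (eps n ◁' id_mor X)) ∘ x.
  by rewrite !mcompA -!bmapRc -mcompA rP'.
have rPR Y X n W (x : mor N W _) :
    (eps (n ◁ X) ◁' id_mor Y) ∘ ((fmap T (r n X) ◁' id_mor Y) ∘
      ((bf_r T (G n) X ◁' id_mor Y) ∘ x)) = ((eps n ◁' id_mor X) ◁' id_mor Y) ∘ x.
  by rewrite !mcompA -!bmapLc -mcompA rP'.
have monoL X Z (m : M) W (f g : mor N W (T (X ▷ m))) (h : mor N (T m) Z) : is_iso h ->
    (id_mor X ▷' h) ∘ (bf_l T X m ∘ f) = (id_mor X ▷' h) ∘ (bf_l T X m ∘ g) -> f = g.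
  move=> ih; rewrite !mcompA; apply: iso_mono; apply: is_iso_comp; last exact: is_iso_mfl lT _ _.
  exact: is_iso_bmap (is_iso_id _) ih.
have isoR n X : is_iso (eps n ◁' id_mor X) by exact: is_iso_bmap (ieps n) (is_iso_id X).
split.
- split=> /=.
  + move=> X X' n n' f h; apply: faT; apply: (monoL _ _ _ _ _ _ _ (ieps n')); by_elt.
    rewrite !fmap_comp -!mcompA lP neps bmapLR [X in fmap T X]bmapLR fmap_comp.
    rewrite -!mcompA (mfl_nat1 lT) (mfl_nat2 lT) -bmap_swap.
    by rewrite epsL lP.
  + move=> X n; apply: (ff_is_iso faT fuT); rewrite lE.
    by apply: is_iso_comp => //; exact: is_iso_inv.
  + move=> X Y n; apply: faT; apply: (monoL _ _ _ _ _ _ ((id_mor Y ▷' eps n) ∘ bf_l T Y (G n))) => //.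
    by_elt; rewrite !fmap_comp bmapRc -!mcompA -(mfl_la lT).
    by rewrite -(la_nat3 hNl) lP (mfl_nat2 lT) lPL lP neps.
  + move=> n; apply: faT; apply: (monoL _ _ _ _ _ _ _ (ieps n)); by_elt.
    by rewrite !fmap_comp -!mcompA lP neps (mfl_lu lT) (lu_nat hNl).
- split=> /=.
  + move=> n n' X X' h f; apply: faT; apply: (iso_epi (is_iso_mfr rT _ _)).
    apply: (iso_mono (ieps _)); by_elt.
    rewrite !fmap_comp -!mcompA neps rP [in LHS]bmapRL [in RHS]bmapRL fmap_comp.
    by rewrite -!mcompA -(mfr_nat1 rT) -(mfr_nat2 rT) rP bmap_swap epsR.
  + move=> n X; apply: (ff_is_iso faT fuT); rewrite rE.
    by apply: is_iso_comp; [apply: is_iso_comp => //|]; apply: is_iso_inv.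
  + move=> n X Y; apply: faT; apply: (iso_epi (is_iso_mfr rT _ _)).
    apply: (@iso_epi _ _ _ _ _ (bf_r T (G n) X ◁' id_mor Y)).
      exact: is_iso_bmap (iR _ _) (is_iso_id _).
    apply: (iso_mono (ieps _)); by_elt.
    rewrite !fmap_comp -!mcompA neps -(mfr_nat1 rT) rP rPR (mfr_ra rT) rP.
    by rewrite (ra_nat1 hNr).
  + move=> n; apply: faT; apply: (iso_mono (ieps _)); by_elt.
    by rewrite fmap_comp -!mcompA neps -(mfr_ru rT) rP (ru_nat hNr).
- move=> X n Y /=; apply: faT; apply: (iso_epi (is_iso_mfr rT _ _)).
  apply: (monoL _ _ _ _ _ _ _ (ieps _)); by_elt.
  rewrite !fmap_comp -!mcompA lP neps rP (mfl_nat2 lT) -(mfr_nat1 rT).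
  by rewrite -(bf_mid hT) rPL -(mid_nat2 hNm) lPR.
Qed.
End Inverse.

End ModuleFunctors.

(** * Equivalence of bimodule categories and isomorphism of bimodule functors *)

Section BimoduleEquivalence.
Variables (k : fieldType) (C : moncat k).
Implicit Types M N P : bimod C.

Lemma bimodule_equivalent_refl M : bimodule_equivalent M M.
Proof.
by exists (bimodfun_id M); split; [exact: bimodfun_id_bimodule|exact: equivalence_id].
Qed.

Lemma bimodule_equivalent_sym M N :
  is_bimodule N -> bimodule_equivalent M N -> bimodule_equivalent N M.
Proof.
move=> [_ hl hr hm] [T [hT eT]].
by have [G [eps [hG eG _ _ _]]] := bimodule_functor_inverse hl hr hm hT eT; exists G.
Qed.

Lemma bimodule_equivalent_trans M N P :
  bimodule_equivalent M N -> bimodule_equivalent N P -> bimodule_equivalent M P.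
Proof.
move=> [T [hT eT]] [S [hS eS]]; exists (bimodfun_comp S T).
by split; [exact: bimodfun_comp_bimodule|exact: equivalence_comp].
Qed.

Lemma bimodfun_iso_refl M N (T : bimodfun M N) : bimodfun_iso T T.
Proof.
exists (fun m => id_mor (T m)); split.
- by split=> [X Y f|X]; [rewrite comp_idl comp_idr|exact: is_iso_id].
- by move=> X m; rewrite bmap_id comp_idl comp_idr.
- by move=> m X; rewrite bmap_id comp_idl comp_idr.
Qed.

Lemma bimodfun_iso_sym M N (S T : bimodfun M N) : bimodfun_iso S T -> bimodfun_iso T S.
Proof.
move=> [eta [heta l r]]; have [nat i] := heta; exists (fun m => inv (eta m)); split.
- exact: natural_iso_inv.
- move=> X m; apply: (iso_epi (i (X ▷ m))); rewrite -mcompA invK // comp_idr.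
  by rewrite -mcompA l mcompA -bmapRc invK // bmap_id comp_idl.
- move=> m X; apply: (iso_mono (i (m ◁ X))); rewrite !mcompA -r Kinv // comp_idl.
  by rewrite -mcompA -bmapLc Kinv // bmap_id comp_idr.
Qed.

Lemma bimodfun_iso_trans M N (S T U : bimodfun M N) :
  bimodfun_iso S T -> bimodfun_iso T U -> bimodfun_iso S U.
Proof.
move=> [eta [[nat i] l r]] [eta' [[nat' i'] l' r']].
exists (fun m => eta' m ∘ eta m); split.
- split=> [X Y f|X]; last exact: is_iso_comp.
  by rewrite -mcompA nat !mcompA nat'.
- by move=> X m; rewrite bmapRc !mcompA l' -mcompA l mcompA.
- by move=> m X; rewrite bmapLc mcompA r' -mcompA r mcompA.
Qed.

Lemma bimodfun_comp_congr M N P (S S' : bimodfun N P) (T T' : bimodfun M N) :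
  bimodule_functor S -> bimodule_functor S' ->
  bimodfun_iso S S' -> bimodfun_iso T T' ->
  bimodfun_iso (bimodfun_comp S T) (bimodfun_comp S' T').
Proof.
move=> [lS rS _] [lS' rS' _] [eta [[nat i] l r]] [eta' [[nat' i'] l' r']].
exists (fun m => eta (T' m) ∘ fmap S (eta' m)); split.
- split=> [X Y f|X] /=.
    by rewrite -mcompA -fmap_comp nat' fmap_comp !mcompA nat.
  by apply: is_iso_comp => //; exact: is_iso_fmap.
- move=> X m /=; rewrite bmapRc -mcompA (mcompA (fmap S' _)) -nat -mcompA -fmap_comp l'.
  rewrite fmap_comp; apply: eltP => ? x; rewrite -!mcompA -(mfl_nat2 lS).
  by rewrite !mcompA l.
- move=> m X /=; rewrite bmapLc; by_elt; rewrite (mcompA (bf_r S' _ _)) r.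
  rewrite -!mcompA (mfr_nat1 rS) !mcompA; congr (_ ∘ _ ∘ _).
  by rewrite -nat -!mcompA -!fmap_comp r'.
Qed.

End BimoduleEquivalence.

(** * The regular bimodule and restriction of the right action along a tensor functor *)

Section Regular.
Variables (k : fieldType) (C : moncat k).

Lemma regular_is_bimodule : finite_semisimple C -> is_bimodule (regular_bimod C).
Proof.
move=> ssC; split=> //; split=> /=.
- by move=> *; rewrite asc_nat.
- by move=> m m' h; strictify.
- by split=> *; [exact: is_iso_fwd|exact: is_iso_bwd].
- by move=> *; rewrite pentagon.
- by move=> *; exact: triangleV.
- by move=> *; rewrite asc_nat.
- by move=> m m' h; strictify.
- by split=> *; [exact: is_iso_fwd|exact: is_iso_bwd].
- by move=> *; rewrite pentagon.
- by move=> *; exact: triangleV.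
- by move=> *; rewrite asc_nat.
- by move=> *; exact: is_iso_fwd.
- by move=> *; rewrite pentagon.
- by move=> *; rewrite pentagon.
Qed.

(* [twist F] is convertible to [restrict (regular_bimod C) F]. *)
Definition restrict (M : bimod C) (F : monfun C C) : bimod C :=
  @Bimod k C M (lact M) (bicomp_right (ract M) F) (la M) (lu M)
    (fun m X Y => (id_mor m ◁' mon_J F X Y) ∘ ra M m (F X) (F Y))
    (fun m => (id_mor m ◁' mon_eps F) ∘ ru M m)
    (fun X m Y => mid M X m (F Y)).

Lemma restrict_is_bimodule M F : is_bimodule M -> monoidal F -> is_bimodule (restrict M F).
Proof.
move=> [ss hl hr hm] [[iJ ieps] Jnat Jasc Jlun Jrun]; split=> //; split=> /=.
- move=> m m' X X' Y Y' h f g; have [n _ _ _ _] := hr.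
  by rewrite -mcompA n !mcompA -!bmap_comp Jnat comp_idl comp_idr.
- move=> m m' h; rewrite -!mcompA fmap_id.
  apply: eltP => ? x; rewrite -!mcompA (ru_nat hr).
  by rewrite bmap_swap.
- split=> *; apply: is_iso_comp; try exact: is_iso_bmap (is_iso_id _) _.
    exact: is_iso_ra.
  exact: is_iso_ru.
- move=> m X Y Z; rewrite fmap_id bmapLc; by_elt.
  rewrite (ra_nat2 hr) (ra_nat3 hr) (ra_pentagon hr) !mcompA -!bmapRc.
  by rewrite -Jasc.
- move=> m X; rewrite fmap_id bmapLc; by_elt.
  rewrite (ra_nat2 hr) (ra_unit hr) !mcompA -!bmapRc; congr (bmap _ _ _ ∘ _).
  apply: (iso_mono (is_iso_fmap _ (is_iso_fwd (lun X)))).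
  by rewrite !mcompA Jlun bwdK -fmap_comp bwdK fmap_id.
- by move=> *; have [n _ _ _] := hm; rewrite n.
- by move=> *; exact: is_iso_mid.
- by move=> *; have [_ _ n _] := hm; rewrite fmap_id n.
- move=> X m Y Z; rewrite bmapRc fmap_id; by_elt.
  by rewrite -(mid_ra hm) (mid_nat3 hm).
Qed.

Lemma twist_is_bimodule (F : monfun C C) : finite_semisimple C -> monoidal F -> is_bimodule (twist F).
Proof. by move=> ss; exact: (restrict_is_bimodule (regular_is_bimodule ss)). Qed.

(** At the object [unit_ob] the right module axioms of the twist are those of a tensor functor,
    tensored on the left with the unit, an operation that loses nothing. The module unit axiom gives
    the left unit axiom of [F], and the derived [ra_unit2] the right one. *)
Lemma right_module_monoidal (F : monfun C C) : right_module (twist F) -> monoidal F.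
Proof.
move=> h; have [nat _ _ pent unit1] := h.
have iso1 (Z W : C) (f : mor C Z W) : is_iso (id_mor unit_ob ⊗' f) -> is_iso f.
  move=> i; apply: (@is_iso_compKr _ _ _ _ _ _ (lun Z)); first exact: is_iso_fwd.
  by rewrite -lun_nat; apply: is_iso_comp => //; exact: is_iso_fwd.
split.
- split.
    move=> X Y; apply: iso1; apply: is_iso_compKr (is_iso_fwd (asc unit_ob (F X) (F Y))) _.
    exact: (is_iso_ra h unit_ob X Y).
  apply: iso1; apply: is_iso_compKr (is_iso_bwd (run unit_ob)) _.
  exact: (is_iso_ru h unit_ob).
- move=> X X' Y Y' f g; have /= E := nat _ _ _ _ _ _ (id_mor unit_ob) f g.
  by strictify T; hat_hyp E T e.
- move=> X Y Z; have := pent unit_ob X Y Z; rewrite /= fmap_id => E.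
  by strictify T; hat_hyp E T e.
- move=> X; have := unit1 unit_ob X; rewrite /= fmap_id => E.
  apply: (iso_mono (is_iso_fmap F (is_iso_bwd (lun X)))).
  rewrite !mcompA -fmap_comp fwdK fmap_id comp_idl.
  by strictify T; hat_hyp E T e.
- move=> X; have := @ra_unit2 _ _ _ h unit_ob X _ (id_mor _); rewrite /= !comp_idr => E.
  apply: (iso_mono (is_iso_fmap F (is_iso_bwd (run X)))).
  rewrite !mcompA -fmap_comp fwdK fmap_id comp_idl.
  by strictify T; hat_hyp E T e.
Qed.

End Regular.

(** * Tensor functors: composition, isomorphism, inverses *)

Section MonoidalFunctorTheory.
Variables (k : fieldType) (C : moncat k).
Implicit Types F G H : monfun C C.

Section Elementwise.
Variables (F : monfun C C) (hF : monoidal F).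

Lemma is_iso_J X Y : is_iso (mon_J F X Y).
Proof. by case: hF => [[]]. Qed.

Lemma is_iso_eps : is_iso (mon_eps F).
Proof. by case: hF => [[]]. Qed.

Lemma J_nat1 X X' (f : mor C X X') Y W (x : mor C W _) :
  mon_J F X' Y ∘ ((fmap F f ⊗' id_mor (F Y)) ∘ x) =
  fmap F (f ⊗' id_mor Y) ∘ (mon_J F X Y ∘ x).
Proof. by case: hF => _ h _ _ _; rewrite !mcompA -h fmap_id. Qed.

Lemma J_nat2 X Y Y' (f : mor C Y Y') W (x : mor C W _) :
  mon_J F X Y' ∘ ((id_mor (F X) ⊗' fmap F f) ∘ x) =
  fmap F (id_mor X ⊗' f) ∘ (mon_J F X Y ∘ x).
Proof. by case: hF => _ h _ _ _; rewrite !mcompA -h fmap_id. Qed.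

Lemma J_asc X Y Z W (x : mor C W _) :
  fmap F (asc X Y Z) ∘ (mon_J F (X ⊗ Y) Z ∘ ((mon_J F X Y ⊗' id_mor (F Z)) ∘ x)) =
  mon_J F X (Y ⊗ Z) ∘ ((id_mor (F X) ⊗' mon_J F Y Z) ∘ (asc (F X) (F Y) (F Z) ∘ x)).
Proof. by case: hF => _ _ h _ _; rewrite !mcompA h. Qed.

Lemma J_lun X W (x : mor C W _) :
  fmap F (lun X) ∘ (mon_J F unit_ob X ∘ ((mon_eps F ⊗' id_mor (F X)) ∘ x)) = lun (F X) ∘ x.
Proof. by case: hF => _ _ _ h _; rewrite !mcompA h. Qed.

Lemma J_run X W (x : mor C W _) :
  fmap F (run X) ∘ (mon_J F X unit_ob ∘ ((id_mor (F X) ⊗' mon_eps F) ∘ x)) = run (F X) ∘ x.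
Proof. by case: hF => _ _ _ _ h; rewrite !mcompA h. Qed.

End Elementwise.

Definition monfun_id : monfun C C :=
  @MonFun _ C C (fid C) (fun X Y => id_mor (X ⊗ Y)) (id_mor unit_ob).

Lemma monfun_id_monoidal : monoidal monfun_id.
Proof.
by split=> *; first split=> *; rewrite /= ?bmap_id ?comp_idr ?comp_idl //; exact: is_iso_id.
Qed.

Lemma monfun_comp_monoidal G F : monoidal G -> monoidal F -> monoidal (monfun_comp G F).
Proof.
move=> hG hF; split.
- split=> [X Y|] /=; apply: is_iso_comp; try exact: is_iso_J.
  + exact/is_iso_fmap/is_iso_J.
  + exact/is_iso_fmap/is_iso_eps.
  + exact: is_iso_eps.
- move=> X X' Y Y' f g /=; case: hG => _ nG _ _ _; case: hF => _ nF _ _ _.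
  by rewrite -mcompA nG !mcompA -!fmap_comp nF.
- move=> X Y Z /=; rewrite bmapLc bmapRc; by_elt.
  rewrite (J_nat1 hG) (J_nat2 hG) -(J_asc hG) !mcompA -!fmap_comp; congr (fmap G _ ∘ _ ∘ _ ∘ _).
  by apply: eltP => ? y; rewrite -!mcompA (J_asc hF).
- move=> X /=; rewrite bmapLc; by_elt; rewrite (J_nat1 hG) !mcompA -!fmap_comp -!mcompA.
  have -> : fmap F (lun X) ∘ (mon_J F unit_ob X ∘ (mon_eps F ⊗' id_mor (F X))) = lun (F X).
    by rewrite -[LHS]comp_idr -!mcompA (J_lun hF) comp_idr.
  exact: J_lun.
- move=> X /=; rewrite bmapRc; by_elt; rewrite (J_nat2 hG) !mcompA -!fmap_comp -!mcompA.
  have -> : fmap F (run X) ∘ (mon_J F X unit_ob ∘ (id_mor (F X) ⊗' mon_eps F)) = run (F X).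
    by rewrite -[LHS]comp_idr -!mcompA (J_run hF) comp_idr.
  exact: J_run.
Qed.

Lemma monfun_iso_refl F : monfun_iso F F.
Proof.
exists (fun X => id_mor (F X)); split.
- by split=> [X Y f|X]; [rewrite comp_idl comp_idr|exact: is_iso_id].
- by move=> X Y; rewrite bmap_id comp_idl comp_idr.
- by rewrite comp_idl.
Qed.

Lemma monfun_iso_sym F G : monfun_iso F G -> monfun_iso G F.
Proof.
move=> [eta [heta J e]]; have [nat i] := heta; exists (fun m => inv (eta m)); split.
- exact: natural_iso_inv.
- move=> X Y; apply: (iso_mono (i _)); rewrite mcompA Kinv // comp_idl mcompA J.
  by rewrite -mcompA -bmap_comp !Kinv // bmap_id comp_idr.
- by rewrite -e mcompA invK // comp_idl.
Qed.

Lemma monfun_iso_trans F G H : monfun_iso F G -> monfun_iso G H -> monfun_iso F H.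
Proof.
move=> [eta [[nat i] J e]] [eta' [[nat' i'] J' e']].
exists (fun m => eta' m ∘ eta m); split.
- split=> [X Y f|X]; last exact: is_iso_comp.
  by rewrite -mcompA nat !mcompA nat'.
- by move=> X Y; rewrite bmap_comp -mcompA J !mcompA J'.
- by rewrite -mcompA e e'.
Qed.

Lemma monfun_comp_congr F F' G G' : monoidal G ->
  monfun_iso F F' -> monfun_iso G G' -> monfun_iso (monfun_comp G F) (monfun_comp G' F').
Proof.
move=> [_ nG _ _ _] [eta [[nat i] J e]] [eta' [[nat' i'] J' e']].
exists (fun X => eta' (F' X) ∘ fmap G (eta X)); split.
- split=> [X Y f|X] /=.
    by rewrite -mcompA -fmap_comp nat fmap_comp !mcompA nat'.
  by apply: is_iso_comp => //; exact: is_iso_fmap.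
- move=> X Y /=; rewrite bmap_comp -mcompA (mcompA (fmap G _)) -fmap_comp J fmap_comp.
  rewrite !mcompA nat' -(mcompA _ (fmap G (_ ⊗' _))) -nG.
  by rewrite -!mcompA (mcompA (eta' _)) J' -!mcompA.
- by rewrite /= -mcompA (mcompA (fmap G _)) -fmap_comp e mcompA nat' -mcompA e'.
Qed.

Lemma monfun_compA F G H :
  monfun_iso (monfun_comp (monfun_comp H G) F) (monfun_comp H (monfun_comp G F)).
Proof.
exists (fun X => id_mor _); split.
- by split=> [X Y f|X]; [rewrite comp_idl comp_idr|exact: is_iso_id].
- by move=> X Y; rewrite bmap_id comp_idl comp_idr /= fmap_comp mcompA.
- by rewrite comp_idl /= fmap_comp mcompA.
Qed.

Lemma monfun_comp1 F : monfun_iso (monfun_comp monfun_id F) F.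
Proof.
exists (fun X => id_mor _); split.
- by split=> [X Y f|X]; [rewrite comp_idl comp_idr|exact: is_iso_id].
- by move=> X Y; rewrite bmap_id comp_idl comp_idr /= comp_idr.
- by rewrite comp_idl /= comp_idr.
Qed.

(** As for bimodule functors, [J] and [e] are forced by the wish that [eps] be monoidal, and their
    axioms are verified under [F]. *)
Lemma monoidal_inverse F : monoidal F -> equivalence F ->
  exists G : monfun C C, [/\ monoidal G, equivalence G,
    monfun_iso (monfun_comp F G) monfun_id & monfun_iso (monfun_comp G F) monfun_id].
Proof.
move=> hF eF; have faF := equivalence_faithful eF; have fuF := equivalence_full eF.
have [G [eps heps]] := quasi_inverse faF fuF (equivalence_ess_surj eF).
have [neps ieps] := heps; have {}ieps (X : C) : is_iso (eps X) := ieps X.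
have {}neps X Y f W (x : mor C W _) : eps Y ∘ (fmap F (fmap G f) ∘ x) = f ∘ (eps X ∘ x).
  by rewrite mcompA neps mcompA.
have eG : equivalence G.
  apply: (@equivalence_cancel_l _ _ _ _ F) => //.
  exact: equivalence_natural_iso (natural_iso_inv heps) (equivalence_id C).
pose inner X Y := inv (eps (X ⊗ Y)) ∘ (eps X ⊗' eps Y) ∘ inv (mon_J F (G X) (G Y)).
have [J JE] : exists J : forall X Y, mor C (G X ⊗ G Y) (G (X ⊗ Y)), forall X Y,
    fmap F (J X Y) = inner X Y.
  pose h X Y := cid (fuF _ _ (inner X Y)).
  by exists (fun X Y => sval (h X Y)) => X Y; case: (h X Y).
have [e eE] := fuF _ _ (inv (eps unit_ob) ∘ inv (mon_eps F)).
have JP X Y W (x : mor C W _) :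
    eps (X ⊗ Y) ∘ (fmap F (J X Y) ∘ (mon_J F (G X) (G Y) ∘ x)) = (eps X ⊗' eps Y) ∘ x.
  by rewrite JE -!mcompA Kinve // invKe //; exact: is_iso_J.
have JP' X Y : eps (X ⊗ Y) ∘ (fmap F (J X Y) ∘ mon_J F (G X) (G Y)) = eps X ⊗' eps Y.
  by rewrite -[LHS]comp_idr -!mcompA JP comp_idr.
have eP : eps unit_ob ∘ (fmap F e ∘ mon_eps F) = id_mor unit_ob.
  by rewrite eE -!mcompA invK ?comp_idr ?Kinv //; exact: is_iso_eps.
have hG : monoidal (MonFun J e).
  split=> /=.
  - split=> [X Y|]; apply: (ff_is_iso faF fuF).
      rewrite JE; apply: is_iso_comp; last exact/is_iso_inv/is_iso_J.
      by apply: is_iso_comp; [exact: is_iso_inv|exact: is_iso_bmap].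
    by rewrite eE; apply: is_iso_comp; apply: is_iso_inv => //; exact: is_iso_eps.
  - move=> X X' Y Y' f g; apply: faF; apply: (iso_epi (is_iso_J hF _ _)).
    apply: (iso_mono (ieps _)); by_elt; rewrite !fmap_comp -!mcompA neps JP.
    have [_ n _ _ _] := hF; rewrite (mcompA (fmap F (_ ⊗' _))) -n -mcompA JP.
    rewrite !mcompA -!bmap_comp; congr (_ ⊗' _ ∘ _); rewrite -[LHS]comp_idr -mcompA neps comp_idr //.
  - move=> X Y Z; apply: faF; apply: (iso_epi (is_iso_J hF _ _)).
    apply: (@iso_epi _ _ _ _ _ (mon_J F (G X) (G Y) ⊗' id_mor (F (G Z)))).
      exact: is_iso_bmap (is_iso_J hF _ _) (is_iso_id _).
    apply: (iso_mono (ieps _)); by_elt; rewrite !fmap_comp -!mcompA neps.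
    rewrite -(J_nat1 hF) JP (J_asc hF) -(J_nat2 hF) JP.
    by rewrite bmapL3 bmapR3 !JP' !mcompA asc_nat.
  - move=> X; apply: faF; apply: (iso_epi (is_iso_J hF _ _)).
    apply: (@iso_epi _ _ _ _ _ (mon_eps F ⊗' id_mor (F (G X)))).
      exact: is_iso_bmap (is_iso_eps hF) (is_iso_id _).
    apply: (iso_mono (ieps _)); by_elt; rewrite !fmap_comp -!mcompA neps.
    rewrite -(J_nat1 hF) JP (J_lun hF) bmapL3 eP.
    by rewrite mcompA lun_nat -mcompA.
  - move=> X; apply: faF; apply: (iso_epi (is_iso_J hF _ _)).
    apply: (@iso_epi _ _ _ _ _ (id_mor (F (G X)) ⊗' mon_eps F)).
      exact: is_iso_bmap (is_iso_id _) (is_iso_eps hF).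
    apply: (iso_mono (ieps _)); by_elt; rewrite !fmap_comp -!mcompA neps.
    rewrite -(J_nat2 hF) JP (J_run hF) bmapR3 eP.
    by rewrite mcompA run_nat -mcompA.
have FG : monfun_iso (monfun_comp F (MonFun J e)) monfun_id.
  exists eps; split=> /=; [exact: heps| |exact: eP].
  by move=> X Y; rewrite JP' comp_idl.
exists (MonFun J e); split=> //.
(* The unit of the equivalence is defined as the preimage of [eps] at [F X], so that its properties
   can be read off from those of [eps]. *)
have [eta etaE] : exists eta : forall X, mor C (G (F X)) X, forall X, fmap F (eta X) = eps (F X).
  pose h X := cid (fuF _ _ (eps (F X))).
  by exists (fun X => sval (h X)) => X; case: (h X).
exists eta; split=> /=.
- split=> [X Y f|X] /=; last by apply: (ff_is_iso faF fuF); rewrite etaE.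
  by apply: faF; rewrite !fmap_comp !etaE; apply: eltP => ? x; rewrite -!mcompA neps.
- move=> X Y; rewrite comp_idl; apply: faF; apply: (iso_epi (is_iso_J hF _ _)).
  by_elt; rewrite !fmap_comp -!mcompA etaE neps JP.
  have [_ n _ _ _] := hF; rewrite [RHS]mcompA -n !etaE.
  by rewrite !mcompA.
- apply: faF; rewrite !fmap_comp etaE; apply: (iso_epi (is_iso_eps hF)).
  by rewrite fmap_id comp_idl -!mcompA (neps _ _ (mon_eps F)) eP comp_idr.
Qed.

End MonoidalFunctorTheory.

(** * Twisted half-braidings *)

Section TwistedCentral.
Variables (k : fieldType) (C : moncat k).
Implicit Types (M N : bimod C) (F G : monfun C C).

(* A half-braiding of [c] relative to [F]; these are the right module structures
   on the left module functor [X |-> X ▷ c] from [twist F] to [M]. *)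
Definition twisted_central M F (c : M) (u : forall Y, mor M (c ◁ Y) (F Y ▷ c)) : Prop :=
  [/\ forall Y Y' (f : mor C Y Y'), u Y' ∘ (id_mor c ◁' f) = (fmap F f ▷' id_mor c) ∘ u Y,
      forall Y, is_iso (u Y),
      forall X Y, (mon_J F X Y ▷' id_mor c) ∘ inv (la M (F X) (F Y) c)
          ∘ (id_mor (F X) ▷' u Y) ∘ mid M (F X) c Y ∘ (u X ◁' id_mor Y) =
        u (X ⊗ Y) ∘ ra M c X Y
    & u unit_ob ∘ ru M c = (mon_eps F ▷' id_mor c) ∘ lu M c].

Section Functor.
Variables (M : bimod C) (F : monfun C C) (c : M) (u : forall Y, mor M (c ◁ Y) (F Y ▷ c)).
Hypotheses (hl : left_module M) (hr : right_module M) (hm : middle_associative M).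
Hypothesis hu : twisted_central u.

Lemma is_iso_u Y : is_iso (u Y).
Proof. by case: hu. Qed.

Lemma u_nat Y Y' (f : mor C Y Y') W (x : mor M W _) :
  u Y' ∘ ((id_mor c ◁' f) ∘ x) = (fmap F f ▷' id_mor c) ∘ (u Y ∘ x).
Proof. by case: hu => h _ _ _; rewrite !mcompA h. Qed.

Lemma u_hex X Y W (x : mor M W _) :
  (mon_J F X Y ▷' id_mor c) ∘ (inv (la M (F X) (F Y) c) ∘
    ((id_mor (F X) ▷' u Y) ∘ (mid M (F X) c Y ∘ ((u X ◁' id_mor Y) ∘ x)))) =
  u (X ⊗ Y) ∘ (ra M c X Y ∘ x).
Proof. by case: hu => _ _ h _; rewrite !mcompA h. Qed.

Lemma u_unit W (x : mor M W _) :
  u unit_ob ∘ (ru M c ∘ x) = (mon_eps F ▷' id_mor c) ∘ (lu M c ∘ x).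
Proof. by case: hu => _ _ _ h; rewrite !mcompA h. Qed.

Lemma u_hexL m X Y W (x : mor M W _) :
  (id_mor m ▷' (mon_J F X Y ▷' id_mor c)) ∘ ((id_mor m ▷' inv (la M (F X) (F Y) c)) ∘
    ((id_mor m ▷' (id_mor (F X) ▷' u Y)) ∘ ((id_mor m ▷' mid M (F X) c Y) ∘
      ((id_mor m ▷' (u X ◁' id_mor Y)) ∘ x)))) =
  (id_mor m ▷' u (X ⊗ Y)) ∘ ((id_mor m ▷' ra M c X Y) ∘ x).
Proof. by case: hu => _ _ h _; rewrite !mcompA -!bmapRc h. Qed.

Definition act_functor : bimodfun (twist F) M :=
  @BimodFun _ _ (twist F) M (fix_right (lact M) c) (fun X m => la M X m c)
    (fun m X => inv (la M m (F X) c) ∘ ((id_mor m ▷' u X) ∘ mid M m c X)).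

Lemma act_functor_left : left_module_functor (bf_l act_functor).
Proof.
split=> /=.
- by move=> X X' m m' f h; have [n _ _ _ _] := hl; rewrite n.
- by move=> *; exact: is_iso_la.
- by move=> X Y m; by_elt; rewrite (la_pentagon hl).
- by move=> m; apply: eltP => ? x; rewrite -mcompA (la_unit2 hl).
Qed.

Lemma act_functor_right : right_module_functor (bf_r act_functor).
Proof.
split=> /=.
- move=> m m' X X' h f; rewrite [_ ◁' f]bmapLR [h ⊗' _]bmapLR bmapLc.
  by_elt; rewrite (mid_nat1 hm) (mid_nat3 hm) -bmap_swap (laV_nat1 hl).
  congr (_ ∘ _); rewrite -(laV_nat2 hl); congr (_ ∘ _).
  rewrite [LHS]mcompA [RHS]mcompA -!bmapRc; congr (bmap _ _ _ ∘ _).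
  by case: hu.
- move=> m X; apply: is_iso_comp; first exact/is_iso_inv/is_iso_la.
  apply: is_iso_comp; last exact: is_iso_mid.
  exact: is_iso_bmap (is_iso_id _) (is_iso_u _).
- move=> m X Y; rewrite !bmapLc; by_elt.
  rewrite (mid_laV hl hm) -(laV_nat3 hl) (laV_pentagon hl) -(laV_nat2 hl).
  by rewrite (mid_nat2 hm) u_hexL (mid_ra hm).
- move=> m; rewrite bmapLc; by_elt.
  have e : u unit_ob ∘ ru M c = (mon_eps F ▷' id_mor c) ∘ lu M c by case: hu.
  rewrite (mid_ru hr hm) [X in inv _ ∘ X]mcompA -bmapRc e bmapRc -mcompA.
  rewrite (laV_nat2 hl) -(la_unit hl) invKe //; exact: is_iso_la.
Qed.

Lemma act_functor_bimodule : bimodule_functor act_functor.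
Proof.
split; [exact: act_functor_left|exact: act_functor_right|].
move=> X m Y /=; rewrite !bmapRc; by_elt.
rewrite -(mid_la hm) -(la_nat3 hl).
apply: (iso_mono (is_iso_bmap (lact M) (is_iso_id X) (is_iso_la hl m (F Y) c))).
rewrite -(la_pentagon hl) (Kinve _ (is_iso_la hl _ _ _)) mcompA -bmapRc.
by rewrite Kinv ?bmap_id ?comp_idl //; exact: is_iso_la.
Qed.

Hypotheses (fV : faithful (fix_right (lact M) c)) (fuV : full (fix_right (lact M) c)).

(** The right module axioms of [M] are reflected to [twist F] along $X\mapsto X ▷ c$, and those of
    [twist F] say that [F] is monoidal. No tensor axiom of [F] has to be computed. *)
Lemma twisted_central_monoidal : monoidal F.
Proof.
apply: right_module_monoidal.
exact: (right_module_reflect hr act_functor_right fV fuV).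
Qed.

End Functor.

Section Uniqueness.
Variables (M : bimod C) (F F' : monfun C C) (c : M).
Variables (u : forall Y, mor M (c ◁ Y) (F Y ▷ c)) (u' : forall Y, mor M (c ◁ Y) (F' Y ▷ c)).
Hypotheses (hl : left_module M) (hr : right_module M) (hm : middle_associative M).
Hypotheses (hu : twisted_central u) (hu' : twisted_central u').
Hypotheses (fV : faithful (fix_right (lact M) c)) (fuV : full (fix_right (lact M) c)).

(** Both $F X ▷ c$ and $F' X ▷ c$ are identified with $c ◁ X$, and $X\mapsto X ▷ c$ is fully
    faithful: the object [c] determines [F]. For the regular bimodule this is the uniqueness of
    conjugation by [c]. *)
Lemma twisted_central_monfun_iso : monfun_iso F F'.
Proof.
have [eta etaE] : exists eta : forall X, mor C (F X) (F' X), forall X,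
    eta X ▷' id_mor c = u' X ∘ inv (u X).
  pose h X := cid (fuV (u' X ∘ inv (u X) : mor M (fix_right (lact M) c (F X)) (fix_right (lact M) c (F' X)))).
  by exists (fun X => sval (h X)) => X; case: (h X).
have iu := is_iso_u hu; have iu' := is_iso_u hu'.
have etaP X W (x : mor M W _) : (eta X ▷' id_mor c) ∘ (u X ∘ x) = u' X ∘ x.
  by rewrite etaE -mcompA invKe.
exists eta; split.
- split=> [X Y f|X].
    apply: fV => /=; rewrite !bmapLc; apply: (iso_epi (iu X)); by_elt.
    by rewrite -(u_nat hu) !etaP (u_nat hu').
  apply: (ff_is_iso fV fuV); rewrite /= etaE.
  by apply: is_iso_comp => //; exact: is_iso_inv.
- move=> X Y; apply: fV => /=; rewrite !bmapLc.
  apply: (iso_epi (is_iso_inv (is_iso_la hl _ _ _))).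
  apply: (iso_epi (is_iso_bmap (lact M) (is_iso_id _) (iu Y))).
  apply: (iso_epi (is_iso_mid hm _ _ _)).
  apply: (iso_epi (is_iso_bmap (ract M) (iu X) (is_iso_id Y))).
  by_elt; rewrite (u_hex hu) etaP -(u_hex hu').
  rewrite [eta X ⊗' eta Y]bmapRL bmapLc -!mcompA; congr (_ ∘ _).
  rewrite -(laV_nat1 hl) -(laV_nat2 hl) bmap_swap -(mid_nat1 hm); congr (_ ∘ _).
  have e Z : (eta Z ▷' id_mor c) ∘ u Z = u' Z.
    by rewrite -[LHS]comp_idr -mcompA etaP comp_idr.
  by rewrite [RHS]mcompA -bmapRc e (mcompA (_ ◁' id_mor Y)) -bmapLc e.
- apply: fV => /=; rewrite bmapLc; apply: (iso_epi (is_iso_lu hl c)); by_elt.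
  by rewrite -(u_unit hu) etaP (u_unit hu').
Qed.

End Uniqueness.

Section OfBimoduleFunctor.
Variables (M : bimod C) (F : monfun C C) (T : bimodfun (twist F) M).
Hypotheses (ltw : left_module (twist F)) (hl : left_module M) (hT : bimodule_functor T).
Let c := T (unit_ob : C).
Let sw Y : mor (twist F) (unit_ob ⊗ F Y) (F Y ⊗ unit_ob) := bwd (run (F Y)) ∘ lun (F Y).

Definition central_of_functor Y : mor M (c ◁ Y) (F Y ▷ c) :=
  bf_l T (F Y) unit_ob ∘ (fmap T (sw Y) ∘ bf_r T unit_ob Y).

Lemma central_of_functor_central : twisted_central central_of_functor.
Proof.
have [lT rT _] := hT; have il := is_iso_mfl lT; have ir := is_iso_mfr rT.
split.
- move=> Y Y' f; by_elt; rewrite (mfr_nat2 rT) -(mfl_nat1 lT).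
  congr (_ ∘ _); rewrite !mcompA -!fmap_comp; congr (fmap T _ ∘ _ ∘ _).
  by rewrite /sw /=; strictify.
- move=> Y; apply: is_iso_comp (il _ _) (is_iso_comp _ (ir _ _)).
  by apply/is_iso_fmap/is_iso_comp; [exact: is_iso_bwd|exact: is_iso_fwd].
- move=> X Y; rewrite !bmapRc !bmapLc; by_elt.
  rewrite (bf_mid hT) (mfr_nat1 rT) -(mfl_nat2 lT) (mfl_laV lT ltw hl) -(mfl_nat1 lT).
  rewrite -(mfr_ra rT); congr (_ ∘ _).
  rewrite !mcompA -!fmap_comp; congr (fmap T _ ∘ _ ∘ _ ∘ _).
  by rewrite /sw /= fmap_id inv_fwd; strictify.
- rewrite /central_of_functor; by_elt.
  rewrite (mfr_ru rT) -(mfl_lu lT) -(mfl_nat1 lT); congr (_ ∘ _).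
  rewrite !mcompA -!fmap_comp; congr (fmap T _ ∘ _).
  by rewrite /sw /=; strictify.
Qed.

(** The isomorphism is $X ▷ T(1)\cong T(X\otimes 1)\cong T(X)$. If [T] is an equivalence then so is
    the action on [c], which for the regular bimodule makes [c] invertible. *)
Lemma central_of_functor_natural_iso :
  @natural_iso _ _ _ (fix_right (lact M) c) (T : functor C M)
    (fun X => fmap T (run X : mor (twist F) (X ⊗ unit_ob) X) ∘ inv (bf_l T X unit_ob)).
Proof.
have [lT _ _] := hT; have il := is_iso_mfl lT.
split=> [X Y f|X] /=; last first.
  apply: is_iso_comp; last exact: is_iso_inv.
  by apply/is_iso_fmap/is_iso_fwd.
apply: (iso_epi (il X unit_ob)); by_elt; rewrite -(mfl_nat1 lT) !invKe //.
rewrite !mcompA -!fmap_comp; congr (fmap T _ ∘ _).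
exact: run_nat.
Qed.

End OfBimoduleFunctor.
End TwistedCentral.

(** * Recognition of twists among bimodule categories *)

Section TwistedForms.
Variables (k : fieldType) (C : moncat k).
Implicit Types M N : bimod C.

(** Since $X\mapsto X ▷ c$ is an equivalence, $F Y ▷ c\cong c ◁ Y$ can be solved for [F Y]. The
    action on morphisms, [J] and [e] are then the unique solutions of the four conditions of
    [twisted_central]. *)
Lemma exists_twisted_central M (c : M) :
  left_module M -> right_module M -> middle_associative M ->
  equivalence (fix_right (lact M) c) ->
  exists (F : monfun C C) (u : forall Y : C, mor M (c ◁ Y) (F Y ▷ c)), @twisted_central k C M F c u.
Proof.
move=> hl hr hm eV.
have faV X Y (f g : mor C X Y) : f ▷' id_mor c = g ▷' id_mor c -> f = g.
  exact: (equivalence_faithful eV).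
have fuV X Y (g : mor M (X ▷ c) (Y ▷ c)) : exists f : mor C X Y, f ▷' id_mor c = g.
  exact: (equivalence_full eV).
have esV := equivalence_ess_surj eV.
pose F0 Y : C := sval (cid (esV (c ◁ Y))).
have [u iu] : exists u : forall Y, mor M (c ◁ Y) (F0 Y ▷ c), forall Y, is_iso (u Y).
  have h Y : exists f : mor M (c ◁ Y) (F0 Y ▷ c), is_iso f.
    by apply: isomorphic_sym; rewrite /F0; case: cid.
  by exists (fun Y => sval (cid (h Y))) => Y; case: cid.
pose F1 Y Y' (f : mor C Y Y') : mor C (F0 Y) (F0 Y') :=
  sval (cid (fuV _ _ (u Y' ∘ (id_mor c ◁' f) ∘ inv (u Y)))).
have F1E Y Y' (f : mor C Y Y') : F1 _ _ f ▷' id_mor c = u Y' ∘ (id_mor c ◁' f) ∘ inv (u Y).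
  by rewrite /F1; case: cid.
have Fid Y : F1 _ _ (id_mor Y) = id_mor (F0 Y).
  by apply: faV; rewrite F1E !bmap_id comp_idr Kinv.
have Fcomp X Y Z (g : mor C Y Z) (f : mor C X Y) : F1 _ _ (g ∘ f) = F1 _ _ g ∘ F1 _ _ f.
  by apply: faV; rewrite bmapLc !F1E bmapRc -!mcompA invKe.
have Flin X Y a (f g : mor C X Y) : F1 _ _ (a *: f + g) = a *: F1 _ _ f + F1 _ _ g.
  by apply: faV; rewrite bmap_linl !F1E bmap_linr comp_linr comp_linl.
have [J JE] : exists J : forall X Y, mor C (F0 X ⊗ F0 Y) (F0 (X ⊗ Y)), forall X Y,
    J X Y ▷' id_mor c = u (X ⊗ Y) ∘ ra M c X Y ∘ inv (inv (la M (F0 X) (F0 Y) c)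
      ∘ (id_mor (F0 X) ▷' u Y) ∘ mid M (F0 X) c Y ∘ (u X ◁' id_mor Y)).
  pose h X Y := cid (fuV (F0 X ⊗ F0 Y) (F0 (X ⊗ Y)) (u (X ⊗ Y) ∘ ra M c X Y ∘
    inv (inv (la M (F0 X) (F0 Y) c)
      ∘ (id_mor (F0 X) ▷' u Y) ∘ mid M (F0 X) c Y ∘ (u X ◁' id_mor Y)))).
  by exists (fun X Y => sval (h X Y)) => X Y; case: (h X Y).
have [e eE] := fuV _ _ (u unit_ob ∘ ru M c ∘ inv (lu M c)).
exists (MonFun (mon_fun := Functor Fid Fcomp Flin) J e), u; split=> //=.
- by move=> Y Y' f; rewrite F1E -!mcompA invK // comp_idr.
- move=> X Y; rewrite -!(mcompA (J X Y ▷' id_mor c)) JE -!mcompA invK ?comp_idr //.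
  apply: is_iso_comp (is_iso_inv (is_iso_la hl _ _ _)) _.
  apply: is_iso_comp (is_iso_bmap _ (is_iso_id _) (iu _)) _.
  exact: is_iso_comp (is_iso_mid hm _ _ _) (is_iso_bmap _ (iu _) (is_iso_id _)).
- by rewrite eE -mcompA invK ?comp_idr //; exact: is_iso_lu.
Qed.

Lemma act_equivalence_twist M (c : M) : is_bimodule M ->
  equivalence (fix_right (lact M) c) ->
  exists F : monfun C C, monoidal F /\ bimodule_equivalent (twist F) M.
Proof.
move=> [_ hl hr hm] eV; have [F [u hu]] := exists_twisted_central hl hr hm eV.
exists F; split.
  apply: (twisted_central_monoidal hl hr hm hu).
    exact: equivalence_faithful.
  exact: equivalence_full.
exists (act_functor u); split=> //; exact: act_functor_bimodule.
Qed.

Lemma left_module_equivalent_twist M : is_bimodule M ->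
  left_module_equivalent M (regular_bimod C) ->
  exists F : monfun C C, monoidal F /\ bimodule_equivalent (twist F) M.
Proof.
move=> hM [S [s [hs eS]]].
have [c [j ij]] := equivalence_ess_surj eS (unit_ob : C).
apply: (act_equivalence_twist (c := c)) => //.
apply: (equivalence_cancel_l eS).
(* With $S c\cong 1$ one has $S(X ▷ c)\cong X\otimes S c\cong X$, so [S] after the action on [c] is
   isomorphic to the identity. *)
pose eta (X : C) : mor C X (S (X ▷ c)) :=
  inv (s X c) ∘ ((id_mor X ⊗' inv j) ∘ bwd (run X)).
apply: (@equivalence_natural_iso _ _ _ (fid C) (fcomp S (fix_right (lact M) c)) eta _ (equivalence_id C)).
have is_ := is_iso_mfl hs; split=> [X Y f|X] /=; last first.
  apply: is_iso_comp; first exact: is_iso_inv.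
  apply: is_iso_comp; last exact: is_iso_bwd.
  exact: is_iso_bmap (is_iso_id _) (is_iso_inv ij).
apply: (iso_mono (is_ Y c)); rewrite /eta; by_elt.
rewrite (Kinve _ (is_ Y c)) (mfl_nat1 hs) (Kinve _ (is_ X c)) [in RHS]bmap_swap.
congr (_ ∘ _); rewrite !mcompA; congr (_ ∘ _).
by rewrite /=; strictify.
Qed.

Section Restrict.
Variables (M N : bimod C) (F G : monfun C C).

Lemma restrict_equivalent :
  bimodule_equivalent M N -> bimodule_equivalent (restrict M F) (restrict N F).
Proof.
move=> [T [hT eT]]; have [lT rT mT] := hT.
exists (@BimodFun _ _ (restrict M F) (restrict N F) T (bf_l T) (fun m X => bf_r T m (F X))).
split=> //; split=> //.
- split=> /=.
  + by move=> m m' X X' h f; case: rT.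
  + by move=> *; exact: is_iso_mfr.
  + move=> m X Y; rewrite fmap_id fmap_comp; by_elt; rewrite (mfr_ra rT).
    by rewrite (mfr_nat2 rT).
  + by move=> m; by_elt; rewrite (mfr_nat2 rT) (mfr_ru rT) fmap_comp -mcompA.
- by move=> X m Y /=; rewrite fmap_id.
Qed.

Lemma restrict_monfun_iso : right_module M -> middle_associative M -> monfun_iso F G ->
  bimodule_equivalent (restrict M F) (restrict M G).
Proof.
(* The right constraint of a bimodule functor starts at the action of the target, here $m ◁ G X\to m
   ◁ F X$, so the isomorphism is needed in the direction from [G] to [F]. *)
move=> hr hm /monfun_iso_sym [eta [[nat i] J e]].
exists (@BimodFun _ _ (restrict M F) (restrict M G) (fid M)
  (fun X m => id_mor (X ▷ m)) (fun m X => bmap (ract M) (id_mor (m : M)) (eta X))).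
split; last exact: equivalence_id.
split; [split|split|] => /=.
- by move=> *; rewrite comp_idl comp_idr.
- by move=> *; exact: is_iso_id.
- by move=> *; rewrite bmap_id !comp_idl comp_idr.
- by move=> *; rewrite comp_idl.
- by move=> m m' X X' h f; rewrite -!bmap_comp nat comp_idl comp_idr.
- by move=> *; exact: is_iso_bmap (is_iso_id _) (i _).
- move=> m X Y; rewrite fmap_id; by_elt; rewrite (ra_nat3 hr) (ra_nat2 hr) !mcompA -!bmapRc.
  by rewrite J -(mcompA (mon_J F X Y)) -bmapRL.
- by move=> m; rewrite mcompA -bmapRc e.
- move=> X m Y; rewrite fmap_id bmap_id comp_idr comp_idl.
  by by_elt; rewrite (mid_nat3 hm).
Qed.

Lemma restrict_restrict : right_module M ->
  bimodule_equivalent (restrict (restrict M G) F) (restrict M (monfun_comp G F)).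
Proof.
move=> hr.
exists (@BimodFun _ _ (restrict (restrict M G) F) (restrict M (monfun_comp G F)) (fid M)
  (fun X m => id_mor (X ▷ m)) (fun m X => id_mor (ract M m (G (F X))))).
split; last exact: equivalence_id.
split; [split|split|] => /=.
- by move=> *; rewrite comp_idl comp_idr.
- by move=> *; exact: is_iso_id.
- by move=> *; rewrite bmap_id !comp_idl comp_idr.
- by move=> *; rewrite comp_idl.
- by move=> *; rewrite comp_idl comp_idr.
- by move=> *; exact: is_iso_id.
- by move=> m X Y; rewrite !fmap_id !bmap_id !comp_idr comp_idl bmapRc mcompA.
- by move=> m; rewrite comp_idl bmapRc mcompA.
- by move=> X m Y; rewrite !fmap_id !bmap_id !comp_idr !comp_idl.
Qed.

Lemma restrict_id : bimodule_equivalent (restrict M (monfun_id C)) M.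
Proof.
exists (@BimodFun _ _ (restrict M (monfun_id C)) M (fid M)
  (fun X m => id_mor (X ▷ m)) (fun m X => id_mor (m ◁ X))).
split; last exact: equivalence_id.
split; [split|split|] => /=.
- by move=> *; rewrite comp_idl comp_idr.
- by move=> *; exact: is_iso_id.
- by move=> *; rewrite bmap_id !comp_idl comp_idr.
- by move=> *; rewrite comp_idl.
- by move=> *; rewrite comp_idl comp_idr.
- by move=> *; exact: is_iso_id.
- by move=> m X Y; rewrite !bmap_id !comp_idr !comp_idl.
- by move=> m; rewrite bmap_id.
- by move=> X m Y; rewrite !bmap_id !comp_idr !comp_idl.
Qed.

End Restrict.
End TwistedForms.

(** * Relative tensor products *)

Section RelativeTensorTwist.
Variables (k : fieldType) (C : moncat k) (M N : bimod C) (F : monfun C C).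
Variables (S : functor N C) (s : forall X n, mor C (S (X ▷ n)) (X ⊗ S n)).
Variable t : forall n X, mor C (S n ⊗ F X) (S (n ◁ X)).
Hypotheses (hl : left_module M) (hr : right_module M) (hm : middle_associative M).
Hypotheses (lS : @left_module_functor k C N (twist F) S s).
Hypotheses (rS : @right_module_functor k C N (twist F) S t).
Hypothesis mS : forall X n Y,
  (id_mor X ⊗' t n Y) ∘ asc X (S n) (F Y) ∘ (s X n ⊗' id_mor (F Y)) =
  s X (n ◁ Y) ∘ fmap S (mid N X n Y) ∘ t (X ▷ n) Y.
Hypothesis eS : equivalence S.

Let is_ X n : is_iso (s X n). Proof. exact: is_iso_mfl lS X n. Qed.

Let s_nat1 X X' (f : mor C X X') n W (x : mor C W _) :
  s X' n ∘ (fmap S (f ▷' id_mor n) ∘ x) = (f ⊗' id_mor (S n)) ∘ (s X n ∘ x).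
Proof. exact: (mfl_nat1 lS). Qed.

Let s_nat2 X n n' (f : mor N n n') W (x : mor C W _) :
  s X n' ∘ (fmap S (id_mor X ▷' f) ∘ x) = (id_mor X ⊗' fmap S f) ∘ (s X n ∘ x).
Proof. exact: (mfl_nat2 lS). Qed.

Let s_la X Y n W (x : mor C W _) :
  (id_mor X ⊗' s Y n) ∘ (s X (Y ▷ n) ∘ (fmap S (la N X Y n) ∘ x)) =
  asc X Y (S n) ∘ (s (X ⊗ Y) n ∘ x).
Proof. by apply/esym; exact: (mfl_la lS). Qed.

Lemma sV_nat X X' n n' (f : mor C X X') (g : mor N n n') :
  inv (s X' n') ∘ (f ⊗' fmap S g) = fmap S (f ▷' g) ∘ inv (s X n).
Proof.
apply: (iso_mono (is_ X' n')); apply: (iso_epi (is_ X n)).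
rewrite -!mcompA invK // comp_idr (Kinve _ (is_ X' n')).
by have [h _ _ _] := lS; rewrite [RHS]h.
Qed.

Lemma sV_la X Y n :
  inv (s X (Y ▷ n)) ∘ ((id_mor X ⊗' inv (s Y n)) ∘ asc X Y (S n)) =
  fmap S (la N X Y n) ∘ inv (s (X ⊗ Y) n).
Proof.
apply: (iso_mono (is_ X (Y ▷ n))); rewrite (Kinve _ (is_ X _)).
apply: (iso_mono (is_iso_bmap (tens C) (is_iso_id X) (is_ Y n))).
rewrite mcompA -bmapRc Kinv // bmap_id comp_idl.
apply: (iso_epi (is_ (X ⊗ Y) n)); rewrite -!mcompA invK // comp_idr.
by have [_ _ h _] := lS; rewrite mcompA; exact: h.
Qed.

Lemma mid_sV X n Y :
  fmap S (mid N X n Y) ∘ (t (X ▷ n) Y ∘ (inv (s X n) ⊗' id_mor (F Y))) =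
  inv (s X (n ◁ Y)) ∘ ((id_mor X ⊗' t n Y) ∘ asc X (S n) (F Y)).
Proof.
apply: (iso_mono (is_ X (n ◁ Y))); rewrite (Kinve _ (is_ X _)).
apply: (iso_epi (is_iso_bmap (tens C) (is_ X n) (is_iso_id (F Y)))).
rewrite -!mcompA -bmapLc invK // bmap_id comp_idr.
by rewrite !mcompA mS.
Qed.

(** Here [S] identifies [N] with the twist by [F], and this bifunctor $(m,n)\mapsto m ◁ S n$ is the
    familiar map exhibiting $M\boxtimes_C C\cong M$, with the right action changed along [F]. *)
Definition twist_prod : bifunctor M N (restrict M F) := bicomp_right (ract M) S.
Definition twist_balance m X n : mor M (twist_prod (m ◁ X) n) (twist_prod m (X ▷ n)) :=
  bmap (ract M) (id_mor m) (inv (s X n)) ∘ ra M m X (S n).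
Definition twist_r m n X :
    mor (restrict M F) (twist_prod m n ◁ X) (twist_prod m (n ◁ X)) :=
  bmap (ract M) (id_mor m) (t n X) ∘ ra M m (S n) (F X).

Lemma twist_balanced : balanced twist_balance.
Proof.
split.
- move=> m m' X X' n n' f h g; rewrite /twist_balance /=.
  have [nr _ _ _ _] := hr; rewrite -mcompA nr !mcompA -!bmap_comp.
  by rewrite (sV_nat h g) comp_idl comp_idr.
- move=> m X n; apply: is_iso_comp; last exact: is_iso_ra.
  exact: is_iso_bmap (is_iso_id _) (is_iso_inv (is_ _ _)).
- move=> m X Y n; rewrite /twist_balance /= fmap_id; by_elt.
  rewrite (ra_nat3 hr) (ra_pentagon hr) !mcompA -!bmapRc.
  by rewrite -(sV_la X Y n) mcompA.
Qed.

(** Let $S c\cong 1$. A balanced [D] factors through $G=D(-,c)$. A transformation between functors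
    on [M] is recovered from its components at $(p,c)$ through the isomorphism [rho], $B(p,c)=p ◁ S
    c\cong p$. *)
Lemma twist_universal : universal_balanced twist_balance.
Proof.
have [c [j ij]] : exists c (j : mor C (S c) unit_ob), is_iso j.
  exact: (equivalence_ess_surj eS (unit_ob : C)).
have faS n n' (f g : mor N n n') : fmap S f = fmap S g -> f = g by exact: (equivalence_faithful eS).
have fuS n n' (f : mor C (S n) (S n')) : exists g, fmap S g = f by exact: (equivalence_full eS).
(* [q n] is the preimage under [S] of $S(S n ▷ c)\cong S n\otimes S c\cong S n$: every object of [N]
   is obtained from [c] by the left action. *)
have [q qE] : exists q : forall n, mor N (S n ▷ c) n, forall n,
    fmap S (q n) = run (S n) ∘ ((id_mor (S n) ⊗' j) ∘ s (S n) c).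
  pose h n := cid (fuS _ _ (run (S n) ∘ ((id_mor (S n) ⊗' j) ∘ s (S n) c))).
  by exists (fun n => sval (h n)) => n; case: (h n).
have iq n : is_iso (q n).
  apply: (ff_is_iso (equivalence_faithful eS) (equivalence_full eS)).
  rewrite qE; apply: is_iso_comp (is_iso_fwd _) (is_iso_comp _ (is_ _ _)).
  exact: is_iso_bmap (is_iso_id _) ij.
have qnat n n' (f : mor N n n') : q n' ∘ (fmap S f ▷' id_mor c) = f ∘ q n.
  apply: faS; rewrite !fmap_comp !qE; by_elt; rewrite s_nat1 -bmap_swap.
  by rewrite (mcompA (run _)) (run_nat (fmap S f)) -mcompA.
have qs X n : q (X ▷ n) ∘ (inv (s X n) ▷' id_mor c) = (id_mor X ▷' q n) ∘ la N X (S n) c.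
  apply: (iso_epi (is_iso_bmap (lact N) (is_ X n) (is_iso_id c))).
  rewrite -mcompA -bmapLc invK // bmap_id comp_idr.
  apply: faS; apply: (iso_mono (is_ X n)); rewrite !fmap_comp !qE; by_elt.
  rewrite s_nat2 !qE !bmapRc -!mcompA s_la s_nat1.
  rewrite !mcompA; do 2 congr (_ ∘ _).
  strictify T; by_elt.
  exact: (@hat_nat _ _ (Leaf _) (Node (Leaf X) (Leaf _)) (s X n) _ _ (hat (Leaf _) One j T)).
move=> E _; split.
- move=> D d [dnat id_ dla].
  have dnat2 m X X' (f : mor C X X') n W (x : mor E W _) :
      d m X' n ∘ (bmap D (id_mor m ◁' f) (id_mor n) ∘ x) =
      bmap D (id_mor m) (f ▷' id_mor n) ∘ (d m X n ∘ x).
    by rewrite !mcompA dnat.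
  have dnat3 m X n n' (f : mor N n n') W (x : mor E W _) :
      d m X n' ∘ (bmap D (id_mor (m ◁ X)) f ∘ x) =
      bmap D (id_mor m) (id_mor X ▷' f) ∘ (d m X n ∘ x).
    by rewrite !mcompA -bmap_id dnat.
  have dlae m X Y n W (x : mor E W _) :
      d m X (Y ▷ n) ∘ (d (m ◁ X) Y n ∘ x) = bmap D (id_mor m) (la N X Y n) ∘
        (d m (X ⊗ Y) n ∘ (bmap D (ra M m X Y) (id_mor n) ∘ x)).
    by rewrite !mcompA dla.
  (* The comparison is $D(m ◁ S n, c)\cong D(m, S n ▷ c)\cong D(m,n)$, by the balancing of [D] and
     then [q]. *)
  exists (fix_right D c : functor (restrict M F) E).
  exists (fun m n => bmap D (id_mor m) (q n) ∘ d m (S n) c); split.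
  + move=> m m' n n' f g /=.
    have := dnat m m' _ _ c c f (fmap S g) (id_mor c) => e.
    rewrite -mcompA e !mcompA -!bmap_comp; congr (bmap D _ _ ∘ _).
      by rewrite comp_idl comp_idr.
    exact: qnat.
  + move=> m n; apply: is_iso_comp (id_ _ _ _).
    exact: is_iso_bmap (is_iso_id _) (iq n).
  + move=> m X n /=; rewrite /twist_balance bmapLc; by_elt.
    by rewrite dnat2 dnat3 dlae mcompA -bmapRc qs bmapRc -mcompA.
- move=> G G' theta nat bal.
  have natR m n n' (f : mor N n n') W (x : mor E W _) :
      theta m n' ∘ (fmap G (id_mor m ◁' fmap S f) ∘ x) = fmap G' (id_mor m ◁' fmap S f) ∘ (theta m n ∘ x).
    by rewrite !mcompA; congr (_ ∘ _); exact: (nat _ _ _ _ (id_mor m) f).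
  have natL m m' n (f : mor M m m') W (x : mor E W _) :
      theta m' n ∘ (fmap G (f ◁' id_mor (S n)) ∘ x) =
      fmap G' (f ◁' id_mor (S n)) ∘ (theta m n ∘ x).
    rewrite !mcompA; congr (_ ∘ _); have := nat _ _ _ _ f (id_mor n).
    by rewrite /= fmap_id.
  pose rho (p : M) : mor M (p ◁ S c) p := inv (ru M p) ∘ (id_mor p ◁' j).
  have irho p : is_iso (rho p).
    apply: is_iso_comp; first exact/is_iso_inv/is_iso_ru.
    exact: is_iso_bmap (is_iso_id _) ij.
  have rho_nat p p' (f : mor M p p') : f ∘ rho p = rho p' ∘ (f ◁' id_mor (S c)).
    apply: (iso_mono (is_iso_ru hr p')); rewrite /rho; by_elt.
    rewrite (ru_nat hr) !(Kinve _ (is_iso_ru hr _)) -[in RHS]bmap_swap.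
    by [].
  (* On objects of the form [B m n], [rho] is the balancing followed by [q]. Compatibility of
     [theta] with the balancing therefore gives the extension the value [theta m n] there. *)
  have rhoE m n : rho (m ◁ S n) = (id_mor m ◁' fmap S (q n)) ∘ twist_balance m (S n) c.
    rewrite /rho /twist_balance qE; apply: (iso_mono (is_iso_ru hr _)); by_elt.
    rewrite (Kinve _ (is_iso_ru hr _)).
    have y : (id_mor m ◁' (run (S n) ∘ (id_mor (S n) ⊗' j ∘ s (S n) c))) ∘
        (id_mor m ◁' inv (s (S n) c)) =
        (id_mor m ◁' run (S n)) ∘ (id_mor m ◁' (id_mor (S n) ⊗' j)).
      by rewrite -!bmapRc -!mcompA Kinv // comp_idr.
    rewrite (mcompA (_ ◁' _) (_ ◁' _)) y -!mcompA -(ra_nat3 hr).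
    move: ((id_mor (m ◁ S n) ◁' j) ∘ _) => z.
    rewrite -{2}(Kinve z (is_iso_ru hr (m ◁ S n))) (ra_unit2 hr) (mcompA (_ ◁' _)) -bmapRc.
    by rewrite bwdK bmap_id comp_idl Kinve //; exact: is_iso_ru.
  have rhoV p : is_iso (fmap G (rho p)) by exact: is_iso_fmap.
  exists (fun p => fmap G' (rho p) ∘ (theta p c ∘ inv (fmap G (rho p)))); split.
  + move=> p p' f; apply: (iso_epi (rhoV p)); by_elt.
    rewrite (mcompA (fmap G f)) -fmap_comp rho_nat fmap_comp -!mcompA (invKe _ (rhoV p')).
    rewrite (invKe _ (rhoV p)) natL !mcompA -!fmap_comp.
    by rewrite -rho_nat.
  + move=> m n; apply: (iso_epi (rhoV _)); by_elt; rewrite (invKe _ (rhoV _)) rhoE !fmap_comp.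
    rewrite -!mcompA natR; congr (_ ∘ _); rewrite !mcompA; congr (_ ∘ _).
    by have := bal m (S n) c; rewrite /twist_balance !fmap_comp mcompA => ->.
  + move=> eta neta etaE p; apply: (iso_epi (rhoV p)).
    by rewrite neta -[eta _]/(eta (twist_prod p c)) etaE -!mcompA invK // comp_idr.
Qed.

Lemma twist_relative_tensor : relative_tensor M N (restrict M F).
Proof.
exists twist_prod, twist_balance, (fun X m n => mid M X m (S n)), twist_r.
split; [by split; [exact: twist_balanced|exact: twist_universal]| | | |].
- split.
  + move=> n; split=> /=.
    * by move=> *; have [h _ _ _] := hm; exact: h.
    * by move=> *; exact: is_iso_mid.
    * by move=> X Y m; rewrite fmap_id; by_elt; rewrite (mid_la hm).
    * by move=> m; rewrite fmap_id; apply: eltP => W x; rewrite -mcompA (mid_lu hl hm).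
  + by move=> X m n n' g; rewrite /twist_prod /=; by_elt; rewrite (mid_nat3 hm).
- split.
  + move=> m; split=> /=.
    * move=> n n' X X' h f; rewrite /twist_r; have [nr _ _ _ _] := hr; rewrite -mcompA nr.
      have [nt _ _ _] := rS; rewrite !mcompA -!bmap_comp; congr (bmap _ _ _ ∘ _).
      exact: nt.
    * move=> n X; apply: is_iso_comp (is_iso_ra hr _ _ _).
      exact: is_iso_bmap (is_iso_id _) (is_iso_mfr rS _ _).
    * move=> n X Y; rewrite /twist_r /= fmap_id bmapLc; by_elt.
      rewrite (ra_nat2 hr) (ra_nat3 hr) (ra_pentagon hr) !mcompA -!bmapRc.
      have [_ _ h _] := rS; have /= e := h n X Y; rewrite fmap_id in e.
      by rewrite e mcompA.
    * move=> n; rewrite /twist_r /=; by_elt; rewrite (ra_nat3 hr) (ra_unit2 hr).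
      rewrite !mcompA -!bmapRc; have [_ _ _ h] := rS; have /= <- := h n.
      by rewrite mcompA.
  + by move=> m m' n X f; rewrite /twist_r /= !fmap_id; by_elt; rewrite (ra_nat1 hr) bmap_swap.
- split.
  + move=> X m Y n; rewrite /twist_balance /= fmap_id bmapRc; by_elt.
    by rewrite -(mid_ra hm) (mid_nat3 hm).
  + move=> m X n Y; rewrite /twist_balance /twist_r /= fmap_id bmapLc; by_elt.
    rewrite (ra_nat2 hr) (ra_nat3 hr) (ra_pentagon hr) !mcompA -!bmapRc.
    by rewrite -[inv _ ∘ _ ∘ _]mcompA -mid_sV mcompA.
- move=> X m n Y; rewrite /twist_r /= fmap_id bmapRc; by_elt.
  by rewrite -(mid_ra hm) (mid_nat3 hm).
Qed.

End RelativeTensorTwist.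

(** * Natural transformations out of a universal balanced product *)

Section UniversalBalanced.
Variables (k : fieldType) (C : moncat k) (M N P : bimod C) (B : bifunctor M N P).
Variable b : forall m X n, mor P (B (m ◁ X) n) (B m (X ▷ n)).
Hypothesis hB : universal_balanced b.
Variables (E : lincat k) (ssE : finite_semisimple E).

Lemma ub_ext (G H : functor P E) (theta : forall m n, mor E (G (B m n)) (H (B m n))) :
  (forall m m' n n' (f : mor M m m') (g : mor N n n'),
     theta m' n' ∘ fmap G (bmap B f g) = fmap H (bmap B f g) ∘ theta m n) ->
  (forall m X n, theta m (X ▷ n) ∘ fmap G (b m X n) = fmap H (b m X n) ∘ theta (m ◁ X) n) ->
  exists eta : forall p, mor E (G p) (H p), natural eta /\ forall m n, eta (B m n) = theta m n.
Proof.
move=> nat bal; have [_ h] := hB ssE.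
by have [eta [e1 e2 _]] := h G H theta (fun m m' n n' f g => nat m m' n n' f g) bal; exists eta.
Qed.

Lemma ub_unique (G H : functor P E) (eta eta' : forall p, mor E (G p) (H p)) :
  natural eta -> natural eta' -> (forall m n, eta (B m n) = eta' (B m n)) ->
  forall p, eta p = eta' p.
Proof.
move=> n n' e p; have [_ h] := hB ssE.
have [eta0 [_ _ un]] := h G H (fun m n => eta (B m n))
  (fun m m' n1 n1' f g => n _ _ _) (fun m X n1 => n _ _ _).
by rewrite (un eta) // (un eta').
Qed.

(** The pointwise inverses of [theta] extend as well, and both composites of the two extensions are
    identities by uniqueness. *)
Lemma ub_ext_iso (G H : functor P E) (theta : forall m n, mor E (G (B m n)) (H (B m n))) :
  (forall m m' n n' (f : mor M m m') (g : mor N n n'),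
     theta m' n' ∘ fmap G (bmap B f g) = fmap H (bmap B f g) ∘ theta m n) ->
  (forall m X n, theta m (X ▷ n) ∘ fmap G (b m X n) = fmap H (b m X n) ∘ theta (m ◁ X) n) ->
  (forall m n, is_iso (theta m n)) ->
  exists eta : forall p, mor E (G p) (H p), natural_iso eta /\ forall m n, eta (B m n) = theta m n.
Proof.
move=> nat bal iso; have [eta [neta etaE]] := ub_ext nat bal.
have inv_sq X X' Y Y' (i : mor E X Y) (j : mor E X' Y') f g : is_iso i -> is_iso j ->
    j ∘ f = g ∘ i -> inv j ∘ g = f ∘ inv i.
  move=> hi hj e; apply: (iso_mono hj); apply: (iso_epi hi).
  by rewrite -!mcompA invK // comp_idr Kinve.
have [|m X n|eta' [neta' etaE']] := @ub_ext H G (fun m n => inv (theta m n)).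
- by move=> m m' n n' f g; apply: inv_sq.
- exact: inv_sq.
exists eta; split=> //; split=> // p; exists (eta' p); split.
- apply: (@ub_unique G G (fun p => eta' p ∘ eta p) (fun p => id_mor (G p))).
  + by move=> X Y f; rewrite -mcompA neta !mcompA neta'.
  + by move=> X Y f; rewrite comp_idl comp_idr.
  + by move=> m n; rewrite etaE etaE' invK.
- apply: (@ub_unique H H (fun p => eta p ∘ eta' p) (fun p => id_mor (H p))).
  + by move=> X Y f; rewrite -mcompA neta' !mcompA neta.
  + by move=> X Y f; rewrite comp_idl comp_idr.
  + by move=> m n; rewrite etaE etaE' Kinv.
Qed.

End UniversalBalanced.

(** * Uniqueness of the relative tensor product *)

Section Compare.
Variables (k : fieldType) (C : moncat k) (M N P Q : bimod C).
Hypotheses (hP : is_bimodule P) (hQ : is_bimodule Q).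
Variables (B : bifunctor M N P) (B' : bifunctor M N Q).
Variable b : forall m X n, mor P (B (m ◁ X) n) (B m (X ▷ n)).
Variable b' : forall m X n, mor Q (B' (m ◁ X) n) (B' m (X ▷ n)).
Hypotheses (bal : balanced b) (bal' : balanced b').
Hypotheses (ub : universal_balanced b) (ub' : universal_balanced b').

(** The usual comparison of two universal objects. The universal property speaks of finite
    semisimple targets, so it applies to [P] and [Q] because these are bimodule categories in the
    sense of [is_bimodule]. *)
Lemma ub_compare : exists (G : functor P Q) (phi : forall m n, mor Q (G (B m n)) (B' m n)),
  [/\ equivalence G,
      forall m m' n n' (f : mor M m m') (g : mor N n n'),
        phi m' n' ∘ fmap G (bmap B f g) = bmap B' f g ∘ phi m n,
      forall m n, is_iso (phi m n)
    & forall m X n, phi m (X ▷ n) ∘ fmap G (b m X n) = b' m X n ∘ phi (m ◁ X) n].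
Proof.
have [ssP _ _ _] := hP; have [ssQ _ _ _] := hQ.
have [/(_ B' b' bal') [G [phi [n1 i1 e1]]] _] := ub ssQ.
have [/(_ B b bal) [H [psi [n2 i2 e2]]] _] := ub' ssP.
exists G, phi; split=> //.
have comp_id (P1 Q1 : bimod C) (B1 : bifunctor M N P1) (B2 : bifunctor M N Q1)
    (b1 : forall m X n, mor P1 (B1 (m ◁ X) n) (B1 m (X ▷ n)))
    (b2 : forall m X n, mor Q1 (B2 (m ◁ X) n) (B2 m (X ▷ n)))
    (G1 : functor P1 Q1) (H1 : functor Q1 P1) (f1 : forall m n, mor Q1 (G1 (B1 m n)) (B2 m n))
    (f2 : forall m n, mor P1 (H1 (B2 m n)) (B1 m n)) :
    finite_semisimple P1 -> universal_balanced b1 ->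
    (forall m m' n n' (f : mor M m m') (g : mor N n n'),
        f1 m' n' ∘ fmap G1 (bmap B1 f g) = bmap B2 f g ∘ f1 m n) ->
    (forall m m' n n' (f : mor M m m') (g : mor N n n'),
        f2 m' n' ∘ fmap H1 (bmap B2 f g) = bmap B1 f g ∘ f2 m n) ->
    (forall m n, is_iso (f1 m n)) -> (forall m n, is_iso (f2 m n)) ->
    (forall m X n, f1 m (X ▷ n) ∘ fmap G1 (b1 m X n) = b2 m X n ∘ f1 (m ◁ X) n) ->
    (forall m X n, f2 m (X ▷ n) ∘ fmap H1 (b2 m X n) = b1 m X n ∘ f2 (m ◁ X) n) ->
    exists eta, @natural_iso _ _ _ (fcomp H1 G1) (fid P1) eta.
  move=> ss u1 nat1 nat2 is1 is2 bb1 bb2.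
  have [| | |eta [heta _]] := @ub_ext_iso _ _ _ _ _ _ _ u1 _ ss (fcomp H1 G1) (fid P1)
    (fun m n => f2 m n ∘ fmap H1 (f1 m n)); last by exists eta.
  - move=> m m' n n' f g /=.
    by rewrite -mcompA -fmap_comp nat1 fmap_comp !mcompA nat2.
  - by move=> m X n /=; rewrite -mcompA -fmap_comp bb1 fmap_comp !mcompA bb2.
  - by move=> m n; apply: is_iso_comp => //; exact: is_iso_fmap.
exists H; split.
  exact: (comp_id _ _ _ _ _ _ _ _ _ _ ssP ub n1 n2).
exact: (comp_id _ _ _ _ _ _ _ _ _ _ ssQ ub' n2 n1).
Qed.

End Compare.

Section CompareBimodules.
Variables (k : fieldType) (C : moncat k) (M N P Q : bimod C).

(* [relative_tensor M N R] is the existence of such data. *)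
Definition tensor_data (R : bimod C) (B : bifunctor M N R)
    (b : forall m X n, mor R (B (m ◁ X) n) (B m (X ▷ n)))
    (l : forall X m n, mor R (B (X ▷ m) n) (X ▷ B m n))
    (r : forall m n X, mor R (B m n ◁ X) (B m (n ◁ X))) : Prop :=
  [/\ balanced b /\ universal_balanced b,
      (forall n, @left_module_functor k C M R (fix_right B n) (fun X m => l X m n)) /\
      (forall X m n n' (g : mor N n n'),
         l X m n' ∘ bmap B (id_mor (X ▷ m)) g = (id_mor X ▷' bmap B (id_mor m) g) ∘ l X m n),
      (forall m, @right_module_functor k C N R (fix_left B m) (fun n X => r m n X)) /\
      (forall m m' n X (f : mor M m m'),
         r m' n X ∘ (bmap B f (id_mor n) ◁' id_mor X) = bmap B f (id_mor (n ◁ X)) ∘ r m n X),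
      (forall X m Y n,
         (id_mor X ▷' b m Y n) ∘ l X (m ◁ Y) n ∘ bmap B (mid M X m Y) (id_mor n) =
         l X m (Y ▷ n) ∘ b (X ▷ m) Y n) /\
      (forall m X n Y,
         bmap B (id_mor m) (mid N X n Y) ∘ r m (X ▷ n) Y ∘ (b m X n ◁' id_mor Y) =
         b m X (n ◁ Y) ∘ r (m ◁ X) n Y)
    & forall X m n Y,
        (id_mor X ▷' r m n Y) ∘ mid R X (B m n) Y ∘ (l X m n ◁' id_mor Y) =
        l X m (n ◁ Y) ∘ r (X ▷ m) n Y].

Section Elementwise.
Variables (R : bimod C) (B : bifunctor M N R).
Variable b : forall m X n, mor R (B (m ◁ X) n) (B m (X ▷ n)).
Variable l : forall X m n, mor R (B (X ▷ m) n) (X ▷ B m n).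
Variable r : forall m n X, mor R (B m n ◁ X) (B m (n ◁ X)).
Hypothesis hB : tensor_data b l r.

Lemma is_iso_td_l X m n : is_iso (l X m n).
Proof. case: hB => _ [/(_ n) [_ h _ _] _] _ _ _; exact: h. Qed.

Lemma is_iso_td_r m n X : is_iso (r m n X).
Proof. case: hB => _ _ [/(_ m) [_ h _ _] _] _ _; exact: h. Qed.

Lemma td_l_nat X X' (f : mor C X X') m m' (g : mor M m m') n n' (h : mor N n n')
    W (x : mor R W _) :
  l X' m' n' ∘ (bmap B (f ▷' g) h ∘ x) = (f ▷' bmap B g h) ∘ (l X m n ∘ x).
Proof.
case: hB => _ [/(_ n) [e _ _ _] e'] _ _ _; rewrite bmapRL !mcompA e'.
have := e _ _ _ _ f g => /= e2; rewrite -(mcompA _ (l X' m' n)) e2 !mcompA.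
by rewrite -!bmap_comp !comp_idl !comp_idr.
Qed.

Lemma td_l_la X Y m n W (x : mor R W _) :
  la R X Y (B m n) ∘ (l (X ⊗ Y) m n ∘ x) =
  (id_mor X ▷' l Y m n) ∘ (l X (Y ▷ m) n ∘ (bmap B (la M X Y m) (id_mor n) ∘ x)).
Proof. by case: hB => _ [/(_ n) [_ _ e _] _] _ _ _; have /= h := e X Y m; rewrite !mcompA h. Qed.

Lemma td_l_lu m n W (x : mor R W _) :
  l unit_ob m n ∘ (bmap B (lu M m) (id_mor n) ∘ x) = lu R (B m n) ∘ x.
Proof. by case: hB => _ [/(_ n) [_ _ _ e] _] _ _ _; have /= h := e m; rewrite !mcompA h. Qed.

Lemma td_r_nat m m' (g : mor M m m') n n' (h : mor N n n') X X' (f : mor C X X')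
    W (x : mor R W _) :
  r m' n' X' ∘ ((bmap B g h ◁' f) ∘ x) = bmap B g (h ◁' f) ∘ (r m n X ∘ x).
Proof.
case: hB => _ _ [/(_ m') [e _ _ _] e'] _ _; have := e _ _ _ _ h f => /= e2.
have -> : bmap B g h ◁' f =
    (bmap B (id_mor m') h ◁' f) ∘ (bmap B g (id_mor n) ◁' id_mor X).
  by rewrite -!bmap_comp !comp_idl !comp_idr.
rewrite !mcompA e2 -(mcompA _ (r _ _ _)) e' !mcompA.
by rewrite -!bmap_comp !comp_idl !comp_idr.
Qed.

Lemma td_r_ra m n X Y W (x : mor R W _) :
  bmap B (id_mor m) (ra N n X Y) ∘ (r m (n ◁ X) Y ∘ ((r m n X ◁' id_mor Y) ∘ x)) =
  r m n (X ⊗ Y) ∘ (ra R (B m n) X Y ∘ x).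
Proof. by case: hB => _ _ [/(_ m) [_ _ e _] _] _ _; have /= h := e n X Y; rewrite !mcompA h. Qed.

Lemma td_r_ru m n W (x : mor R W _) :
  r m n unit_ob ∘ (ru R (B m n) ∘ x) = bmap B (id_mor m) (ru N n) ∘ x.
Proof. by case: hB => _ _ [/(_ m) [_ _ _ e] _] _ _; have /= h := e n; rewrite !mcompA h. Qed.

Lemma td_b_l X m Y n W (x : mor R W _) :
  (id_mor X ▷' b m Y n) ∘ (l X (m ◁ Y) n ∘ (bmap B (mid M X m Y) (id_mor n) ∘ x)) =
  l X m (Y ▷ n) ∘ (b (X ▷ m) Y n ∘ x).
Proof. by case: hB => _ _ _ [e _] _; rewrite !mcompA e. Qed.

Lemma td_b_r m X n Y W (x : mor R W _) :
  bmap B (id_mor m) (mid N X n Y) ∘ (r m (X ▷ n) Y ∘ ((b m X n ◁' id_mor Y) ∘ x)) =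
  b m X (n ◁ Y) ∘ (r (m ◁ X) n Y ∘ x).
Proof. by case: hB => _ _ _ [_ e] _; rewrite !mcompA e. Qed.

Lemma td_mid X m n Y W (x : mor R W _) :
  (id_mor X ▷' r m n Y) ∘ (mid R X (B m n) Y ∘ ((l X m n ◁' id_mor Y) ∘ x)) =
  l X m (n ◁ Y) ∘ (r (X ▷ m) n Y ∘ x).
Proof. by case: hB => _ _ _ _ e; rewrite !mcompA e. Qed.

End Elementwise.

Hypotheses (hP : is_bimodule P) (hQ : is_bimodule Q).
Hypotheses (hMm : middle_associative M) (hNm : middle_associative N).

(** On objects [B m n] the constraints of [G] are forced by requiring [phi] to respect the actions.
    They are natural and compatible with the balancing, hence extend to [P]. Every axiom is an
    equality of natural transformations between functors from [P] to [Q], so it is enough to test it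
    on [B m n], where it reduces to the axioms of [tensor_data]. *)
Lemma relative_tensor_unique :
  relative_tensor M N P -> relative_tensor M N Q -> bimodule_equivalent P Q.
Proof.
move=> [B [b [l [r hB]]]] [B' [b' [l' [r' hB']]]].
have [ssP Pl Pr Pm] := hP; have [ssQ Ql Qr Qm] := hQ.
have [[bal ub] _ _ _ _] := hB; have [[bal' ub'] _ _ _ _] := hB'.
have [G [phi [eG phi_nat iphi phi_b]]] := ub_compare hP hQ bal bal' ub ub'.
have {}hB : tensor_data b l r by []. have {}hB' : tensor_data b' l' r' by [].
have phi_nate m m' n n' (f : mor M m m') (g : mor N n n') W (x : mor Q W _) :
    phi m' n' ∘ (fmap G (bmap B f g) ∘ x) = bmap B' f g ∘ (phi m n ∘ x).
  by rewrite !mcompA phi_nat.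
have phi_be m X n W (x : mor Q W _) :
    phi m (X ▷ n) ∘ (fmap G (b m X n) ∘ x) = b' m X n ∘ (phi (m ◁ X) n ∘ x).
  by rewrite !mcompA phi_b.
have GD X Y Z (g : mor P Y Z) (f : mor P X Y) W (x : mor Q W _) :
    fmap G (g ∘ f) ∘ x = fmap G g ∘ (fmap G f ∘ x).
  by rewrite fmap_comp mcompA.
have iL X m n : is_iso (id_mor X ▷' phi m n) by exact: is_iso_bmap (is_iso_id _) (iphi _ _).
have iGl X m n : is_iso (fmap G (l X m n)) by exact/is_iso_fmap/(is_iso_td_l hB).
have iGr m n X : is_iso (fmap G (r m n X)) by exact/is_iso_fmap/(is_iso_td_r hB).
have phi_nat3 m m' n n' (f : mor M m m') (g : mor N n n') X W (x : mor Q W _) :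
    (id_mor X ▷' phi m' n') ∘ ((id_mor X ▷' fmap G (bmap B f g)) ∘ x) =
    (id_mor X ▷' bmap B' f g) ∘ ((id_mor X ▷' phi m n) ∘ x).
  by rewrite !mcompA -!bmapRc phi_nat.
have phi_nat4 m m' n n' (f : mor M m m') (g : mor N n n') X W (x : mor Q W _) :
    (phi m' n' ◁' id_mor X) ∘ ((fmap G (bmap B f g) ◁' id_mor X) ∘ x) =
    (bmap B' f g ◁' id_mor X) ∘ ((phi m n ◁' id_mor X) ∘ x).
  by rewrite !mcompA -!bmapLc phi_nat.
have phi_b3 m X n Y W (x : mor Q W _) :
    (id_mor Y ▷' phi m (X ▷ n)) ∘ ((id_mor Y ▷' fmap G (b m X n)) ∘ x) =
    (id_mor Y ▷' b' m X n) ∘ ((id_mor Y ▷' phi (m ◁ X) n) ∘ x).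
  by rewrite !mcompA -!bmapRc phi_b.
have phi_b4 m X n Y W (x : mor Q W _) :
    (phi m (X ▷ n) ◁' id_mor Y) ∘ ((fmap G (b m X n) ◁' id_mor Y) ∘ x) =
    (b' m X n ◁' id_mor Y) ∘ ((phi (m ◁ X) n ◁' id_mor Y) ∘ x).
  by rewrite !mcompA -!bmapLc phi_b.
have Gl_nat X X' (f : mor C X X') m m' (g : mor M m m') n n' (h : mor N n n') W (x : mor Q W _) :
    fmap G (l X' m' n') ∘ (fmap G (bmap B (f ▷' g) h) ∘ x) =
    fmap G (f ▷' bmap B g h) ∘ (fmap G (l X m n) ∘ x).
  by rewrite -!GD; congr (fmap G _ ∘ _); by_elt; exact: (td_l_nat hB).
have Gr_nat m m' (g : mor M m m') n n' (h : mor N n n') X X' (f : mor C X X') W (x : mor Q W _) :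
    fmap G (r m' n' X') ∘ (fmap G (bmap B g h ◁' f) ∘ x) =
    fmap G (bmap B g (h ◁' f)) ∘ (fmap G (r m n X) ∘ x).
  by rewrite -!GD; congr (fmap G _ ∘ _); by_elt; exact: (td_r_nat hB).
(* [thL] is solved from the condition that [phi] be compatible with [l] and [l']; [thR] below comes
   in the same way from [r] and [r']. *)
have [thL [ithL thLE]] : exists thL : forall X m n, mor Q (G (X ▷ B m n)) (X ▷ G (B m n)),
    (forall X m n, is_iso (thL X m n)) /\ forall X m n W (x : mor Q W _),
    (id_mor X ▷' phi m n) ∘ (thL X m n ∘ (fmap G (l X m n) ∘ x)) =
    l' X m n ∘ (phi (X ▷ m) n ∘ x).
  exists (fun X m n => inv (id_mor X ▷' phi m n) ∘
    (l' X m n ∘ (phi (X ▷ m) n ∘ inv (fmap G (l X m n))))); split=> [X m n|X m n W x].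
    apply: is_iso_comp (is_iso_inv (iL _ _ _)) (is_iso_comp (is_iso_td_l hB' _ _ _) _).
    exact: is_iso_comp (iphi _ _) (is_iso_inv (iGl _ _ _)).
  by rewrite -!mcompA Kinve // invKe.
have [thR [ithR thRE]] : exists thR : forall X m n, mor Q (G (B m n) ◁ X) (G (B m n ◁ X)),
    (forall X m n, is_iso (thR X m n)) /\ forall X m n W (x : mor Q W _),
    phi m (n ◁ X) ∘ (fmap G (r m n X) ∘ (thR X m n ∘ x)) =
    r' m n X ∘ ((phi m n ◁' id_mor X) ∘ x).
  exists (fun X m n => inv (fmap G (r m n X)) ∘
    (inv (phi m (n ◁ X)) ∘ (r' m n X ∘ (phi m n ◁' id_mor X)))); split=> [X m n|X m n W x].
    apply: is_iso_comp (is_iso_inv (iGr _ _ _)) (is_iso_comp (is_iso_inv (iphi _ _)) _).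
    exact: is_iso_comp (is_iso_td_r hB' _ _ _) (is_iso_bmap _ (iphi _ _) (is_iso_id _)).
  by rewrite -!mcompA Kinve // Kinve.
have [lG hlG] : exists lG : forall X p, mor Q (G (X ▷ p)) (X ▷ G p), forall X,
    @natural_iso _ _ _ (fcomp G (fix_left (lact P) X)) (fcomp (fix_left (lact Q) X) G) (lG X) /\
    forall m n, lG X (B m n) = thL X m n.
  have h X := @ub_ext_iso _ _ _ _ _ _ _ ub _ ssQ (fcomp G (fix_left (lact P) X))
    (fcomp (fix_left (lact Q) X) G) (thL X).
  suff h' X : exists eta : forall p, mor Q (G (X ▷ p)) (X ▷ G p),
      @natural_iso _ _ _ (fcomp G (fix_left (lact P) X)) (fcomp (fix_left (lact Q) X) G) eta /\
      forall m n, eta (B m n) = thL X m n.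
    by exists (fun X => sval (cid (h' X))) => X; case: cid.
  apply: h => //=.
  - move=> m m' n n' f g; apply: (iso_epi (iGl X m n)); apply: (iso_mono (iL X m' n')); by_elt.
    by rewrite -Gl_nat thLE phi_nate (td_l_nat hB') phi_nat3 thLE.
  (* The axiom [td_b_l] relates the balancing to [l] only through [mid], so the two sides are
     compared after precomposition with this isomorphism. *)
  - move=> m Y n; apply: (iso_epi (iGl X (m ◁ Y) n)).
    apply: (@iso_epi _ _ _ _ _ (fmap G (bmap B (mid M X m Y) (id_mor n)))).
      exact/is_iso_fmap/is_iso_bmap/is_iso_id/(is_iso_mid hMm).
    apply: (iso_mono (iL X m _)); by_elt; rewrite phi_b3 thLE phi_nate (td_b_l hB') -phi_be -thLE.
    congr (_ ∘ (_ ∘ _)); rewrite -!GD; congr (fmap G _ ∘ _); by_elt.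
    exact: (td_b_l hB).
have [rG hrG] : exists rG : forall p X, mor Q (G p ◁ X) (G (p ◁ X)), forall X,
    @natural_iso _ _ _ (fcomp (fix_right (ract Q) X) G) (fcomp G (fix_right (ract P) X)) (rG^~ X) /\
    forall m n, rG (B m n) X = thR X m n.
  have h X := @ub_ext_iso _ _ _ _ _ _ _ ub _ ssQ (fcomp (fix_right (ract Q) X) G)
    (fcomp G (fix_right (ract P) X)) (thR X).
  suff h' X : exists eta : forall p, mor Q (G p ◁ X) (G (p ◁ X)),
      @natural_iso _ _ _ (fcomp (fix_right (ract Q) X) G) (fcomp G (fix_right (ract P) X)) eta /\
      forall m n, eta (B m n) = thR X m n.
    by exists (fun p X => sval (cid (h' X)) p) => X; case: cid.
  apply: h => //=.
  - move=> m m' n n' f g; apply: (iso_mono (iGr _ _ _)); apply: (iso_mono (iphi _ _)); by_elt.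
    by rewrite thRE phi_nat4 Gr_nat phi_nate thRE (td_r_nat hB').
  - move=> m Y n; apply: (iso_mono (iGr _ _ _)).
    apply: (@iso_mono _ _ _ _ _ (fmap G (bmap B (id_mor m) (mid N Y n X)))).
      exact/is_iso_fmap/is_iso_bmap/(is_iso_mid hNm)/is_iso_id.
    apply: (iso_mono (iphi _ _)); by_elt; rewrite [in LHS]phi_nate thRE phi_b4 (td_b_r hB').
    rewrite -thRE -phi_be; congr (_ ∘ _); rewrite -!GD -!mcompA; congr (fmap G _ ∘ _); by_elt.
    by rewrite (td_b_r hB).
have lG_nat X p p' (f : mor P p p') W (x : mor Q W _) :
    lG X p' ∘ (fmap G (id_mor X ▷' f) ∘ x) = (id_mor X ▷' fmap G f) ∘ (lG X p ∘ x).
  by have [[h _] _] := hlG X; rewrite !mcompA; have /= -> := h _ _ f.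
have rG_nat X p p' (f : mor P p p') W (x : mor Q W _) :
    rG p' X ∘ ((fmap G f ◁' id_mor X) ∘ x) = fmap G (f ◁' id_mor X) ∘ (rG p X ∘ x).
  by have [[h _] _] := hrG X; rewrite !mcompA; have /= -> := h _ _ f.
have ilG X p : is_iso (lG X p) by have [[_ h] _] := hlG X; exact: h.
have irG p X : is_iso (rG p X) by have [[_ h] _] := hrG X; exact: h.
have lGE X m n W (x : mor Q W _) :
    (id_mor X ▷' phi m n) ∘ (lG X (B m n) ∘ (fmap G (l X m n) ∘ x)) =
    l' X m n ∘ (phi (X ▷ m) n ∘ x).
  by have [_ ->] := hlG X.
have rGE X m n W (x : mor Q W _) :
    phi m (n ◁ X) ∘ (fmap G (r m n X) ∘ (rG (B m n) X ∘ x)) =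
    r' m n X ∘ ((phi m n ◁' id_mor X) ∘ x).
  by have [_ ->] := hrG X.
have lGE3 Y X m n W (x : mor Q W _) :
    (id_mor Y ▷' (id_mor X ▷' phi m n)) ∘ ((id_mor Y ▷' lG X (B m n)) ∘
      ((id_mor Y ▷' fmap G (l X m n)) ∘ x)) =
    (id_mor Y ▷' l' X m n) ∘ ((id_mor Y ▷' phi (X ▷ m) n) ∘ x).
  rewrite !mcompA -!bmapRc; congr (bmap _ _ _ ∘ _); by_elt; exact: lGE.
have lGE4 Y X m n W (x : mor Q W _) :
    ((id_mor X ▷' phi m n) ◁' id_mor Y) ∘ ((lG X (B m n) ◁' id_mor Y) ∘
      ((fmap G (l X m n) ◁' id_mor Y) ∘ x)) =
    (l' X m n ◁' id_mor Y) ∘ ((phi (X ▷ m) n ◁' id_mor Y) ∘ x).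
  rewrite !mcompA -!bmapLc; congr (bmap _ _ _ ∘ _); by_elt; exact: lGE.
have rGE3 Y X m n W (x : mor Q W _) :
    (id_mor Y ▷' phi m (n ◁ X)) ∘ ((id_mor Y ▷' fmap G (r m n X)) ∘
      ((id_mor Y ▷' rG (B m n) X) ∘ x)) =
    (id_mor Y ▷' r' m n X) ∘ ((id_mor Y ▷' (phi m n ◁' id_mor X)) ∘ x).
  rewrite !mcompA -!bmapRc; congr (bmap _ _ _ ∘ _); by_elt; exact: rGE.
have rGE4 Y X m n W (x : mor Q W _) :
    (phi m (n ◁ X) ◁' id_mor Y) ∘ ((fmap G (r m n X) ◁' id_mor Y) ∘
      ((rG (B m n) X ◁' id_mor Y) ∘ x)) =
    (r' m n X ◁' id_mor Y) ∘ (((phi m n ◁' id_mor X) ◁' id_mor Y) ∘ x).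
  rewrite !mcompA -!bmapLc; congr (bmap _ _ _ ∘ _); by_elt; exact: rGE.
(* From here on each axiom is checked by [uniq]: naturality of both sides, then agreement on
   [B m n]. *)
have uniq := @ub_unique _ _ _ _ _ _ _ ub Q ssQ.
exists (@BimodFun _ _ P Q G lG rG); split=> //; split.
- split=> /=.
  + move=> X X' p p' f h; rewrite bmapRL [in RHS]bmapRL fmap_comp; by_elt.
    rewrite lG_nat; congr (_ ∘ _); rewrite !mcompA; congr (_ ∘ _).
    apply: (uniq (fcomp G (fix_left (lact P) X)) (fcomp (fix_left (lact Q) X') G)
      (fun p => lG X' p ∘ fmap G (f ▷' id_mor p)) (fun p => (f ▷' id_mor (G p)) ∘ lG X p)).
    * move=> Y Y' g /=; rewrite -mcompA -fmap_comp -bmapLR bmapRL fmap_comp.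
      by apply: eltP => W x; rewrite -!mcompA lG_nat.
    * move=> Y Y' g /=; apply: eltP => W x; rewrite -!mcompA lG_nat bmap_swap //.
    * move=> m n; apply: (iso_epi (iGl X m n)); apply: (iso_mono (iL X' m n)); by_elt.
      have e := @Gl_nat X X' f m m (id_mor m) n n (id_mor n); rewrite bmap_id in e.
      have e' := td_l_nat hB' f (id_mor m) (id_mor n); rewrite bmap_id in e'.
      by rewrite -e lGE phi_nate e' -bmap_swap lGE.
  + by [].
  + move=> X Y; apply: (uniq (fcomp G (fix_left (lact P) (X ⊗ Y)))
      (fcomp (fix_left (lact Q) X) (fcomp (fix_left (lact Q) Y) G))
      (fun m => la Q X Y (G m) ∘ lG (X ⊗ Y) m)
      (fun m => (id_mor X ▷' lG Y m) ∘ lG X (Y ▷ m) ∘ fmap G (la P X Y m))).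
    * by move=> p p' f /=; by_elt; rewrite lG_nat (la_nat3 Ql).
    * move=> p p' f /=; by_elt; rewrite -GD.
      have -> : la P X Y p' ∘ (id_mor (X ⊗ Y) ▷' f) = (id_mor X ▷' (id_mor Y ▷' f)) ∘ la P X Y p.
        by by_elt; exact: la_nat3.
      rewrite GD lG_nat; rewrite !mcompA -!bmapRc; congr (bmap _ _ _ ∘ _ ∘ _ ∘ _).
      by by_elt; exact: lG_nat.
    * move=> m n; apply: (iso_epi (iGl (X ⊗ Y) m n)).
      apply: (iso_mono (is_iso_bmap (lact Q) (is_iso_id X) (iL Y m n))); by_elt.
      rewrite -(la_nat3 Ql) lGE (td_l_la hB').
      have e : fmap G (la P X Y (B m n)) ∘ fmap G (l (X ⊗ Y) m n) =
          fmap G (id_mor X ▷' l Y m n) ∘ (fmap G (l X (Y ▷ m) n) ∘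
          fmap G (bmap B (la M X Y m) (id_mor n))).
        by rewrite -!fmap_comp; congr (fmap G _); by_elt; exact: (td_l_la hB).
      rewrite [in RHS](mcompA (fmap G (la P X Y _))) e -!mcompA lG_nat lGE3 lGE.
      by rewrite phi_nate.
  + apply: (uniq G (fcomp (fix_left (lact Q) unit_ob) G)
      (fun p => lG unit_ob p ∘ fmap G (lu P p)) (fun p => lu Q (G p))).
    * move=> p p' f /=; rewrite -mcompA -fmap_comp.
      have -> : lu P p' ∘ f = (id_mor unit_ob ▷' f) ∘ lu P p.
        by by_elt; exact: lu_nat.
      by rewrite fmap_comp; by_elt; rewrite lG_nat.
    * by move=> p p' f /=; by_elt; rewrite (lu_nat Ql).
    * move=> m n; apply: (iso_mono (iL unit_ob m n)).
      have -> : lu P (B m n) = l unit_ob m n ∘ bmap B (lu M m) (id_mor n).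
        by apply: eltP => W x; rewrite -mcompA (td_l_lu hB).
      rewrite fmap_comp; by_elt; rewrite lGE phi_nate (td_l_lu hB').
      by rewrite (lu_nat Ql).
- split=> /=.
  + move=> p p' X X' h f; rewrite bmapLR [in RHS]bmapLR fmap_comp; by_elt.
    rewrite rG_nat; congr (_ ∘ _); rewrite !mcompA; congr (_ ∘ _).
    apply: (uniq (fcomp (fix_right (ract Q) X) G) (fcomp G (fix_right (ract P) X'))
      (fun p => rG p X' ∘ (id_mor (G p) ◁' f)) (fun p => fmap G (id_mor p ◁' f) ∘ rG p X)).
    * by move=> Y Y' g /=; by_elt; rewrite -bmap_swap rG_nat.
    * move=> Y Y' g /=; by_elt; rewrite rG_nat -!GD.
      by rewrite -bmapLR -bmapRL.
    * move=> m n; apply: (iso_mono (iGr m n X')); apply: (iso_mono (iphi _ _)); by_elt.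
      have e := Gr_nat m m (id_mor m) n n (id_mor n) X X' f; rewrite bmap_id in e.
      have e' := td_r_nat hB' (id_mor m) (id_mor n) f; rewrite bmap_id in e'.
      by rewrite e phi_nate !rGE bmap_swap e'.
  + by [].
  + move=> p X Y; move: p.
    apply: (uniq (fcomp (fix_right (ract Q) Y) (fcomp (fix_right (ract Q) X) G))
      (fcomp G (fix_right (ract P) (X ⊗ Y)))
      (fun m => fmap G (ra P m X Y) ∘ rG (m ◁ X) Y ∘ (rG m X ◁' id_mor Y))
      (fun m => rG m (X ⊗ Y) ∘ ra Q (G m) X Y)).
    * move=> p p' f /=; by_elt.
      have e : (rG p' X ◁' id_mor Y) ∘ ((fmap G f ◁' id_mor X) ◁' id_mor Y) =
          (fmap G (f ◁' id_mor X) ◁' id_mor Y) ∘ (rG p X ◁' id_mor Y).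
        by rewrite -!bmapLc; congr (bmap _ _ _); by_elt; exact: rG_nat.
      rewrite (mcompA (rG p' X ◁' _)) e -!mcompA rG_nat -!GD; congr (fmap G _ ∘ _).
      by by_elt; exact: ra_nat1.
    * by move=> p p' f /=; by_elt; rewrite (ra_nat1 Qr) rG_nat.
    * move=> m n; apply: (iso_mono (iGr m n (X ⊗ Y))); apply: (iso_mono (iphi _ _)); by_elt.
      rewrite rGE -(ra_nat1 Qr) -(td_r_ra hB').
      have e : fmap G (r m n (X ⊗ Y)) ∘ fmap G (ra P (B m n) X Y) =
          fmap G (bmap B (id_mor m) (ra N n X Y)) ∘ (fmap G (r m (n ◁ X) Y) ∘
          fmap G (r m n X ◁' id_mor Y)).
        rewrite -!fmap_comp; congr (fmap G _); apply: eltP => W x.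
        by rewrite -!mcompA (td_r_ra hB).
      rewrite (mcompA (fmap G (r m n _))) e -!mcompA phi_nate -rG_nat rGE rGE4.
      by [].
  + apply: (uniq G (fcomp G (fix_right (ract P) unit_ob))
      (fun p => rG p unit_ob ∘ ru Q (G p)) (fun p => fmap G (ru P p))).
    * by move=> p p' f /=; by_elt; rewrite (ru_nat Qr) rG_nat.
    * move=> p p' f /=; rewrite -!fmap_comp; congr (fmap G _).
      by by_elt; exact: ru_nat.
    * move=> m n; apply: (iso_mono (iGr m n unit_ob)); apply: (iso_mono (iphi _ _)).
      rewrite -[in RHS]fmap_comp.
      have -> : r m n unit_ob ∘ ru P (B m n) = bmap B (id_mor m) (ru N n).
        by rewrite -[LHS]comp_idr -mcompA (td_r_ru hB) comp_idr.
      rewrite phi_nat; apply: eltP => W x; rewrite -!mcompA rGE -(ru_nat Qr).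
      by rewrite (td_r_ru hB').
- move=> X p Y /=; move: p.
  apply: (uniq (fcomp (fix_right (ract Q) Y) (fcomp G (fix_left (lact P) X)))
    (fcomp (fix_left (lact Q) X) (fcomp G (fix_right (ract P) Y)))
    (fun m => (id_mor X ▷' rG m Y) ∘ mid Q X (G m) Y ∘ (lG X m ◁' id_mor Y))
    (fun m => lG X (m ◁ Y) ∘ fmap G (mid P X m Y) ∘ rG (X ▷ m) Y)).
  + move=> p p' f /=; by_elt.
    have e : (lG X p' ◁' id_mor Y) ∘ (fmap G (id_mor X ▷' f) ◁' id_mor Y) =
        ((id_mor X ▷' fmap G f) ◁' id_mor Y) ∘ (lG X p ◁' id_mor Y).
      by rewrite -!bmapLc; congr (bmap _ _ _); by_elt; exact: lG_nat.
    rewrite (mcompA (lG X p' ◁' _)) e -!mcompA (mid_nat2 Qm) !mcompA -!bmapRc.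
    congr (bmap _ _ _ ∘ _ ∘ _ ∘ _); by_elt; exact: rG_nat.
  + move=> p p' f /=; by_elt; rewrite rG_nat -GD.
    have -> : mid P X p' Y ∘ ((id_mor X ▷' f) ◁' id_mor Y) =
        (id_mor X ▷' (f ◁' id_mor Y)) ∘ mid P X p Y by by_elt; exact: mid_nat2.
    by rewrite GD lG_nat.
  + move=> m n; apply: (iso_epi (is_iso_bmap (ract Q) (iGl X m n) (is_iso_id Y))).
    apply: (iso_mono (is_iso_bmap (lact Q) (is_iso_id X) (iGr m n Y))).
    apply: (iso_mono (iL X m (n ◁ Y))); by_elt.
    rewrite rGE3 -(mid_nat2 Qm) lGE4 (td_mid hB') rG_nat -lG_nat.
    have e : fmap G (id_mor X ▷' r m n Y) ∘ (fmap G (mid P X (B m n) Y) ∘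
        fmap G (l X m n ◁' id_mor Y)) = fmap G (l X m (n ◁ Y)) ∘ fmap G (r (X ▷ m) n Y).
      rewrite -!fmap_comp; congr (fmap G _); apply: eltP => W x.
      by rewrite -!mcompA (td_mid hB).
    rewrite [in RHS](mcompA (fmap G (mid P _ _ _))) (mcompA (fmap G (_ ▷' _))) e.
    by rewrite -!mcompA lGE rGE.
Qed.

End CompareBimodules.

(** * Transport of a relative tensor product along a bimodule equivalence *)

Section TransportTarget.
Variables (k : fieldType) (C : moncat k) (M N P Q : bimod C).
Variables (U : bimodfun P Q).
Hypotheses (Ql : left_module Q) (Qr : right_module Q) (hU : bimodule_functor U) (eU : equivalence U).

Definition comp_bifunctor (B : bifunctor M N P) : bifunctor M N Q.
Proof.
exists (fun m n => U (B m n)) (fun m m' n n' f g => fmap U (bmap B f g)).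
- by move=> m n; rewrite bmap_id fmap_id.
- by move=> *; rewrite bmap_comp fmap_comp.
- by move=> *; rewrite bmap_linl fmap_lin.
- by move=> *; rewrite bmap_linr fmap_lin.
Defined.

(** Functors out of [Q] correspond to functors out of [P] through a quasi-inverse [V] of [U]. A
    transformation on [Q] is determined by its components on the image of [U], by naturality along
    [eps]. *)
Lemma comp_universal (B : bifunctor M N P) (b : forall m X n, mor P (B (m ◁ X) n) (B m (X ▷ n))) :
  universal_balanced b ->
  @universal_balanced k C M N Q (comp_bifunctor B) (fun m X n => fmap U (b m X n)).
Proof.
move=> ub E ssE; have [ess ff] := ub E ssE.
have faU := equivalence_faithful eU; have fuU := equivalence_full eU.
have [V [eps [neps ieps]]] := quasi_inverse faU fuU (equivalence_ess_surj eU).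
have {}ieps q : is_iso (eps q) := ieps q.
have {}neps q q' (f : mor Q q q') : eps q' ∘ fmap U (fmap V f) = f ∘ eps q := neps q q' f.
pose th p : mor P (V (U p)) p := sval (cid (fuU _ _ (eps (U p)))).
have thE p : fmap U (th p) = eps (U p) by rewrite /th; case: cid.
have ith p : is_iso (th p) by apply: (ff_is_iso faU fuU); rewrite thE.
have th_nat p p' (f : mor P p p') : th p' ∘ fmap V (fmap U f) = f ∘ th p.
  by apply: faU; rewrite !fmap_comp !thE.
split.
- move=> D d hd; have [G [eta [nat i e]]] := ess D d hd.
  exists (fcomp G V), (fun m n => eta m n ∘ fmap G (th (B m n))); split=> /=.
  + move=> m m' n n' f g; rewrite -mcompA -fmap_comp th_nat fmap_comp !mcompA.
    by congr (_ ∘ _); exact: nat.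
  + by move=> m n; apply: is_iso_comp => //; exact: is_iso_fmap.
  + by move=> m X n; rewrite -mcompA -fmap_comp th_nat fmap_comp !mcompA e.
- move=> G G' theta nat bal.
  have [eta [neta etaE un]] := ff (fcomp G U) (fcomp G' U) theta nat bal.
  have extE (eta' : forall q, mor E (G q) (G' q)) : natural eta' -> forall q,
      eta' q = fmap G' (eps q) ∘ eta' (U (V q)) ∘ inv (fmap G (eps q)).
    move=> n q; apply: (iso_epi (is_iso_fmap G (ieps q))).
    by rewrite -mcompA invK ?comp_idr ?n //; exact: is_iso_fmap.
  exists (fun q => fmap G' (eps q) ∘ eta (V q) ∘ inv (fmap G (eps q))).
  have iG q := is_iso_fmap G (ieps q).
  have key : forall p, fmap G' (eps (U p)) ∘ eta (V (U p)) ∘ inv (fmap G (eps (U p))) = eta p.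
    move=> p; apply: (iso_epi (iG (U p))); rewrite -mcompA invK // comp_idr -thE.
    by have /= := neta _ _ (th p).
  split.
  + move=> q q' f; apply: (iso_epi (iG q)).
    rewrite -!mcompA invK // comp_idr -fmap_comp -neps fmap_comp (invKe _ (iG q')).
    have /= -> := neta _ _ (fmap V f); rewrite !mcompA -!fmap_comp.
    by rewrite neps.
  + by move=> m n; rewrite key etaE.
  + move=> eta' neta' etaE' q; rewrite (extE eta') //; congr (_ ∘ _ ∘ _).
    by apply: (un (fun p => eta' (U p))) => //= X Y f; exact: neta'.
Qed.

Lemma relative_tensor_transport : relative_tensor M N P -> relative_tensor M N Q.
Proof.
move=> [B [b [l [r hB]]]]; have {}hB : tensor_data b l r by [].
have [[bal ub] _ _ _ _] := hB; have [lU rU mU] := hU.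
have UD X Y Z (g : mor P Y Z) (f : mor P X Y) W (x : mor Q W (U X)) :
    fmap U (g ∘ f) ∘ x = fmap U g ∘ (fmap U f ∘ x).
  by rewrite fmap_comp mcompA.
exists (comp_bifunctor B), (fun m X n => fmap U (b m X n)),
  (fun X m n => bf_l U X (B m n) ∘ fmap U (l X m n)),
  (fun m n X => fmap U (r m n X) ∘ bf_r U (B m n) X).
have il X p : is_iso (bf_l U X p) by exact: is_iso_mfl lU _ _.
have ir p X : is_iso (bf_r U p X) by exact: is_iso_mfr rU _ _.
have lnat X X' p p' (f : mor C X X') (g : mor P p p') W (x : mor Q W _) :
    bf_l U X' p' ∘ (fmap U (f ▷' g) ∘ x) = (f ▷' fmap U g) ∘ (bf_l U X p ∘ x).
  by have [h _ _ _] := lU; rewrite !mcompA h.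
have rnat X X' p p' (f : mor C X X') (g : mor P p p') W (x : mor Q W _) :
    bf_r U p' X' ∘ ((fmap U g ◁' f) ∘ x) = fmap U (g ◁' f) ∘ (bf_r U p X ∘ x).
  by have [h _ _ _] := rU; rewrite !mcompA h.
have Ul X X' (f : mor C X X') m m' (g : mor M m m') n n' (h : mor N n n') W (x : mor Q W _) :
    fmap U (l X' m' n') ∘ (fmap U (bmap B (f ▷' g) h) ∘ x) =
    fmap U (f ▷' bmap B g h) ∘ (fmap U (l X m n) ∘ x).
  by rewrite -!UD; congr (fmap U _ ∘ _); by_elt; exact: (td_l_nat hB).
have Ur m m' (g : mor M m m') n n' (h : mor N n n') X X' (f : mor C X X') W (x : mor Q W _) :
    fmap U (r m' n' X') ∘ (fmap U (bmap B g h ◁' f) ∘ x) =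
    fmap U (bmap B g (h ◁' f)) ∘ (fmap U (r m n X) ∘ x).
  by rewrite -!UD; congr (fmap U _ ∘ _); by_elt; exact: (td_r_nat hB).
split.
- split; last exact: comp_universal.
  have [e1 e2 e3] := bal; split=> /=.
  + by move=> *; rewrite -!fmap_comp e1.
  + by move=> *; exact: is_iso_fmap.
  + by move=> *; rewrite -!fmap_comp e3.
- split=> [n|X m n n' g] /=; last first.
    by by_elt; rewrite -{1}(bmap_id (lact M)) Ul lnat.
  split=> /=.
  + by move=> X X' m m' f h; by_elt; rewrite Ul lnat.
  + by move=> X m; apply: is_iso_comp => //; exact/is_iso_fmap/(is_iso_td_l hB).
  + move=> X Y m; by_elt; rewrite (mfl_la lU) bmapRc -mcompA -lnat; congr (_ ∘ (_ ∘ _)).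
    by rewrite -!UD; congr (fmap U _ ∘ _); by_elt; exact: (td_l_la hB).
  + move=> m; rewrite -mcompA -fmap_comp.
    have -> : l unit_ob m n ∘ bmap B (lu M m) (id_mor n) = lu P (B m n).
      by apply: eltP => W x; rewrite -mcompA (td_l_lu hB).
    by apply: eltP => W x; rewrite -mcompA (mfl_lu lU).
- split=> [m|m m' n X f] /=; last first.
    by by_elt; rewrite rnat Ur bmap_id.
  split=> /=.
  + by move=> n n' X X' h f; by_elt; rewrite rnat Ur.
  + by move=> n X; apply: is_iso_comp => //; exact/is_iso_fmap/(is_iso_td_r hB).
  + move=> n X Y; rewrite bmapLc; by_elt; rewrite rnat -(mfr_ra rU).
    rewrite !mcompA -!fmap_comp; congr (fmap U _ ∘ _ ∘ _ ∘ _).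
    by apply: eltP => W x; rewrite -!mcompA (td_r_ra hB).
  + move=> n; apply: eltP => W x; rewrite -!mcompA (mfr_ru rU) -UD; congr (fmap U _ ∘ _).
    by rewrite -[LHS]comp_idr -mcompA (td_r_ru hB) comp_idr.
- split.
  + move=> X m Y n /=; by_elt; rewrite -lnat; congr (_ ∘ _).
    rewrite !mcompA -!fmap_comp; congr (fmap U _ ∘ _).
    by apply: eltP => W x; rewrite -!mcompA (td_b_l hB).
  + move=> m X n Y /=; by_elt; rewrite rnat !mcompA -!fmap_comp; congr (fmap U _ ∘ _ ∘ _).
    by apply: eltP => W x; rewrite -!mcompA (td_b_r hB).
- move=> X m n Y /=; rewrite bmapRc bmapLc; by_elt.
  rewrite (bf_mid hU) rnat -lnat; congr (_ ∘ _).
  rewrite !mcompA -!fmap_comp; congr (fmap U _ ∘ _ ∘ _).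
  by apply: eltP => W x; rewrite -!mcompA (td_mid hB).
Qed.

End TransportTarget.

(** * Invertible objects and twists *)

Section InvertibleObjects.
Variables (k : fieldType) (C : moncat k).

Lemma invertible_fix_left (g : C) : invertible g -> equivalence (fix_left (tens C) g).
Proof.
move=> [h [[a ia] [b ib]]]; exists (fix_left (tens C) h); split.
- exists (fun X => lun X ∘ ((b ⊗' id_mor X) ∘ bwd (asc h g X))).
  split=> [X Y f|X] /=.
    strictify T; by_elt; rewrite !hat_leaf.
    exact: (@hat_nat _ _ (Node (Leaf h) (Leaf g)) One b).
  apply: is_iso_comp (is_iso_fwd _) (is_iso_comp _ (is_iso_bwd _)).
  exact: is_iso_bmap ib (is_iso_id _).
- exists (fun X => lun X ∘ ((a ⊗' id_mor X) ∘ bwd (asc g h X))).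
  split=> [X Y f|X] /=.
    strictify T; by_elt; rewrite !hat_leaf.
    exact: (@hat_nat _ _ (Node (Leaf g) (Leaf h)) One a).
  apply: is_iso_comp (is_iso_fwd _) (is_iso_comp _ (is_iso_bwd _)).
  exact: is_iso_bmap ia (is_iso_id _).
Qed.

Lemma invertible_fix_right (g : C) : invertible g -> equivalence (fix_right (tens C) g).
Proof.
move=> [h [[a ia] [b ib]]]; exists (fix_right (tens C) h); split.
- exists (fun X => run X ∘ ((id_mor X ⊗' a) ∘ asc X g h)).
  split=> [X Y f|X] /=.
    by strictify; by_elt; rewrite !hat_leaf bmap_swap.
  apply: is_iso_comp (is_iso_fwd _) (is_iso_comp _ (is_iso_fwd _)).
  exact: is_iso_bmap (is_iso_id _) ia.
- exists (fun X => run X ∘ ((id_mor X ⊗' b) ∘ asc X h g)).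
  split=> [X Y f|X] /=.
    by strictify; by_elt; rewrite !hat_leaf bmap_swap.
  apply: is_iso_comp (is_iso_fwd _) (is_iso_comp _ (is_iso_fwd _)).
  exact: is_iso_bmap (is_iso_id _) ib.
Qed.

(** Essential surjectivity gives $h\otimes g\cong 1$. For the other side, $(g\otimes h)\otimes
    g\cong g\cong 1\otimes g$, and $-\otimes g$ is fully faithful, so this isomorphism descends to
    $g\otimes h\cong 1$. *)
Lemma fix_right_invertible (g : C) : equivalence (fix_right (tens C) g) -> invertible g.
Proof.
move=> e; have [h [a ia]] := equivalence_ess_surj e (unit_ob : C); exists h.
split; last by exists a.
pose f : mor C (fix_right (tens C) g (g ⊗ h)) (fix_right (tens C) g unit_ob) :=
  bwd (lun g) ∘ (run g ∘ ((id_mor g ⊗' a) ∘ asc g h g)).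
have [f' ef] := equivalence_full e f; exists f'.
apply: (ff_is_iso (equivalence_faithful e) (equivalence_full e)); rewrite ef.
apply: is_iso_comp (is_iso_bwd _) (is_iso_comp (is_iso_fwd _) (is_iso_comp _ (is_iso_fwd _))).
exact: is_iso_bmap (is_iso_id _) ia.
Qed.

Lemma invertible_unit : invertible (unit_ob : C).
Proof. by exists unit_ob; split; exists (lun unit_ob); exact: is_iso_fwd. Qed.

Lemma tens_iso4 (g h h' g' : C) : isomorphic (h ⊗ h') unit_ob -> isomorphic (g ⊗ g') unit_ob ->
  isomorphic ((g ⊗ h) ⊗ (h' ⊗ g')) unit_ob.
Proof.
move=> [a ia] ig; apply: isomorphic_trans ig.
exists ((id_mor g ⊗' (lun g' ∘ ((a ⊗' id_mor g') ∘ bwd (asc h h' g')))) ∘ asc g h (h' ⊗ g')).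
apply: is_iso_comp (is_iso_fwd _); apply: is_iso_bmap (is_iso_id _) _.
apply: is_iso_comp (is_iso_fwd _) (is_iso_comp _ (is_iso_bwd _)).
exact: is_iso_bmap ia (is_iso_id _).
Qed.

Lemma invertible_tens (g h : C) : invertible g -> invertible h -> invertible (g ⊗ h).
Proof.
by move=> [g' [a b]] [h' [c d]]; exists (h' ⊗ g'); split; exact: tens_iso4.
Qed.

End InvertibleObjects.

(** * Twists, their products, and the groups Eq and Out *)

Section InnerTwists.
Variables (k : fieldType) (C : moncat k).
Hypothesis ssC : finite_semisimple C.
Let hreg := regular_is_bimodule ssC.

Lemma twist_regular_central (F : monfun C C) : monoidal F ->
  bimodule_equivalent (twist F) (regular_bimod C) ->
  exists (g : C) (u : forall Y : C, mor C (g ⊗ Y) (F Y ⊗ g)),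
    invertible g /\ @twisted_central k C (regular_bimod C) F g u.
Proof.
move=> hF [T [hT eT]]; have [_ ltw _ _] := twist_is_bimodule ssC hF.
have [_ lr _ _] := hreg.
exists (T (unit_ob : C)), (central_of_functor T); split; last exact: central_of_functor_central.
apply: fix_right_invertible.
exact: equivalence_natural_iso (natural_iso_inv (central_of_functor_natural_iso hT)) eT.
Qed.

Lemma central_twist_regular (F : monfun C C) (g : C) (u : forall Y : C, mor C (g ⊗ Y) (F Y ⊗ g)) :
  invertible g -> @twisted_central k C (regular_bimod C) F g u ->
  bimodule_equivalent (twist F) (regular_bimod C).
Proof.
move=> ig hu; have [_ lr rr mr] := hreg.
exists (@act_functor k C (regular_bimod C) F g u); split.
  exact: act_functor_bimodule.
exact: invertible_fix_right.
Qed.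

(** The twisted half-braiding is a natural isomorphism $g\otimes -\cong F(-)\otimes g$ with [g]
    invertible; the left side and $-\otimes g$ are equivalences, hence so is [F]. *)
Lemma twist_regular_equivalence (F : monfun C C) : monoidal F ->
  bimodule_equivalent (twist F) (regular_bimod C) -> equivalence F.
Proof.
move=> hF /(twist_regular_central hF) [g [u [ig hu]]].
apply: (equivalence_cancel_l (invertible_fix_right ig)).
apply: (@equivalence_natural_iso _ _ _ (fix_left (tens C) g)
  (fcomp (fix_right (tens C) g) F) u _ (invertible_fix_left ig)).
split=> [X Y f|X]; last exact: (is_iso_u hu).
by have [h _ _ _] := hu; exact: h.
Qed.

Lemma twist_monfun_iso (F G : monfun C C) : monoidal F -> monfun_iso F G ->
  bimodule_equivalent (twist F) (twist G).
Proof. by move=> hF i; have [_ _ r m] := hreg; exact: (restrict_monfun_iso r m i). Qed.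

Lemma twist_id : bimodule_equivalent (twist (monfun_id C)) (regular_bimod C).
Proof. exact: (restrict_id (regular_bimod C)). Qed.

(** One relative tensor product is explicit, the restriction of [x] along [G], which is equivalent
    to the twist by [FG]. Any other one agrees with it by uniqueness, and any bimodule equivalent to
    it is again one by transport. *)
Lemma relative_tensor_twist (x y z : bimod C) (F G : monfun C C) :
  is_bimodule x -> is_bimodule y -> is_bimodule z -> monoidal F -> monoidal G ->
  bimodule_equivalent (twist F) x -> bimodule_equivalent (twist G) y ->
  (relative_tensor x y z <-> bimodule_equivalent (twist (monfun_comp F G)) z).
Proof.
move=> hx hy hz hF hG xF yG; have [_ xl xr xm] := hx; have [_ yl yr ym] := hy.
have [_ zl zr zm] := hz.
have hxG : is_bimodule (restrict x G) by exact: restrict_is_bimodule.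
have rt : relative_tensor x y (restrict x G).
  have [S [hS eS]] := bimodule_equivalent_sym hy yG; have [lS rS mS] := hS.
  apply: (@twist_relative_tensor _ _ x y G S (bf_l S) (bf_r S)) => //.
  by move=> X n Y; have := mS X n Y; rewrite /= ?fmap_id.
have e : bimodule_equivalent (twist (monfun_comp F G)) (restrict x G).
  have hr : is_bimodule (restrict (twist F) G).
    by apply: restrict_is_bimodule => //; exact: twist_is_bimodule.
  have [_ _ rr _] := hreg.
  apply: bimodule_equivalent_trans (restrict_equivalent G xF).
  apply: bimodule_equivalent_sym; last exact: (restrict_restrict G F rr).
  by apply: twist_is_bimodule => //; exact: monfun_comp_monoidal.
split=> [rtz|ez].
  exact: bimodule_equivalent_trans e (relative_tensor_unique hxG hz xm ym rt rtz).
have [U [hU eU]] := bimodule_equivalent_trans (bimodule_equivalent_sym hxG e) ez.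
exact: relative_tensor_transport hU eU rt.
Qed.

(** The inverse of the twist by [F] is the twist by an inverse of [F]; as a left module category the
    twist is literally [C]. *)
Lemma twist_out (F : tensor_auteq C) : exists M : out_bimod C, M = twist F :> bimod C.
Proof.
have hF := ta_monoidal F; have [G [hG eG FG GF]] := monoidal_inverse hF (ta_equivalence F).
have bF := twist_is_bimodule ssC hF; have bG := twist_is_bimodule ssC hG.
have prod_reg (F1 G1 : monfun C C) : monoidal F1 -> monoidal G1 ->
    monfun_iso (monfun_comp F1 G1) (monfun_id C) ->
    relative_tensor (twist F1) (twist G1) (regular_bimod C).
  move=> h1 h2 i; apply/(relative_tensor_twist (F := F1) (G := G1)) => //.
  - exact: twist_is_bimodule.
  - exact: twist_is_bimodule.
  - exact: bimodule_equivalent_refl.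
  - exact: bimodule_equivalent_refl.
  - apply: bimodule_equivalent_trans twist_id.
    by apply: twist_monfun_iso => //; exact: monfun_comp_monoidal.
have iF : invertible_bimodule (twist F).
  by split=> //; exists (twist G); split=> //; exact: prod_reg.
have lF : left_module_equivalent (twist F) (regular_bimod C).
  exists (fid C), (fun X m => id_mor (X ⊗ m)); split; last exact: equivalence_id.
  by have [h _ _] := bimodfun_id_bimodule (regular_bimod C); exact: h.
by exists (OutBimod iF lF).
Qed.

(** A left module equivalence with [C] yields only a tensor functor [F]. Writing the inverse
    bimodule [N] as a twist by some [G] too, the two products $MN$ and $NM$ show that [FG] and [GF]
    are equivalences. *)
Lemma out_twist (M : out_bimod C) :
  exists F : tensor_auteq C, bimodule_equivalent (twist F) M.
Proof.
have [hM [N [hN MN NM]]] := ob_invertible M; have lM := ob_left M.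
have [F [hF eF]] := left_module_equivalent_twist hM lM.
have [_ Ml Mr Mm] := hM; have [_ Nl Nr Nm] := hN.
have hNF : is_bimodule (restrict N F) by exact: restrict_is_bimodule.
have [S [hS eS]] := bimodule_equivalent_sym hM eF; have [lS rS mS] := hS.
have rt : relative_tensor N M (restrict N F).
  apply: (@twist_relative_tensor _ _ N M F S (bf_l S) (bf_r S)) => //.
  by move=> X n Y; have := mS X n Y; rewrite /= ?fmap_id.
have [T [[lT _ _] eT]] := relative_tensor_unique hNF hreg Nm Mm rt NM.
(* Restriction along [F] leaves the left action of [N] unchanged, so the equivalence of
   $N\boxtimes_C M$ with [C] is also one of left module categories from [N] to [C]. *)
have lN : left_module_equivalent N (regular_bimod C) by exists T, (bf_l T).
have [G [hG eG]] := left_module_equivalent_twist hN lN.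
have eFG := (relative_tensor_twist hM hN hreg hF hG eF eG).1 MN.
have eGF := (relative_tensor_twist hN hM hreg hG hF eG eF).1 NM.
have equivF : equivalence F.
  apply: (@equivalence_two_sided _ _ F G).
    by apply: (twist_regular_equivalence _ eGF); exact: monfun_comp_monoidal.
  by apply: (twist_regular_equivalence _ eFG); exact: monfun_comp_monoidal.
by exists (TensorAuteq hF equivF).
Qed.

Lemma out_is_bimodule (M : out_bimod C) : is_bimodule M.
Proof. by have [] := ob_invertible M. Qed.

Definition ta_comp (F G : tensor_auteq C) : tensor_auteq C :=
  TensorAuteq (monfun_comp_monoidal (ta_monoidal F) (ta_monoidal G))
    (equivalence_comp (ta_equivalence F) (ta_equivalence G)).

Definition ta_id : tensor_auteq C :=
  TensorAuteq (monfun_id_monoidal C) (equivalence_id C).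

Lemma ta_inverse (F : tensor_auteq C) : exists G : tensor_auteq C,
  monfun_iso (monfun_comp F G) (monfun_id C) /\ monfun_iso (monfun_comp G F) (monfun_id C).
Proof.
have [G [hG eG FG GF]] := monoidal_inverse (ta_monoidal F) (ta_equivalence F).
by exists (TensorAuteq hG eG).
Qed.

Definition eq_group : EqGroup C.
Proof.
apply: (@build_class_group_op (tensor_auteq C) (fun F G => monfun_iso F G) ta_comp ta_id).
- by move=> F; exact: monfun_iso_refl.
- by move=> F G; exact: monfun_iso_sym.
- by move=> F G H; exact: monfun_iso_trans.
- by move=> F F' G G' i j; apply: monfun_comp_congr => //; exact: ta_monoidal.
- by move=> F G H; exact: monfun_compA.
- by move=> F; exact: monfun_comp1.
- by move=> F; have [G [_ i]] := ta_inverse F; exists G.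
Qed.

Lemma out_prod (x y z : out_bimod C) (F G : tensor_auteq C) :
  bimodule_equivalent (twist F) x -> bimodule_equivalent (twist G) y ->
  (relative_tensor x y z <-> bimodule_equivalent (twist (ta_comp F G)) z).
Proof.
by move=> ex ey; apply: relative_tensor_twist => //; (exact: out_is_bimodule || exact: ta_monoidal).
Qed.

Lemma twist_sym (x : bimod C) (F : tensor_auteq C) :
  bimodule_equivalent x (twist F) -> bimodule_equivalent (twist F) x.
Proof. exact/bimodule_equivalent_sym/(twist_is_bimodule ssC)/ta_monoidal. Qed.

Lemma twist_comp_congr (F F' G G' : tensor_auteq C) :
  bimodule_equivalent (twist F) (twist F') -> bimodule_equivalent (twist G) (twist G') ->
  bimodule_equivalent (twist (ta_comp F G)) (twist (ta_comp F' G')).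
Proof.
move=> eF eG; have tb (H : tensor_auteq C) := twist_is_bimodule ssC (ta_monoidal H).
apply/(relative_tensor_twist (x := twist F') (y := twist G')) => //; try exact: ta_monoidal.
apply/(relative_tensor_twist (F := F') (G := G')) => //; try exact: ta_monoidal.
all: exact: bimodule_equivalent_refl.
Qed.

(** A model of Out on tensor auto-equivalences, two of them being identified when their twists are
    equivalent. [out_group] is transported from it, since every element of Out is represented by a
    twist. *)
Definition twist_group : @class_group (tensor_auteq C)
  (fun F G => bimodule_equivalent (twist F) (twist G))
  (fun F G H => bimodule_equivalent (twist (ta_comp F G)) (twist H)).
Proof.
apply: (build_class_group_op (e := ta_id)).
- by move=> F; exact: bimodule_equivalent_refl.
- by move=> F G; exact: twist_sym.
- by move=> F G H; exact: bimodule_equivalent_trans.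
- by move=> *; exact: twist_comp_congr.
- by move=> F G H; apply: twist_monfun_iso (monfun_compA _ _ _); exact: (ta_monoidal (ta_comp (ta_comp F G) H)).
- by move=> F; apply: twist_monfun_iso (monfun_comp1 _); exact: (ta_monoidal (ta_comp ta_id F)).
- move=> F; have [G [_ i]] := ta_inverse F; exists G.
  by apply: twist_monfun_iso i; exact: (ta_monoidal (ta_comp G F)).
Qed.

Definition out_group : OutGroup C.
Proof.
have tr := @bimodule_equivalent_trans _ C.
apply: (transport_class_group twist_group (rep := fun F (x : out_bimod C) =>
  bimodule_equivalent (twist F) x)).
- exact: out_twist.
- move=> F; have [M eM] := twist_out F; exists M; rewrite eM.
  exact: bimodule_equivalent_refl.
- move=> x y F G Fx Gy; have xF := bimodule_equivalent_sym (out_is_bimodule x) Fx.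
  have yG := bimodule_equivalent_sym (out_is_bimodule y) Gy.
  by split=> e; [exact: tr xF (tr _ _ _ e Gy)|exact: tr Fx (tr _ _ _ e yG)].
- move=> x y z F G H Fx Gy Hz; have zH := bimodule_equivalent_sym (out_is_bimodule z) Hz.
  by rewrite (out_prod z Fx Gy); split=> e; [exact: tr e Hz|exact: tr e zH].
Qed.

End InnerTwists.

(** * Conjugation by invertible objects *)

Section Conjugation.
Variables (k : fieldType) (C : moncat k).
Implicit Types F G : monfun C C.

(** The relation $g\otimes Y\cong F(Y)\otimes g$ expresses $F(Y)\cong g\otimes Y\otimes g^*$ without
    a choice of dual, and behaves well under products and isomorphisms. *)
Definition conjugates F (g : C) : Prop :=
  exists u : forall Y : C, mor C (g ⊗ Y) (F Y ⊗ g), @twisted_central k C (regular_bimod C) F g u.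

Lemma conjugates_intro F (g : C) (u : forall Y : C, mor C (g ⊗ Y) (F Y ⊗ g)) :
  (forall (Y Y' : C) (f : mor C Y Y'),
     u Y' ∘ (id_mor g ⊗' f) = (fmap F f ⊗' id_mor g) ∘ u Y) ->
  (forall Y, is_iso (u Y)) ->
  (forall X Y : C, (mon_J F X Y ⊗' id_mor g) ∘ bwd (asc (F X) (F Y) g)
      ∘ (id_mor (F X) ⊗' u Y) ∘ asc (F X) g Y ∘ (u X ⊗' id_mor Y) =
    u (X ⊗ Y) ∘ asc g X Y) ->
  u unit_ob ∘ bwd (run g) = (mon_eps F ⊗' id_mor g) ∘ bwd (lun g) ->
  @twisted_central k C (regular_bimod C) F g u.
Proof. by move=> h1 h2 h3 h4; split=> //= X Y; rewrite inv_fwd. Qed.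

Lemma conjugates_elim F (g : C) (u : forall Y : C, mor C (g ⊗ Y) (F Y ⊗ g)) :
  @twisted_central k C (regular_bimod C) F g u ->
  [/\ forall (Y Y' : C) (f : mor C Y Y'),
     u Y' ∘ (id_mor g ⊗' f) = (fmap F f ⊗' id_mor g) ∘ u Y,
   forall Y, is_iso (u Y),
   forall X Y : C, (mon_J F X Y ⊗' id_mor g) ∘ bwd (asc (F X) (F Y) g)
      ∘ (id_mor (F X) ⊗' u Y) ∘ asc (F X) g Y ∘ (u X ⊗' id_mor Y) =
    u (X ⊗ Y) ∘ asc g X Y
   & u unit_ob ∘ bwd (run g) = (mon_eps F ⊗' id_mor g) ∘ bwd (lun g)].
Proof.
by move=> [h1 h2 h3 h4]; split=> // X Y; have := h3 X Y; rewrite /= inv_fwd.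
Qed.

(** Up to coherence the inverse [D] is the solution of $g\otimes D = \mathrm{coev}\otimes g$, which
    exists because $g\otimes -$ is full. One zigzag identity makes it a right inverse of the
    evaluation, the other a left inverse. *)
Lemma ev_iso (g : C) (d : left_dual g) : invertible g -> is_iso (ev d).
Proof.
move=> ig; have eg := invertible_fix_left ig; set g' := dual_ob d.
pose K : mor C (g ⊗ unit_ob) (g ⊗ (g' ⊗ g)) :=
  asc g g' g ∘ ((coev d ⊗' id_mor g) ∘ (bwd (lun g) ∘ run g)).
have [D /= eD] := equivalence_full eg (K : mor C (fix_left (tens C) g unit_ob)
  (fix_left (tens C) g (g' ⊗ g))).
have zz := zigzag d; have zg := zagzig d; rewrite -/g' in zz zg.
exists D; split; last first.
  apply: (equivalence_faithful eg) => /=; rewrite bmapRc eD bmap_id.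
  apply: (iso_mono (is_iso_fwd (run g))); apply: (iso_epi (is_iso_bwd (run g))).
  by rewrite comp_idr bwdK -[RHS]zz /K; strictify.
rewrite /K in eD; strictify T; hat_hyp zg (g ⊗ T) z; hat_hyp eD T e; rewrite -z.
by_elt; rewrite -e; apply: esym.
exact: (@hat_nat _ _ (Node (Leaf g') (Leaf g)) One (ev d) _ _ (hat One (Node (Leaf g') (Leaf g)) D T)).
Qed.

Lemma conjugates_conj (g : C) (d : left_dual g) : invertible g -> conjugates (conj_functor d) g.
Proof.
move=> ig; have ie := ev_iso d ig; set g' := dual_ob d.
have iV : is_iso (inv (ev d)) by exact: is_iso_inv.
exists (fun X => bwd (asc (g ⊗ X) g' g) ∘ ((id_mor (g ⊗ X) ⊗' inv (ev d)) ∘ bwd (run (g ⊗ X)))).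
apply: conjugates_intro => /=.
- move=> X Y f; rewrite -/g'; strictify T; by_elt; rewrite !hat_leaf.
  by rewrite !mcompA -!bmapRc -bmapLR -bmapRL.
- move=> Y; apply: is_iso_comp (is_iso_bwd _) (is_iso_comp _ (is_iso_bwd _)).
  exact: is_iso_bmap (is_iso_id _) iV.
- move=> X Y; rewrite -/g'; strictify T; rewrite -!bmapRc; do 2 congr (_ ⊗' _).
  have ih T' : is_iso (hat (Node (Leaf g') (Leaf g)) One (ev d) T') by exact: is_iso_hat.
  rewrite !(@hat_inv _ _ (Node (Leaf g') (Leaf g)) One) //.
  apply: (iso_epi (ih (Y ⊗ T))); by_elt; rewrite (invKe _ (ih _)).
  exact: (@hat_nat _ _ (Node (Leaf g') (Leaf g)) One (ev d) _ _ (id_mor Y ⊗' inv (hat (Node (Leaf g') (Leaf g)) One (ev d) T))).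
- rewrite -/g'; strictify T.
  have ih : is_iso (hat (Node (Leaf g') (Leaf g)) One (ev d) T) by exact: is_iso_hat.
  rewrite (@hat_inv _ _ (Node (Leaf g') (Leaf g)) One) //.
  apply: (iso_mono (is_iso_bmap (tens C) (is_iso_id g) ih)).
  rewrite -bmapRc Kinv //= bmap_id; have zz := zigzag d; rewrite -/g' in zz.
  by hat_hyp zz T z; rewrite -z.
Qed.

Lemma conjugates_equivalence F (g : C) : invertible g -> conjugates F g -> equivalence F.
Proof.
move=> ig [u hu]; apply: (equivalence_cancel_l (invertible_fix_right ig)).
apply: (@equivalence_natural_iso _ _ _ (fix_left (tens C) g)
  (fcomp (fix_right (tens C) g) F) u _ (invertible_fix_left ig)).
split=> [X Y f|X]; last exact: (is_iso_u hu).
by have [h _ _ _] := hu; exact: h.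
Qed.

Lemma conjugates_monfun_iso F G (g : C) : finite_semisimple C -> invertible g ->
  conjugates F g -> conjugates G g -> monfun_iso F G.
Proof.
move=> ss ig [u hu] [v hv]; have [_ hl hr hm] := regular_is_bimodule ss.
have eg := invertible_fix_right ig.
exact: (twisted_central_monfun_iso hl hm hu hv (equivalence_faithful eg) (equivalence_full eg)).
Qed.

(** This is how [conj_functor] is shown to be monoidal: its axioms are inherited from the regular
    bimodule along the fully faithful functor $-\otimes g$. *)
Lemma conjugates_monoidal F (g : C) : finite_semisimple C -> invertible g ->
  conjugates F g -> monoidal F.
Proof.
move=> ss ig [u hu]; have [_ hl hr hm] := regular_is_bimodule ss.
have eg := invertible_fix_right ig.
exact: (twisted_central_monoidal hl hr hm hu (equivalence_faithful eg) (equivalence_full eg)).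
Qed.

(** Move [Y] past [h] and then past [g]. With uniqueness of the conjugation this makes $F_-$
    multiplicative. *)
Lemma conjugates_comp F G (g h : C) :
  conjugates F g -> conjugates G h -> conjugates (monfun_comp F G) (g ⊗ h).
Proof.
move=> [u /conjugates_elim [un iu uh u1]] [v /conjugates_elim [vn iv vh v1]].
exists (fun X => asc (F (G X)) g h ∘ (u (G X) ⊗' id_mor h) ∘ bwd (asc g (G X) h)
  ∘ (id_mor g ⊗' v X) ∘ asc g h X).
apply: conjugates_intro => /=.
- move=> X Y f; have e := un _ _ (fmap G f); have e' := vn _ _ f.
  strictify T; hat_hyp e (h ⊗ T) eh; hat_hyp e' T eh'.
  by rewrite -bmapRc eh' bmapRc mcompA eh -mcompA.
- move=> Y; apply: is_iso_comp (is_iso_fwd _).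
  apply: is_iso_comp (is_iso_bmap _ (is_iso_id _) (iv _)).
  apply: is_iso_comp (is_iso_bwd _).
  apply: is_iso_comp (is_iso_fwd _) (is_iso_bmap _ (iu _) (is_iso_id _)).
- move=> X Y; have e := uh (G X) (G Y); have e' := vh X Y; have e'' := un _ _ (mon_J G X Y).
  strictify T; hat_hyp e (h ⊗ T) eh; hat_hyp e' T eh'; hat_hyp e'' (h ⊗ T) eh''.
  rewrite -eh' !bmapRc !mcompA eh'' -eh; by_elt.
  congr (_ ∘ (_ ∘ (_ ∘ _))); apply: esym.
  exact: (@hat_nat _ _ (Node (Leaf g) (Leaf (G X))) (Node (Leaf (F (G X))) (Leaf g)) (u (G X)) _ _
    (hat (Node (Leaf h) (Leaf Y)) (Node (Leaf (G Y)) (Leaf h)) (v Y) T)).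
- have e := un _ _ (mon_eps G); strictify T; hat_hyp e (h ⊗ T) eh; hat_hyp u1 (h ⊗ T) eh';
  hat_hyp v1 T eh''.
  by rewrite eh'' eh eh'.
Qed.

Lemma twisted_central_iso F (g h : C) (f : mor C g h) (u : forall Y : C, mor C (g ⊗ Y) (F Y ⊗ g)) :
  is_iso f -> @twisted_central k C (regular_bimod C) F g u ->
  @twisted_central k C (regular_bimod C) F h
    (fun X => (id_mor (F X) ⊗' f) ∘ u X ∘ (inv f ⊗' id_mor X)).
Proof.
move=> i /conjugates_elim [un iu uh u1]; have iV := is_iso_inv i.
have fV : inv f ∘ f = id_mor g by exact: invK.
have Vf : f ∘ inv f = id_mor h by exact: Kinv.
apply: conjugates_intro => /=.
- move=> X Y x; have e := un _ _ x; strictify T; hat_hyp e T eh.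
  rewrite !hat_leaf in eh *; by_elt; rewrite [in LHS]bmap_swap (elt2 eh).
  by rewrite bmap_swap.
- move=> X; apply: is_iso_comp (is_iso_bmap _ iV (is_iso_id _)).
  exact: is_iso_comp (is_iso_bmap _ (is_iso_id _) i) (iu _).
- move=> X Y; have e := uh X Y; strictify T; hat_hyp e T eh.
  rewrite -eh !hat_leaf; by_elt; rewrite [(id_mor (F X) ⊗' (inv f ⊗' _)) ∘ _]mcompA.
  rewrite -bmapRc -bmapLc fV !bmap_id comp_idl.
  exact: (@hat_nat _ _ (Node (Leaf (F X)) (Leaf (F Y))) (Leaf (F (X ⊗ Y))) (mon_J F X Y) _ _
    (f ⊗' id_mor T)).
- strictify T; hat_hyp u1 T e; rewrite e !hat_leaf.
  have n := @hat_nat _ _ One (Leaf (F unit_ob)) (mon_eps F) _ _ (f ⊗' id_mor T).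
  by rewrite mcompA -[LHS]comp_idr -!mcompA -n /= comp_idr -bmapLc Vf bmap_id comp_idr.
Qed.

Lemma conjugates_iso F (g h : C) : isomorphic g h -> conjugates F g -> conjugates F h.
Proof. by move=> [f i] [u hu]; eexists; exact: twisted_central_iso i hu. Qed.

Lemma conjugates_congr F G (g : C) : monfun_iso F G -> conjugates F g -> conjugates G g.
Proof.
move=> [eta [[nat i] J e]] [u /conjugates_elim [un iu uh u1]].
exists (fun X => (eta X ⊗' id_mor g) ∘ u X).
apply: conjugates_intro => /=.
- move=> X Y f; rewrite -mcompA un; by_elt; rewrite !mcompA -!bmapLc.
  by have -> := nat _ _ f.
- by move=> X; apply: is_iso_comp (is_iso_bmap _ (i _) (is_iso_id _)) (iu _).
- move=> X Y; have E := uh X Y; have E' := J X Y; strictify T; hat_hyp E T eh; hat_hyp E' (g ⊗ T) eh'.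
  rewrite -eh; by_elt; rewrite (elt2 eh') !hat_leaf.
  by rewrite -?mcompA !bmap_swap.
- strictify T; hat_hyp u1 T E; hat_hyp e (g ⊗ T) E'.
  by rewrite E E'.
Qed.

End Conjugation.

(** * The Drinfeld center *)

Section Center.
Variables (k : fieldType) (C : moncat k).
Hypothesis ssC : finite_semisimple C.
Implicit Types Z W V : half_braided C.
Let hreg := regular_is_bimodule ssC.

(** [half_braiding] states no unit condition. The hexagon at two units, with naturality along [lun],
    shows that the component at the unit is idempotent in the strict model; being invertible, it is
    the identity. *)
Lemma hat_half_braiding_unit Z T : half_braiding Z ->
  hat (Node (Leaf (hb_ob Z)) One) (Node One (Leaf (hb_ob Z))) (hb_br Z unit_ob) T = id_mor _.
Proof.
move=> [nat i hex]; have e := nat _ _ (lun unit_ob); hat_hyp e T e1.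
have e' := hex unit_ob unit_ob; hat_hyp e' T e2.
have ih : is_iso (hat (Node (Leaf (hb_ob Z)) One) (Node One (Leaf (hb_ob Z))) (hb_br Z unit_ob) T).
  by apply: is_iso_hat; exact: i.
apply: (iso_epi ih).
by rewrite comp_idl -e2 -e1.
Qed.

Lemma half_braiding_central Z : half_braiding Z <->
  @twisted_central k C (regular_bimod C) (monfun_id C) (hb_ob Z) (hb_br Z).
Proof.
split=> [hZ|/conjugates_elim [n i h _]].
  have [n i h] := hZ; apply: conjugates_intro => //=.
    move=> X Y; rewrite bmap_id comp_idl h -!mcompA fwdK comp_idr.
    by [].
  by strictify T; exact: hat_half_braiding_unit.
split=> // X Y; have /= := h X Y; rewrite bmap_id comp_idl => ->.
by rewrite -mcompA bwdK comp_idr.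
Qed.

Lemma tensoring_bimodule Z : half_braiding Z -> bimodule_functor (tensoring Z).
Proof.
move=> hZ; have [n i h] := hZ; split; [split|split|] => /=.
- move=> X X' m m' f g; have e := n _ _ f; strictify T; hat_hyp e (m' ⊗ T) e'.
  by_elt; rewrite (elt2 e'); congr (_ ∘ _).
  exact: (@hat_nat _ _ (Node (Leaf (hb_ob Z)) (Leaf X)) (Node (Leaf X) (Leaf (hb_ob Z)))
    (hb_br Z X) _ _ (hat (Leaf m) (Leaf m') g T)).
- move=> X m; apply: is_iso_comp (is_iso_bwd _); apply: is_iso_comp (is_iso_fwd _) _.
  exact: is_iso_bmap (i _) (is_iso_id _).
- by move=> X Y m; have e := h X Y; strictify T; hat_hyp e (m ⊗ T) e'.
- by move=> m; strictify T; rewrite hat_half_braiding_unit.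
- by move=> *; rewrite asc_nat.
- by move=> *; exact: is_iso_fwd.
- by move=> *; strictify T.
- by move=> *; strictify T.
- by move=> *; strictify T.
Qed.

Lemma tensoring_comp Z W :
  bimodfun_iso (bimodfun_comp (tensoring Z) (tensoring W)) (tensoring (hb_tensor Z W)).
Proof.
exists (fun m => bwd (asc (hb_ob Z) (hb_ob W) m)); split=> /=.
- split=> [X Y f|X] /=; last exact: is_iso_bwd.
  by strictify.
- by move=> X m; strictify T.
- by move=> m X; strictify T.
Qed.

Lemma tensoring_unit : bimodfun_iso (tensoring (hb_unit C)) (bimodfun_id (regular_bimod C)).
Proof.
exists (fun m => lun m : mor C (unit_ob ⊗ m) m); split=> /=.
- split=> [X Y f|X] /=; last exact: is_iso_fwd.
  by strictify.
- by move=> X m; strictify T.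
- by move=> m X; strictify T.
Qed.

(** A transformation of bimodule functors $Z\otimes -\to W\otimes -$ is determined by its component
    at the unit, and compatibility with the left action says that this component commutes with the
    half-braidings. Formal properties of bimodule functors thereby pass to the center. *)
Lemma hb_isomorphic_tensoring Z W :
  hb_isomorphic Z W <-> bimodfun_iso (tensoring Z) (tensoring W).
Proof.
split=> [[f [i e]]|[eta [[n i] /= l r]]].
  exists (fun m => f ⊗' id_mor m : mor C (hb_ob Z ⊗ m) (hb_ob W ⊗ m)); split=> /=.
  - split=> [X Y g|X] /=; last exact: is_iso_bmap i (is_iso_id _).
    by rewrite -bmapLR -bmapRL.
  - by move=> X m; have e' := e X; strictify T; hat_hyp e' (m ⊗ T) e''.
  - by move=> m X; strictify T.
exists (run (hb_ob W) ∘ (@mcomp k C _ (hb_ob Z ⊗ unit_ob) _ (eta unit_ob) (bwd (run (hb_ob Z))))); split.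
  by apply: is_iso_comp (is_iso_fwd _) (is_iso_comp (i _) (is_iso_bwd _)).
(* The right action identifies $\eta_{1\otimes X}$ with $\eta_1\otimes X$, naturality along [lun X]
   and [run X] replaces it by $\eta_{X\otimes 1}$, and the left action brings in the
   half-braidings. *)
move=> X; have l1 := l X unit_ob; have r1 := r unit_ob X.
have n1 := n _ _ (lun X : mor C _ _); have n2 := n _ _ (run X : mor C _ _); rewrite /= in n1 n2.
strictify T; hat_hyp l1 T e1; hat_hyp r1 T e2; hat_hyp n1 T e3; hat_hyp n2 T e4.
by rewrite e2 -e3 e4.
Qed.

Lemma hb_tensor_half_braiding Z W :
  half_braiding Z -> half_braiding W -> half_braiding (hb_tensor Z W).
Proof.
move=> [un iu uh] [vn iv vh]; split=> /=.
- move=> X Y f; have e := un _ _ f; have e' := vn _ _ f.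
  strictify T; hat_hyp e (hb_ob W ⊗ T) eh; hat_hyp e' T eh'.
  by rewrite -bmapRc eh' bmapRc mcompA eh -mcompA.
- move=> Y; apply: is_iso_comp (is_iso_fwd _).
  apply: is_iso_comp (is_iso_bmap _ (is_iso_id _) (iv _)).
  apply: is_iso_comp (is_iso_bwd _).
  apply: is_iso_comp (is_iso_fwd _) (is_iso_bmap _ (iu _) (is_iso_id _)).
- move=> X Y; have e := uh X Y; have e' := vh X Y.
  strictify T; hat_hyp e (hb_ob W ⊗ T) eh; hat_hyp e' T eh'.
  rewrite eh eh' bmapRc; by_elt; congr (_ ∘ _).
  exact: (@hat_nat _ _ (Node (Leaf (hb_ob Z)) (Leaf X)) (Node (Leaf X) (Leaf (hb_ob Z)))
    (hb_br Z X) _ _ (hat (Node (Leaf (hb_ob W)) (Leaf Y)) (Node (Leaf Y) (Leaf (hb_ob W)))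
    (hb_br W Y) T)).
Qed.

Lemma hb_unit_half_braiding : half_braiding (hb_unit C).
Proof.
split=> /=.
- by move=> X Y f; strictify T.
- by move=> X; apply: is_iso_comp (is_iso_bwd _) (is_iso_fwd _).
- by move=> X Y; strictify T.
Qed.

Lemma hb_isomorphic_refl Z : hb_isomorphic Z Z.
Proof. by apply/hb_isomorphic_tensoring; exact: bimodfun_iso_refl. Qed.

Lemma hb_isomorphic_sym Z W : hb_isomorphic Z W -> hb_isomorphic W Z.
Proof. by rewrite !hb_isomorphic_tensoring; exact: bimodfun_iso_sym. Qed.

Lemma hb_isomorphic_trans Z W V : hb_isomorphic Z W -> hb_isomorphic W V -> hb_isomorphic Z V.
Proof. by rewrite !hb_isomorphic_tensoring; exact: bimodfun_iso_trans. Qed.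

Lemma hb_tensor_congr Z Z' W W' : half_braiding Z -> half_braiding Z' ->
  hb_isomorphic Z Z' -> hb_isomorphic W W' -> hb_isomorphic (hb_tensor Z W) (hb_tensor Z' W').
Proof.
rewrite !hb_isomorphic_tensoring => hZ hZ' i j.
apply: bimodfun_iso_trans (bimodfun_iso_sym (tensoring_comp _ _)) _.
apply: bimodfun_iso_trans (tensoring_comp _ _).
by apply: bimodfun_comp_congr => //; exact: tensoring_bimodule.
Qed.

Lemma hb_tensorA Z W V :
  hb_isomorphic (hb_tensor (hb_tensor Z W) V) (hb_tensor Z (hb_tensor W V)).
Proof.
exists (asc (hb_ob Z) (hb_ob W) (hb_ob V)); split; first exact: is_iso_fwd.
by move=> X /=; strictify T.
Qed.

Lemma hb_tensor1 Z : hb_isomorphic (hb_tensor (hb_unit C) Z) Z.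
Proof.
exists (lun (hb_ob Z)); split; first exact: is_iso_fwd.
by move=> X /=; strictify T.
Qed.

Lemma hb_tensor_r1 Z : hb_isomorphic (hb_tensor Z (hb_unit C)) Z.
Proof.
exists (run (hb_ob Z)); split; first exact: is_iso_fwd.
by move=> X /=; strictify T.
Qed.

(** As [tensoring] multiplies on the left, the comparison with [T] uses the right constraint,
    $T(1)\otimes m\cong T(1\otimes m)\cong T(m)$. Its compatibility with the left action rests on
    the mixed axiom of bimodule functors. *)
Lemma bimodfun_tensoring (T : bimodfun (regular_bimod C) (regular_bimod C)) :
  bimodule_functor T ->
  exists Z, [/\ half_braiding Z, hb_ob Z = T (unit_ob : C) & bimodfun_iso (tensoring Z) T].
Proof.
move=> hT; have [lT rT mT] := hT.
pose T0 : functor C C := T; pose l X m : mor C (T0 (X ⊗ m)) (X ⊗ T0 m) := bf_l T X m.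
pose r m X : mor C (T0 m ⊗ X) (T0 (m ⊗ X)) := bf_r T m X.
pose sw (X : C) : mor C (unit_ob ⊗ X) (X ⊗ unit_ob) := bwd (run X) ∘ lun X.
pose Z := @HalfBraided k C (T0 unit_ob) (fun X =>
  l X unit_ob ∘ (fmap T0 (sw X) ∘ r unit_ob X)).
have hZ : half_braiding Z.
  apply/half_braiding_central.
  (* The twist by the identity and the regular bimodule differ by composition with identities in
     [ra] and [ru], so the functor is repackaged with the former as its source. *)
  pose T' := @BimodFun k C (twist (monfun_id C)) (regular_bimod C) (T : functor C C) l r.
  have [_ rl _ _] := hreg.
  have [_ tl _ _] := twist_is_bimodule ssC (monfun_id_monoidal C).
  have hT' : bimodule_functor T'.
    split; [by case: lT|split|exact: mT].
    - by case: rT.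
    - by case: rT.
    - by move=> m X Y; have [_ _ h _] := rT; rewrite /= bmap_id comp_idl; exact: h.
    - by move=> m; have [_ _ _ h] := rT; rewrite /= bmap_id comp_idl; exact: h.
  exact: (central_of_functor_central tl rl hT').
exists Z; split=> //.
have rra (m X Y V : C) (x : mor C V _) : fmap T0 (asc m X Y) ∘ (r (m ⊗ X) Y ∘ ((r m X ⊗' id_mor Y) ∘ x)) =
  r m (X ⊗ Y) ∘ (asc (T0 m) X Y ∘ x) by exact: (mfr_ra rT).
have rn (m m' : C) (f : mor C m m') (X V : C) (x : mor C V _) : r m' X ∘ ((fmap T0 f ⊗' id_mor X) ∘ x) =
  fmap T0 (f ⊗' id_mor X) ∘ (r m X ∘ x) by exact: (mfr_nat1 rT).
have rmid (X m Y V : C) (x : mor C V _) :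
    (id_mor X ⊗' r m Y) ∘ (asc X (T0 m) Y ∘ ((l X m ⊗' id_mor Y) ∘ x)) =
    l X (m ⊗ Y) ∘ (fmap T0 (asc X m Y) ∘ (r (X ⊗ m) Y ∘ x)) by exact: (bf_mid hT).
have ln2 (X m m' : C) (f : mor C m m') (V : C) (x : mor C V _) :
    l X m' ∘ (fmap T0 (id_mor X ⊗' f) ∘ x) = (id_mor X ⊗' fmap T0 f) ∘ (l X m ∘ x).
  exact: (mfl_nat2 lT).
exists (fun m => fmap T0 (lun m) ∘ r unit_ob m); split=> /=.
- split=> [X Y f|X] /=; last first.
    by apply: is_iso_comp; [exact/is_iso_fmap/is_iso_fwd|exact: (is_iso_mfr rT)].
  by_elt; rewrite [r _ _ ∘ _](mfr_nat2 rT); rewrite !mcompA -!fmap_comp.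
  by rewrite lun_nat.
- move=> X m; apply: (iso_epi (is_iso_fwd (asc (T0 unit_ob) X m))).
  by_elt; rewrite fwdKe -rra bmapRc !bmapLc -!mcompA rmid rn -ln2; congr (_ ∘ _).
  rewrite !mcompA -!fmap_comp; congr (fmap T0 _ ∘ _ ∘ _ ∘ _).
  by rewrite /sw; strictify.
- move=> m X; rewrite bmapLc; by_elt; rewrite rn -rra.
  rewrite !mcompA -!fmap_comp; congr (fmap T0 _ ∘ _ ∘ _ ∘ _).
  by strictify.
Qed.


End Center.

(** * Invertible objects of the center and bimodule auto-equivalences *)

Section InvertibleCentral.
Variables (k : fieldType) (C : moncat k).
Hypothesis ssC : finite_semisimple C.
Implicit Types Z W V : half_braided C.
Let hreg := regular_is_bimodule ssC.

Lemma bimodfun_compA (S T U : bimodfun (regular_bimod C) (regular_bimod C)) :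
  bimodfun_iso (bimodfun_comp (bimodfun_comp S T) U) (bimodfun_comp S (bimodfun_comp T U)).
Proof.
exists (fun m => id_mor _); split=> /=.
- by split=> [X Y f|X]; [rewrite comp_idl comp_idr|exact: is_iso_id].
- by move=> X m; rewrite bmap_id comp_idl comp_idr fmap_comp mcompA.
- by move=> m X; rewrite bmap_id comp_idl comp_idr fmap_comp mcompA.
Qed.

Lemma bimodfun_comp1 (S : bimodfun (regular_bimod C) (regular_bimod C)) :
  bimodfun_iso (bimodfun_comp (bimodfun_id _) S) S.
Proof.
exists (fun m => id_mor _); split=> /=.
- by split=> [X Y f|X]; [rewrite comp_idl comp_idr|exact: is_iso_id].
- by move=> X m; rewrite bmap_id !comp_idl comp_idr.
- by move=> m X; rewrite bmap_id !comp_idl !comp_idr.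
Qed.

Lemma bimodfun_compr1 (S : bimodfun (regular_bimod C) (regular_bimod C)) :
  bimodfun_iso (bimodfun_comp S (bimodfun_id _)) S.
Proof.
exists (fun m => id_mor _); split=> /=.
- by split=> [X Y f|X]; [rewrite comp_idl comp_idr|exact: is_iso_id].
- by move=> X m; rewrite bmap_id fmap_id !comp_idl !comp_idr.
- by move=> m X; rewrite bmap_id fmap_id !comp_idl !comp_idr.
Qed.

Lemma bimodfun_right_inverse (T : bimodfun (regular_bimod C) (regular_bimod C)) :
  bimodule_functor T -> equivalence T ->
  exists G : bimodfun (regular_bimod C) (regular_bimod C),
    [/\ bimodule_functor G, equivalence G
      & bimodfun_iso (bimodfun_comp T G) (bimodfun_id (regular_bimod C))].
Proof.
move=> hT eT; have [_ hl hr hm] := hreg.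
have [G [eps [hG eG i l r]]] := bimodule_functor_inverse hl hr hm hT eT.
exists G; split=> //; exists eps; split=> //.
- by move=> X m; rewrite [RHS]l /= comp_idl.
- by move=> m X; rewrite [RHS]r /= comp_idl.
Qed.

(** An inverse of [tensoring Z] is again of this form, which gives [W] with $ZW\cong 1$. Then [W]
    has a right inverse [V] as well, and $Z\cong Z(WV)\cong (ZW)V\cong V$ shows $WZ\cong 1$. *)
Lemma tensoring_equivalence_inverse Z : half_braiding Z -> equivalence (tensoring Z) ->
  exists W, [/\ half_braiding W, hb_isomorphic (hb_tensor Z W) (hb_unit C)
              & hb_isomorphic (hb_tensor W Z) (hb_unit C)].
Proof.
have right_inverse V : half_braiding V -> equivalence (tensoring V) ->
    exists W, [/\ half_braiding W, equivalence (tensoring W) & hb_isomorphic (hb_tensor V W) (hb_unit C)].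
  move=> hV eV; have bV := tensoring_bimodule hV.
  have [G [hG eG i]] := bimodfun_right_inverse bV eV.
  have [W [hW _ j]] := bimodfun_tensoring ssC hG; exists W; split=> //.
    have [eta [heta _ _]] := j.
    exact: equivalence_natural_iso (natural_iso_inv heta) eG.
  apply/hb_isomorphic_tensoring.
  apply: bimodfun_iso_trans (bimodfun_iso_sym (tensoring_comp _ _)) _.
  apply: bimodfun_iso_trans (bimodfun_iso_sym (tensoring_unit C)).
  by apply: bimodfun_iso_trans i; apply: bimodfun_comp_congr => //; exact: bimodfun_iso_refl.
move=> hZ eZ; have [W [hW eW ZW]] := right_inverse Z hZ eZ.
exists W; split=> //; have [V [hV _ WV]] := right_inverse W hW eW.
have hZW := hb_tensor_half_braiding hZ hW; have h1 := hb_unit_half_braiding C.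
have ZV : hb_isomorphic Z V.
  apply: hb_isomorphic_trans (hb_isomorphic_sym (hb_tensor_r1 Z)) _.
  apply: hb_isomorphic_trans (hb_tensor1 V).
  apply: (@hb_isomorphic_trans _ _ _ (hb_tensor Z (hb_tensor W V))).
    exact: hb_tensor_congr (hb_isomorphic_refl Z) (hb_isomorphic_sym WV).
  apply: hb_isomorphic_trans (hb_isomorphic_sym (hb_tensorA Z W V)) _.
  exact: hb_tensor_congr (hb_isomorphic_refl V).
apply: hb_isomorphic_trans WV.
exact: hb_tensor_congr (hb_isomorphic_refl W) ZV.
Qed.

Lemma hb_isomorphic_ob Z W : hb_isomorphic Z W -> isomorphic (hb_ob Z) (hb_ob W).
Proof. by move=> [f [i _]]; exists f. Qed.

Lemma ic_ob_invertible (Z : inv_center C) : invertible (hb_ob Z).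
Proof.
have [W [_ ZW WZ]] := ic_invertible Z; exists (hb_ob W); split.
  exact: hb_isomorphic_ob ZW.
exact: hb_isomorphic_ob WZ.
Qed.

(** Invertibility in the center is inherited from the underlying object, since $Z\otimes -$ is then
    an equivalence. *)
Definition central_ic Z (hZ : half_braiding Z) (iZ : invertible (hb_ob Z)) : inv_center C :=
  InvCenter hZ (tensoring_equivalence_inverse hZ (invertible_fix_left iZ)).

Definition ic_tensor (Z W : inv_center C) : inv_center C :=
  central_ic (hb_tensor_half_braiding (ic_central Z) (ic_central W))
    (invertible_tens (ic_ob_invertible Z) (ic_ob_invertible W)).

Definition ic_unit : inv_center C := central_ic (hb_unit_half_braiding C) (invertible_unit C).

Definition invz_group : InvZGroup C.
Proof.
apply: (@build_class_group_op (inv_center C) (fun x y => hb_isomorphic x y) ic_tensor ic_unit).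
- by move=> x; exact: hb_isomorphic_refl.
- by move=> x y; exact: hb_isomorphic_sym.
- by move=> x y z; exact: hb_isomorphic_trans.
- by move=> x x' y y' i j; apply: hb_tensor_congr => //; exact: ic_central.
- by move=> x y z; exact: hb_tensorA.
- by move=> x; exact: hb_tensor1.
- move=> x; have [W [hW xW Wx]] := ic_invertible x.
  have iW : exists V, [/\ half_braiding V, hb_isomorphic (hb_tensor W V) (hb_unit C)
      & hb_isomorphic (hb_tensor V W) (hb_unit C)].
    by exists x; split=> //; exact: ic_central.
  by exists (InvCenter hW iW).
Qed.

Definition ba_comp (S T : bimod_auteq C) : bimod_auteq C :=
  BimodAuteq (bimodfun_comp_bimodule (ba_bimodule S) (ba_bimodule T))
    (equivalence_comp (ba_equivalence S) (ba_equivalence T)).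

Definition ba_id : bimod_auteq C :=
  BimodAuteq (bimodfun_id_bimodule (regular_bimod C)) (equivalence_id C).

Definition pi1_group : Pi1BrPicGroup C.
Proof.
have refl (S : bimod_auteq C) : bimodfun_iso S S by exact: bimodfun_iso_refl.
have sym (S T : bimod_auteq C) : bimodfun_iso S T -> bimodfun_iso T S by exact: bimodfun_iso_sym.
have trans (S T U : bimod_auteq C) :
    bimodfun_iso S T -> bimodfun_iso T U -> bimodfun_iso S U by exact: bimodfun_iso_trans.
have congr (S S' T T' : bimod_auteq C) : bimodfun_iso S S' -> bimodfun_iso T T' ->
    bimodfun_iso (ba_comp S T) (ba_comp S' T').
  by apply: bimodfun_comp_congr; exact: ba_bimodule.
have assoc (S T U : bimod_auteq C) :
    bimodfun_iso (ba_comp (ba_comp S T) U) (ba_comp S (ba_comp T U)) by exact: bimodfun_compA.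
have op1l (S : bimod_auteq C) : bimodfun_iso (ba_comp ba_id S) S by exact: bimodfun_comp1.
have op1r (S : bimod_auteq C) : bimodfun_iso (ba_comp S ba_id) S by exact: bimodfun_compr1.
have opV (S : bimod_auteq C) : exists T, bimodfun_iso (ba_comp S T) ba_id.
  have [G [hG eG i]] := bimodfun_right_inverse (ba_bimodule S) (ba_equivalence S).
  by exists (BimodAuteq hG eG).
apply: (@build_class_group_op (bimod_auteq C) (fun S T => bimodfun_iso S T) ba_comp ba_id) => //.
move=> S; have [T i] := opV S; exists T.
exact: (@left_inverse_of_right _ (fun S T : bimod_auteq C => bimodfun_iso S T) ba_comp ba_id) i.
Qed.

Definition inv_tens (g h : inv_obj C) : inv_obj C := InvObj (invertible_tens (inv_obP g) (inv_obP h)).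

Definition inv_group : InvGroup C.
Proof.
apply: (@build_class_group_op (inv_obj C) (fun g h => isomorphic g h) inv_tens
  (InvObj (invertible_unit C))).
- by move=> x; exact: isomorphic_refl.
- by move=> x y; exact: isomorphic_sym.
- by move=> x y z; exact: isomorphic_trans.
- by move=> x x' y y'; exact: isomorphic_bmap.
- by move=> x y z; exists (asc x y z); exact: is_iso_fwd.
- by move=> x; exists (lun (x : C)); exact: is_iso_fwd.
- move=> x; have [y [a b]] := inv_obP x.
  by exists (@InvObj _ C y (ex_intro _ (x : C) (conj b a))).
Qed.

Definition ic_auteq (Z : inv_center C) : bimod_auteq C :=
  @BimodAuteq _ C (tensoring Z) (tensoring_bimodule (ic_central Z))
    (invertible_fix_left (ic_ob_invertible Z)).

Lemma auteq_tensoring (T : bimod_auteq C) : exists Z : inv_center C,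
  hb_ob Z = T (unit_ob : C) /\ bimodfun_iso (tensoring Z) T.
Proof.
have [Z [hZ eZ i]] := bimodfun_tensoring ssC (ba_bimodule T).
have [eta [heta _ _]] := i.
have eqZ : equivalence (tensoring Z).
  exact: equivalence_natural_iso (natural_iso_inv heta) (ba_equivalence T).
by exists (InvCenter hZ (tensoring_equivalence_inverse hZ eqZ)).
Qed.

End InvertibleCentral.

(** * The homomorphisms and their kernels *)

Section Homomorphisms.
Variables (k : fieldType) (C : moncat k).
Hypothesis ssC : finite_semisimple C.
Hypothesis rigC : rigid C.
Variables (Pi1 : Pi1BrPicGroup C) (InvZC : InvZGroup C) (InvC : InvGroup C).
Variables (EqC : EqGroup C) (OutC : OutGroup C).

Lemma tensoring_hom : exists Phi : {multiplicative InvZC -> Pi1},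
  bijective Phi /\ forall Z : inv_center C, Phi (cls InvZC Z) = cls Pi1 (ic_auteq Z).
Proof.
have congr (Z W : inv_center C) : hb_isomorphic Z W -> bimodfun_iso (ic_auteq Z) (ic_auteq W).
  by move/hb_isomorphic_tensoring.
have mul (Z W V : inv_center C) : hb_isomorphic (hb_tensor Z W) V ->
    bimodfun_iso (bimodfun_comp (ic_auteq Z) (ic_auteq W)) (ic_auteq V).
  by move/hb_isomorphic_tensoring; apply: bimodfun_iso_trans; exact: tensoring_comp.
have [Phi PhiE] := cls_lift InvZC Pi1 congr mul; exists Phi; split=> //.
have injPhi : injective Phi.
  move=> x y; have [Z <-] := cls_surj x; have [W <-] := cls_surj y; rewrite !PhiE.
  by move=> /cls_eq/hb_isomorphic_tensoring e; apply/cls_eq.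
have surjPhi y : exists x, Phi x = y.
  have [T <-] := cls_surj y; have [Z [_ i]] := auteq_tensoring ssC T.
  by exists (cls InvZC Z); rewrite PhiE; apply/cls_eq.
exists (fun y => sval (cid (surjPhi y))) => [x|y]; last by case: cid.
by apply: injPhi; case: cid.
Qed.

(** The value at the unit models the forgetful functor, as $Z\otimes 1\cong Z$. It is multiplicative
    because $S(1)\otimes T(1)\cong S(1\otimes T(1))\cong S(T(1))$. *)
Lemma unit_value_hom : exists delta : {multiplicative Pi1 -> InvC},
  forall (T : bimod_auteq C) (g : inv_obj C), isomorphic (T (unit_ob : C) : C) g ->
    delta (cls Pi1 T) = cls InvC g.
Proof.
have iT (T : bimod_auteq C) : invertible (T (unit_ob : C) : C).
  by have [Z [<- _]] := auteq_tensoring ssC T; exact: ic_ob_invertible.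
have [||delta dE] := @cls_lift _ _ _ Pi1 _ _ _ InvC (fun T => InvObj (iT T)).
- by move=> S T [eta [[_ i] _ _]]; exists (eta (unit_ob : C)); exact: i.
- move=> S T V [eta [[_ i] _ _]] /=; have [_ rS _] := ba_bimodule S.
  set t := T (unit_ob : C).
  exists (eta (unit_ob : C) ∘ (fmap S (lun (t : C)) ∘ bf_r S (unit_ob : C) t)).
  apply: is_iso_comp; first exact: i.
  by apply: is_iso_comp; [exact/is_iso_fmap/is_iso_fwd|exact: (is_iso_mfr rS)].
by exists delta => T g i; rewrite dE; apply/cls_eq.
Qed.

(** Duals are chosen only to have some conjugation by each [g]; the stated property covers every
    functor conjugating by [g], in particular [conj_functor] for any dual. *)
Lemma conj_hom : exists F_ : {multiplicative InvC -> EqC},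
  forall (g : inv_obj C) (F : tensor_auteq C), conjugates F g -> F_ (cls InvC g) = cls EqC F.
Proof.
have dual (g : C) : {d : left_dual g | True} by apply: cid; have [[d] _] := rigC g; exists d.
have conjg (g : inv_obj C) := conjugates_conj (sval (dual g)) (inv_obP g).
pose f (g : inv_obj C) := TensorAuteq (conjugates_monoidal ssC (inv_obP g) (conjg g))
  (conjugates_equivalence (inv_obP g) (conjg g)).
have fP (g h : inv_obj C) (F : tensor_auteq C) : conjugates F h -> isomorphic g h -> monfun_iso (f g) F.
  move=> cF i; apply: (conjugates_monfun_iso ssC (inv_obP h) _ cF).
  exact: conjugates_iso i (conjg g).
have [||F_ FE] := @cls_lift _ _ _ InvC _ _ _ EqC f.
- by move=> g h i; exact: (fP g h (f h) (conjg h) i).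
- move=> g h l i; apply: monfun_iso_sym; apply: (fP l l (ta_comp (f g) (f h))).
    by apply: conjugates_iso i _; exact: conjugates_comp (conjg g) (conjg h).
  exact: isomorphic_refl.
exists F_ => g F cF; rewrite FE; apply/cls_eq; exact: fP cF (isomorphic_refl _).
Qed.

Lemma twist_hom : exists M_ : {multiplicative EqC -> OutC},
  forall (F : tensor_auteq C) (M : out_bimod C), bimodule_equivalent (twist F) M ->
    M_ (cls EqC F) = cls OutC M.
Proof.
pose f F := sval (cid (twist_out ssC F)).
have fP (F : tensor_auteq C) : bimodule_equivalent (twist F) (f F).
  by rewrite /f; case: cid => M /= ->; exact: bimodule_equivalent_refl.
have fP' (F : tensor_auteq C) : bimodule_equivalent (f F) (twist F)  := bimodule_equivalent_sym (out_is_bimodule (f F)) (fP F).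
have [||M_ ME] := @cls_lift _ _ _ EqC _ _ _ OutC f.
- move=> F G i; apply: bimodule_equivalent_trans (fP' F) (bimodule_equivalent_trans _ (fP G)).
  exact: (twist_monfun_iso ssC (ta_monoidal F) i).
- move=> F G H i; apply/(out_prod ssC _ (fP F) (fP G)).
  apply: bimodule_equivalent_trans (fP H).
  exact: (twist_monfun_iso ssC (ta_monoidal (ta_comp F G)) i).
by exists M_ => F M e; rewrite ME; apply/cls_eq; exact: bimodule_equivalent_trans e.
Qed.

End Homomorphisms.

(** * Exactness at Inv, Eq and Out *)

Section Exactness.
Variables (k : fieldType) (C : moncat k).
Hypothesis ssC : finite_semisimple C.
Hypothesis rigC : rigid C.
Variables (Pi1 : Pi1BrPicGroup C) (InvC : InvGroup C) (EqC : EqGroup C) (OutC : OutGroup C).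

(** An isomorphism from conjugation by [g] to the identity carries the conjugating family to a
    half-braiding on [g]. Conversely a half-braiding exhibits the identity as a conjugation by [g],
    and such functors are unique up to isomorphism. *)
Lemma conj_kernel (delta : {multiplicative Pi1 -> InvC}) (F_ : {multiplicative InvC -> EqC}) :
  (forall (T : bimod_auteq C) (g : inv_obj C), isomorphic (T (unit_ob : C) : C) g ->
     delta (cls Pi1 T) = cls InvC g) ->
  (forall (g : inv_obj C) (F : tensor_auteq C), conjugates F g -> F_ (cls InvC g) = cls EqC F) ->
  forall g, F_ g = 1%g <-> exists x, delta x = g.
Proof.
move=> dE FE x; have [g <-] := cls_surj x.
have id1 : cls EqC (ta_id C) = 1%g by apply/cls1P; exact: monfun_comp1.
have [[d] _] := rigC g; have cd := conjugates_conj d (inv_obP g).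
pose F := TensorAuteq (conjugates_monoidal ssC (inv_obP g) cd) (conjugates_equivalence (inv_obP g) cd).
rewrite (FE g F cd) -id1 cls_eq; split=> [i|[y]].
  have [u hu] := conjugates_congr i cd; pose Z := HalfBraided u.
  have hZ : half_braiding Z by apply/half_braiding_central.
  exists (cls Pi1 (BimodAuteq (tensoring_bimodule hZ) (invertible_fix_left (inv_obP g)))).
  by apply: dE; exists (run (g : C)); exact: is_iso_fwd.
have [T <-] := cls_surj y; have [Z [eZ i]] := auteq_tensoring ssC T.
have iT : isomorphic (T (unit_ob : C) : C) (hb_ob Z) by rewrite eZ; exact: isomorphic_refl.
rewrite (dE T (InvObj (ic_ob_invertible Z))) // => /cls_eq iZ.
apply: (conjugates_monfun_iso ssC (inv_obP g) cd).
apply: conjugates_iso iZ _; exists (hb_br Z); apply/half_braiding_central.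
exact: ic_central.
Qed.

Lemma twist_kernel (F_ : {multiplicative InvC -> EqC}) (M_ : {multiplicative EqC -> OutC}) :
  (forall (g : inv_obj C) (F : tensor_auteq C), conjugates F g -> F_ (cls InvC g) = cls EqC F) ->
  (forall (F : tensor_auteq C) (M : out_bimod C), bimodule_equivalent (twist F) M ->
     M_ (cls EqC F) = cls OutC M) ->
  forall f, M_ f = 1%g <-> exists g, F_ g = f.
Proof.
move=> FE ME f; have [F <-] := cls_surj f; have reg := twist_id C.
have [M eM] := twist_out ssC F; have [I eI] := twist_out ssC (ta_id C).
(* The unit of [OutC] is located as the image under [M_] of the class of the identity, which is
   idempotent in [EqC]. *)
have id1 : cls OutC I = 1%g.
  rewrite -(ME (ta_id C)) ?eI; last exact: bimodule_equivalent_refl.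
  have -> : cls EqC (ta_id C) = 1%g by apply/cls1P; exact: monfun_comp1.
  by apply: (mulgI (M_ 1%g)); rewrite -gmulfM !mulg1.
rewrite (ME F M) ?eM; last exact: bimodule_equivalent_refl.
rewrite -id1 cls_eq eM eI; split=> [e|[x]].
  have [g [u [ig hu]]] := twist_regular_central ssC (ta_monoidal F)
    (bimodule_equivalent_trans e reg).
  by exists (cls InvC (InvObj ig)); apply: FE; exists u.
have [g <-] := cls_surj x; have [[d] _] := rigC g; have cd := conjugates_conj d (inv_obP g).
rewrite (FE g (TensorAuteq (conjugates_monoidal ssC (inv_obP g) cd)
  (conjugates_equivalence (inv_obP g) cd)) cd) cls_eq => i.
have [u hu] := conjugates_congr i cd.
apply: bimodule_equivalent_trans (central_twist_regular ssC (inv_obP g) hu) _.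
exact: bimodule_equivalent_sym (regular_is_bimodule ssC) reg.
Qed.

Lemma twist_surjective (M_ : {multiplicative EqC -> OutC}) :
  (forall (F : tensor_auteq C) (M : out_bimod C), bimodule_equivalent (twist F) M ->
     M_ (cls EqC F) = cls OutC M) ->
  forall o, exists f, M_ f = o.
Proof.
move=> ME o; have [M <-] := cls_surj o; have [F e] := out_twist ssC M.
by exists (cls EqC F); exact: ME.
Qed.

End Exactness.

(** * Semisimplicity and characters of the grading group *)

Record simple_decomposition (k : fieldType) (A : lincat k) (X : A) := SimpleDecomposition {
  sd_n : nat;
  sd_ob : 'I_sd_n -> A;
  sd_in : forall j, mor A (sd_ob j) X;
  sd_out : forall j, mor A X (sd_ob j);
  sd_simple : forall j, simple_ob (sd_ob j);
  sd_split : forall j, sd_out j ∘ sd_in j = id_mor (sd_ob j);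
  sd_sum : \sum_j sd_in j ∘ sd_out j = id_mor X
}.

Arguments sd_ob {k A X} s j.
Arguments sd_in {k A X} s j.
Arguments sd_out {k A X} s j.
Arguments sd_simple {k A X} s j.
Arguments sd_split {k A X} s j.

Section Semisimple.
Variables (k : closedFieldType) (A : lincat k).
Hypothesis ssA : finite_semisimple A.
Implicit Types X Y Z : A.

Lemma is_zeroP Z : is_zero Z <-> id_mor Z = 0.
Proof.
split=> [h|e X]; first by have [h1 _] := h Z; exact: h1.
by split=> f; [rewrite -(comp_idl f) e comp0l|rewrite -(comp_idr f) e comp0r].
Qed.

Lemma simple_id_neq0 X : simple_ob X -> id_mor X <> 0.
Proof. by move=> [nz _] /is_zeroP. Qed.

(** The kernel of [f] is a subobject of a simple object; were it everything, [f] would vanish. *)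
Lemma simple_mono X Y (f : mor A X Y) : simple_ob X -> f <> 0 -> mono f.
Proof.
move=> sX nf; have [[_ ker _ _ _] _ _ _] := ssA.
have [K [i [fi u]]] := ker _ _ f.
have mi : mono i.
  move=> Z g h e; have [|t [_ ut]] := u Z (i ∘ g); first by rewrite mcompA fi comp0l.
  by rewrite -(ut g) // -(ut h).
have [zK|[j [_ ij]]] := sX.2 _ _ mi; last first.
  by case: nf; rewrite -(comp_idr f) -ij mcompA fi comp0l.
move=> Z g h e; have [|t [et _]] := u Z (g - h).
  by rewrite -scaleN1r addrC compDr compZr e scaleN1r addNr.
apply/eqP; rewrite -subr_eq0 -et; have [t0 _] := zK Z.
by rewrite (t0 t) comp0r.
Qed.

Lemma schur_iso X Y (f : mor A X Y) : simple_ob X -> simple_ob Y -> f <> 0 -> is_iso f.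
Proof. by move=> sX sY nf; have [zX|//] := sY.2 _ _ (simple_mono sX nf); case: sX. Qed.

(* Composition with [f] acts on a spanning family of endomorphisms through a matrix;
   its characteristic polynomial splits, and by Cayley-Hamilton it annihilates [f]. *)
Lemma schur_scalar X (f : mor A X X) : simple_ob X -> exists a, f = a *: id_mor X.
Proof.
move=> sX; have [_ fin _ _] := ssA; have [[|n] [b hb]] := fin X X.
  by have [c] := hb (id_mor X); rewrite big_ord0 => /(simple_id_neq0 sX).
have [c hc] : exists c : 'I_n.+1 -> 'I_n.+1 -> k, forall j, f ∘ b j = \sum_l c j l *: b l.
  by exists (fun j => sval (cid (hb (f ∘ b j)))) => j; case: cid.
pose M := \matrix_(j, l) c j l : 'M[k]_n.+1.
have [rs ers] := closed_field_poly_normal (char_poly M).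
move: ers; rewrite (monicP (char_poly_monic M)) scale1r => ers.
have CH : \prod_(r <- rs) (M - r%:M) = 0.
  have := Cayley_Hamilton M; rewrite ers rmorph_prod => <-.
  by apply: eq_bigr => r _; rewrite rmorphB /= horner_mx_X horner_mx_C.
pose g := foldl (fun (h : mor A X X) r => (f - r *: id_mor X) ∘ h) (id_mor X).
have gb s j : g s ∘ b j = \sum_l (\prod_(r <- s) (M - r%:M)) j l *: b l.
  elim/last_ind: s j => [|s r IH] j.
    rewrite comp_idl big_nil (bigD1 j) //= mxE eqxx scale1r big1 ?addr0 // => l /negPf e.
    by rewrite mxE eq_sym e scale0r.
  rewrite {1}/g foldl_rcons -mcompA IH comp_sumr big_rcons /=; set P := \prod_(i <- s) _.
  under eq_bigr => l _ do rewrite compZr compDl -scaleN1r !compZl comp_idl hc scalerDr scaler_sumr.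
  under [RHS]eq_bigr => l _ do rewrite mxE scaler_suml.
  rewrite exchange_big; apply: eq_bigr => l _ /=.
  under [RHS]eq_bigr => m _ do rewrite !mxE mulrBr scalerBl -scalerA.
  rewrite big_split /=; congr (_ + _).
  rewrite sumrN (bigD1 l) //= eqxx big1 ?addr0 => [|m /negPf e].
    by rewrite mulr1n scaleN1r scalerN scalerA.
  by rewrite eq_sym e mulr0n mulr0 scale0r.
(* Otherwise each factor [f - r *: id_mor X] is nonzero, hence invertible, and the product over the
   roots would be an isomorphism killing the spanning family. *)
have [a na] : exists a, f - a *: id_mor X = 0.
  apply: contrapT => h; apply: (simple_id_neq0 sX).
  have ig s : is_iso (g s).
    elim/last_ind: s => [|s r IH]; first exact: is_iso_id.
    rewrite {1}/g foldl_rcons; apply: is_iso_comp IH.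
    by apply: (schur_iso sX sX) => e; apply: h; exists r.
  apply: (iso_mono (ig rs)); have [d ->] := hb (id_mor X).
  rewrite comp0r comp_sumr big1 // => j _; rewrite compZr gb CH big1 ?scaler0 // => l _.
  by rewrite mxE scale0r.
by exists a; apply/eqP; rewrite -subr_eq0 na.
Qed.

Lemma simple_iso X Y : isomorphic X Y -> simple_ob X -> simple_ob Y.
Proof.
move=> [f i] [nz sX]; split=> [/is_zeroP e|W g mg].
  apply: nz; apply/is_zeroP; apply: (iso_mono i).
  by rewrite comp_idr comp0r -(comp_idl f) e comp0l.
have ii := is_iso_inv i; have mg' : mono (inv f ∘ g).
  by move=> Z u v; rewrite -!mcompA => /(iso_mono ii)/mg.
have [|j] := sX _ _ mg'; [by left|right].
exact: is_iso_compKl ii j.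
Qed.

Definition simple_decomp X : simple_decomposition X.
Proof.
apply: (sval (cid (_ : exists d : simple_decomposition X, True))).
have [_ _ _ h] := ssA; have [n [Xs [sXs [i [p [pi _ s]]]]]] := h X.
by exists (SimpleDecomposition sXs pi s).
Qed.

Lemma sd_in_mono X (d : simple_decomposition X) j : mono (sd_in d j).
Proof.
move=> W g h e; rewrite -(comp_idl g) -(comp_idl h) -(sd_split d j) -!mcompA.
by rewrite e.
Qed.

Lemma sd_in_neq0 X Y (d : simple_decomposition X) (f : mor A X Y) :
  f <> 0 -> exists j, f ∘ sd_in d j <> 0.
Proof.
move=> nf; apply: contrapT => h; apply: nf.
rewrite -(comp_idr f) -(sd_sum d) comp_sumr big1 // => j _; rewrite mcompA.
have -> : f ∘ sd_in d j = 0 by apply: contrapT => e; apply: h; exists j.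
exact: comp0l.
Qed.

Lemma natural_eq (B : lincat k) (F G : functor A B) (a b : forall X, mor B (F X) (G X)) :
  natural a -> natural b -> (forall X, simple_ob X -> a X = b X) -> forall X, a X = b X.
Proof.
move=> na nb e X; have d := simple_decomp X.
rewrite -(comp_idr (a X)) -(comp_idr (b X)) -fmap_id -(sd_sum d) fmap_sum !comp_sumr.
apply: eq_bigr => j _; rewrite fmap_comp !mcompA na nb e //; exact: sd_simple.
Qed.

Section Scalars.
Variable lam : A -> k.

(** The endomorphism of the identity functor that acts on each simple object by [lam]. It is
    assembled from a chosen decomposition, and naturality below makes the choice irrelevant. *)
Definition natural_scalar X : mor A X X :=
  let d := simple_decomp X in \sum_j lam (sd_ob d j) *: (sd_in d j ∘ sd_out d j).

Hypothesis lam_iso : forall X Y, simple_ob X -> isomorphic X Y -> lam X = lam Y.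

(** In terms of decompositions of both objects, a nonzero entry of [f] joins simple objects that are
    isomorphic by Schur's lemma, and on these [lam] agrees. *)
Lemma natural_scalar_nat X Y (f : mor A X Y) : natural_scalar Y ∘ f = f ∘ natural_scalar X.
Proof.
rewrite /natural_scalar; move: (simple_decomp X) (simple_decomp Y) => d e /=.
rewrite -[LHS]comp_idr -[RHS]comp_idl -[id_mor X](sd_sum d) -[id_mor Y](sd_sum e) !comp_suml.
apply: eq_bigr => l _; rewrite !comp_sumr; apply: eq_bigr => j _.
rewrite !compZl !compZr; have [z|nz] := pselect (sd_out e l ∘ (f ∘ sd_in d j) = 0).
  have -> : sd_in e l ∘ sd_out e l ∘ f ∘ (sd_in d j ∘ sd_out d j) = 0.
    by rewrite -!mcompA (mcompA f) (mcompA (sd_out e l)) z comp0l comp0r.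
  have -> : sd_in e l ∘ sd_out e l ∘ (f ∘ (sd_in d j ∘ sd_out d j)) = 0.
    by rewrite -!mcompA (mcompA f) (mcompA (sd_out e l)) z comp0l comp0r.
  by rewrite !scaler0.
rewrite -!mcompA; congr (_ *: _); apply/esym/lam_iso; first exact: sd_simple.
exists (sd_out e l ∘ (f ∘ sd_in d j)); apply: schur_iso => //; exact: sd_simple.
Qed.

Lemma natural_scalar_const X a :
  (forall Y (i : mor A Y X), simple_ob Y -> mono i -> lam Y = a) -> natural_scalar X = a *: id_mor X.
Proof.
move=> h; rewrite /natural_scalar; move: (simple_decomp X) => d /=.
rewrite -(sd_sum d) scaler_sumr; apply: eq_bigr => j _.
by rewrite (h _ (sd_in d j)) //; [exact: sd_simple|exact: sd_in_mono].
Qed.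

Lemma natural_scalar_simple X : simple_ob X -> natural_scalar X = lam X *: id_mor X.
Proof.
move=> sX; apply: natural_scalar_const => Y i sY mi; apply: (lam_iso sY).
exists i; apply: schur_iso => // i0; case: sY => nY _; apply: nY; apply/is_zeroP.
by apply: mi; rewrite i0 !comp0l.
Qed.

End Scalars.
End Semisimple.

(** * Weights on simple objects and the half-braidings they define on the unit *)

Section Weights.
Variables (k : closedFieldType) (C : moncat k).
Hypothesis ssC : finite_semisimple C.
Implicit Types (lam mu : C -> k) (X Y Z : C).

Lemma natural_scalar_ext lam mu X :
  (forall Y, simple_ob Y -> lam Y = mu Y) -> natural_scalar ssC lam X = natural_scalar ssC mu X.
Proof. by move=> e; apply: eq_bigr => j _; rewrite e //; exact: sd_simple. Qed.

Lemma natural_scalar1 X : natural_scalar ssC (fun=> 1) X = id_mor X.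
Proof. by rewrite (@natural_scalar_const _ _ ssC _ _ 1) ?scale1r. Qed.

(* The scalars by which a monoidal automorphism of the identity functor acts on
   the simple objects. *)
Definition weight lam : Prop :=
  [/\ forall X Y, simple_ob X -> isomorphic X Y -> lam X = lam Y,
      forall X Y Z (i : mor C Z (X ⊗ Y)),
        simple_ob X -> simple_ob Y -> simple_ob Z -> mono i -> lam Z = lam X * lam Y
    & forall X, simple_ob X -> lam X != 0].

Section OneWeight.
Variable lam : C -> k.
Hypothesis wlam : weight lam.
Let phi := natural_scalar ssC lam.

Lemma weight_nat X Y (f : mor C X Y) : phi Y ∘ f = f ∘ phi X.
Proof. by apply: natural_scalar_nat; case: wlam. Qed.

Lemma weight_simple X : simple_ob X -> phi X = lam X *: id_mor X.
Proof. by apply: natural_scalar_simple; case: wlam. Qed.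

Lemma weight_mul mu X : weight mu ->
  phi X ∘ natural_scalar ssC mu X = natural_scalar ssC (fun Y => lam Y * mu Y) X.
Proof.
move=> wmu; have [i _ _] := wlam; have [i' _ _] := wmu.
have ii Y Z : simple_ob Y -> isomorphic Y Z -> lam Y * mu Y = lam Z * mu Z.
  by move=> sY e; rewrite (i _ _ sY e) (i' _ _ sY e).
apply: (@natural_eq _ _ ssC _ (fid C) (fid C) (fun X => phi X ∘ natural_scalar ssC mu X)
  (natural_scalar ssC (fun Y => lam Y * mu Y))) => {X}.
- by move=> X Y f /=; rewrite -mcompA (natural_scalar_nat ssC i') !mcompA weight_nat.
- by move=> X Y f /=; exact: natural_scalar_nat.
- move=> X sX; rewrite weight_simple // (natural_scalar_simple ssC i') //.
  by rewrite (natural_scalar_simple ssC ii) // compZl compZr comp_idl scalerA.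
Qed.

(** Both sides are natural in each variable, so [X] and [Y] may be taken simple; then all simple
    subobjects of $X\otimes Y$ have the same scalar, the product of those of [X] and [Y]. *)
Lemma weight_tens X Y : phi (X ⊗ Y) = phi X ⊗' phi Y.
Proof.
have [_ m _] := wlam.
apply: (@natural_eq _ _ ssC _ (fix_right (tens C) Y) (fix_right (tens C) Y)
  (fun X => phi (X ⊗ Y)) (fun X => phi X ⊗' phi Y)) => {X}.
- by move=> X X' f /=; rewrite weight_nat.
- by move=> X X' f /=; rewrite -!bmap_comp !weight_nat ?comp_idl ?comp_idr.
move=> X sX.
apply: (@natural_eq _ _ ssC _ (fix_left (tens C) X) (fix_left (tens C) X)
  (fun Y => phi (X ⊗ Y)) (fun Y => phi X ⊗' phi Y)) => {Y}.
- by move=> Y Y' f /=; rewrite weight_nat.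
- by move=> Y Y' f /=; rewrite -!bmap_comp !weight_nat ?comp_idl ?comp_idr.
move=> Y sY; rewrite (weight_simple sX) (weight_simple sY) bmapZl bmapZr scalerA bmap_id.
by apply: natural_scalar_const => Z i sZ; exact: m.
Qed.

Definition unit_braided : half_braided C :=
  @HalfBraided k C unit_ob (fun X => bwd (run X) ∘ (phi X ∘ lun X)).

Lemma unit_braided_half_braiding : half_braiding unit_braided.
Proof.
have iphi X : is_iso (phi X).
  (* The inverse of [phi] is the endomorphism of the inverse weight. *)
  have wV : weight (fun Y => (lam Y)^-1).
    have [i m n] := wlam; split=> [X' Y sX e|X' Y Z f sX sY sZ mf|X' sX].
    - by rewrite (i _ _ sX e).
    - by rewrite (m _ _ _ _ sX sY sZ mf) invfM.
    - by rewrite invr_eq0 n.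
  have e : phi X ∘ natural_scalar ssC (fun Y => (lam Y)^-1) X = id_mor X.
    rewrite weight_mul // -[RHS]natural_scalar1; apply: natural_scalar_ext => Y sY.
    by rewrite divff //; case: wlam => _ _; apply.
  exists (natural_scalar ssC (fun Y => (lam Y)^-1) X); split=> //.
  by rewrite -weight_nat.
split=> [X Y f|X|X Y] /=.
- have e := weight_nat f; strictify T; rewrite !hat_leaf -!bmapLc.
  by rewrite e.
- by apply: is_iso_comp (is_iso_bwd _) (is_iso_comp (iphi X) (is_iso_fwd _)).
- have e := weight_tens X Y; strictify T; hat_hyp e T e'.
  by rewrite e' !hat_leaf -bmapLR -bmapRL.
Qed.

Lemma unit_braided_simple X : simple_ob X ->
  hb_br unit_braided X = lam X *: (bwd (run X) ∘ lun X).
Proof. by move=> sX /=; rewrite weight_simple // compZl compZr comp_idl. Qed.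

End OneWeight.

Lemma unit_braided_mul lam mu : weight lam -> weight mu ->
  hb_isomorphic (hb_tensor (unit_braided lam) (unit_braided mu))
    (unit_braided (fun X => lam X * mu X)).
Proof.
move=> wl wm; exists (lun unit_ob); split; first exact: is_iso_fwd.
move=> X /=; have e := weight_mul wl X wm; strictify T; hat_hyp e T e'.
by rewrite -e'.
Qed.

End Weights.

(** * Half-braidings on the unit come from weights *)

Section Characters.
Variables (k : closedFieldType) (C : moncat k).
Hypothesis ssC : finite_semisimple C.
Hypothesis rigC : rigid C.
Hypothesis s1 : simple_ob (unit_ob : C).
Implicit Types (X Y Z : C) (lam mu : C -> k).

Lemma unit_braided_ext lam mu : (forall X, simple_ob X -> lam X = mu X) ->
  hb_isomorphic (unit_braided ssC lam) (unit_braided ssC mu).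
Proof.
move=> e; exists (id_mor unit_ob); split=> [|X] /=; first exact: is_iso_id.
by rewrite !bmap_id comp_idl comp_idr (natural_scalar_ext ssC X e).
Qed.

Lemma scaler_inj (V : lmodType k) (a b : k) (v : V) : v <> 0 -> a *: v = b *: v -> a = b.
Proof.
move=> nv /eqP; rewrite -subr_eq0 -scalerBl scaler_eq0 subr_eq0 => /orP[/eqP//|/eqP].
by [].
Qed.

(** An isomorphism between the underlying unit objects is a nonzero scalar, by Schur's lemma, and it
    cancels from the compatibility with the half-braidings. *)
Lemma unit_braided_inj lam mu : weight lam -> weight mu ->
  hb_isomorphic (unit_braided ssC lam) (unit_braided ssC mu) ->
  forall X, simple_ob X -> lam X = mu X.
Proof.
move=> wl wm [f [/= i e]] X sX; have [a ea] := schur_scalar ssC f s1.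
have a0 : a != 0.
  apply/eqP => a0; apply: (simple_id_neq0 s1); apply: (iso_mono i).
  by rewrite ea a0 scale0r comp0r comp0l.
have ul := unit_braided_simple ssC wl sX; have um := unit_braided_simple ssC wm sX.
have := e X; rewrite [X in X ∘ _]um [X in _ = _ ∘ X]ul ea bmapZl bmapZr !bmap_id.
rewrite !compZl !compZr comp_idl comp_idr !scalerA [mu X * a]mulrC => eq.
apply/esym/(mulfI a0); apply: scaler_inj eq => u0; apply: (simple_id_neq0 sX).
apply: (iso_epi (is_iso_fwd (lun X))); rewrite comp_idl comp0l.
by apply: (iso_mono (is_iso_bwd (run X))); rewrite u0 comp0r.
Qed.

Lemma half_braiding_iso (Z : half_braided C) (h : C) (f : mor C (hb_ob Z) h) :
  is_iso f -> half_braiding Z -> exists W, [/\ half_braiding W, hb_ob W = h & hb_isomorphic Z W].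
Proof.
move=> i hZ.
exists (HalfBraided (fun X => (id_mor X ⊗' f) ∘ hb_br Z X ∘ (inv f ⊗' id_mor X))).
split=> //.
  by apply/half_braiding_central; apply: twisted_central_iso i _; apply/half_braiding_central.
exists f; split=> //= X; rewrite -!mcompA -bmapLc invK //.
by rewrite bmap_id comp_idr.
Qed.

Lemma half_braided_weight (Z : half_braided C) : half_braiding Z -> isomorphic (hb_ob Z) unit_ob ->
  exists lam, weight lam /\ hb_isomorphic Z (unit_braided ssC lam).
Proof.
(* Transport along [f] gives a half-braiding whose underlying object is the unit itself. *)
move=> hZ [f i]; have [[W br] [hW /= eW ZW]] := half_braiding_iso i hZ.
subst W; have [n ib h] := hW; rewrite /= in n ib h.
pose psi X := run X ∘ (br X ∘ bwd (lun X)).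
have nat X Y (x : mor C X Y) : psi Y ∘ x = x ∘ psi X.
  have e := n _ _ x; rewrite /psi; strictify T; hat_hyp e T e'.
  by rewrite e'.
have tens X Y : psi (X ⊗ Y) = psi X ⊗' psi Y.
  have e := h X Y; rewrite /psi; strictify T; hat_hyp e T e'.
  rewrite e'; by_elt; apply: esym.
  exact: (@hat_nat _ _ (Node One (Leaf X)) (Node (Leaf X) One) (br X) _ _
    (hat (Node One (Leaf Y)) (Node (Leaf Y) One) (br Y) T)).
have ipsi X : is_iso (psi X).
  exact: is_iso_comp (is_iso_fwd _) (is_iso_comp (ib X) (is_iso_bwd _)).
have [lam lamE] : exists lam, forall X, simple_ob X -> psi X = lam X *: id_mor X.
  (* The value 0 on objects that are not simple is junk. *)
  exists (fun X => if pselect (simple_ob X) is left sX then sval (cid (schur_scalar ssC (psi X) sX)) else 0).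
  by move=> X sX; case: pselect => // sX'; case: cid.
have wl : weight lam.
  split.
  - move=> X Y sX iXY; have sY := simple_iso iXY sX; have [x ix] := iXY.
    apply: (@scaler_inj _ _ _ x).
      move=> x0; apply: (simple_id_neq0 sX); apply: (iso_mono ix).
      by rewrite x0 comp_idr comp0r.
    by have := nat _ _ x; rewrite (lamE X sX) (lamE Y sY) compZl compZr comp_idl comp_idr.
  - move=> X Y V x sX sY sV mx; apply: (@scaler_inj _ _ _ x).
      by move=> x0; apply: (simple_id_neq0 sV); apply: mx; rewrite x0 !comp0l.
    have := nat _ _ x; rewrite tens (lamE X sX) (lamE Y sY) (lamE V sV) compZr comp_idr.
    by rewrite bmapZl bmapZr bmap_id scalerA compZl comp_idl.
  - move=> X sX; apply/eqP => l0; apply: (simple_id_neq0 sX); apply: (iso_mono (ipsi X)).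
    by rewrite lamE // l0 scale0r !comp0l.
exists lam; split=> //; apply: hb_isomorphic_trans ZW _.
have e X : psi X = natural_scalar ssC lam X.
  apply: (@natural_eq _ _ ssC _ (fid C) (fid C) psi (natural_scalar ssC lam)) => //.
    by move=> Y Y' x; exact: weight_nat.
  by move=> Y sY; rewrite lamE // weight_simple.
exists (id_mor unit_ob); split=> [|X] /=; first exact: is_iso_id.
rewrite !bmap_id comp_idl comp_idr -e /psi; by_elt; rewrite fwdKe.
by rewrite fwdKe.
Qed.

Lemma dual_coev_neq0 X (d : left_dual X) : simple_ob X -> coev d <> 0.
Proof.
move=> sX e; apply: (simple_id_neq0 sX); rewrite -(zigzag d) e bmap0l comp0r comp0l.
by [].
Qed.

Lemma dual_ev_neq0 X (d : left_dual X) : simple_ob X -> ev d <> 0.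
Proof.
move=> sX e; apply: (simple_id_neq0 sX); rewrite -(zigzag d) e bmap0r comp0r !comp0l.
by [].
Qed.

(* The evaluation of [X] is a split epimorphism onto the unit, hence [Y] is a direct
   summand of [X^* ⊗ (X ⊗ Y)]. *)
Lemma simple_tens_neq0 X Y : simple_ob X -> simple_ob Y -> id_mor (X ⊗ Y) <> 0.
Proof.
move=> sX sY e; have [[d] _] := rigC X; set X' := dual_ob d.
have [j nj] := sd_in_neq0 (simple_decomp ssC (X' ⊗ X)) (dual_ev_neq0 (d := d) sX).
move: nj; set i := sd_in _ j => nj.
have ij : is_iso (ev d ∘ i) by apply: (schur_iso ssC _ s1 nj); exact: sd_simple.
apply: (simple_id_neq0 sY).
apply: (iso_epi (is_iso_fwd (lun Y))); rewrite comp_idl comp0l -[LHS]comp_idr -bmap_id.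
rewrite -(Kinv ij) !bmapLc -mcompA.
have -> : ev d ⊗' id_mor Y = (ev d ⊗' id_mor Y) ∘ bwd (asc X' X Y) ∘
    (id_mor X' ⊗' id_mor (X ⊗ Y)) ∘ asc X' X Y.
  by rewrite bmap_id comp_idr -mcompA fwdK comp_idr.
by rewrite e bmap0r comp0r !comp0l comp0r.
Qed.

(** The unit embeds in $1\otimes 1$, so its weight is a nonzero idempotent. *)
Lemma weight_mul1 lam : weight lam -> lam unit_ob = 1.
Proof.
move=> [_ m n]; apply: (mulfI (n _ s1)); rewrite mulr1 -(m _ _ _ (bwd (lun unit_ob)) s1 s1 s1) //.
by move=> W g h; apply: iso_mono; exact: is_iso_bwd.
Qed.

Lemma simple_sub X : id_mor X <> 0 -> exists Y (i : mor C Y X), simple_ob Y /\ mono i.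
Proof.
move=> nX; have [j _] := sd_in_neq0 (simple_decomp ssC X) nX.
by exists (sd_ob (simple_decomp ssC X) j), (sd_in (simple_decomp ssC X) j); split;
  [exact: sd_simple|exact: sd_in_mono].
Qed.

(** The coevaluation $1\to X\otimes X^*$ has a nonzero component in $X\otimes Y$ for some simple
    summand [Y] of $X^*$. It is a monomorphism since the unit is simple, so the weights of [X] and
    [Y] multiply to that of the unit. *)
Lemma weight_inv lam X : weight lam -> simple_ob X ->
  exists Y, simple_ob Y /\ lam Y * lam X = 1.
Proof.
move=> wl sX; have [_ m _] := wl; have [[d] _] := rigC X; set X' := dual_ob d.
pose D := simple_decomp ssC X'.
have [j nj] : exists j, (id_mor X ⊗' sd_out D j) ∘ coev d <> 0.
  apply: contrapT => h; apply: (dual_coev_neq0 (d := d) sX).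
  rewrite -[coev d]comp_idl -bmap_id -(sd_sum D).
  rewrite (_ : id_mor X ⊗' _ = \sum_j ((id_mor X ⊗' sd_in D j) ∘ (id_mor X ⊗' sd_out D j))).
    rewrite comp_suml big1 // => j _; rewrite -mcompA.
    have -> : (id_mor X ⊗' sd_out D j) ∘ coev d = 0.
      by apply: contrapT => e; apply: h; exists j.
    exact: comp0r.
  have := fmap_sum (fix_left (tens C) X) (index_enum _) (fun j => sd_in D j ∘ sd_out D j).
  by move=> /= ->; apply: eq_bigr => j _; rewrite bmapRc.
exists (sd_ob D j); split; first exact: sd_simple.
rewrite mulrC -(weight_mul1 wl); apply/esym.
exact: (m _ _ _ _ sX (sd_simple D j) s1 (simple_mono ssC s1 nj)).
Qed.

End Characters.

Definition char_mul (U : groupType) (k : fieldType) (c d : mult_char U k) : mult_char U k.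
Proof.
exists (fun u => c u * d u) => [u|u v]; first by rewrite mulf_neq0 ?char_neq0.
by rewrite !charM mulrACA.
Defined.

Definition char1 (U : groupType) (k : fieldType) : mult_char U k.
Proof. by exists (fun=> 1) => [u|u v]; rewrite ?oner_neq0 ?mulr1. Defined.

Definition char_inv (U : groupType) (k : fieldType) (c : mult_char U k) : mult_char U k.
Proof.
exists (fun u => (c u)^-1) => [u|u v]; first by rewrite invr_eq0 char_neq0.
by rewrite charM invfM.
Defined.

Definition hom_group (U : groupType) (k : fieldType) : HomGroup U k.
Proof.
apply: (build_class_group_op (op := @char_mul U k) (e := char1 U k)).
- by move=> c.
- by move=> c d e u.
- by move=> c d e cd de u; rewrite cd de.
- by move=> c c' d d' e e' u; rewrite /= e e'.
- by move=> c d e u; rewrite /= mulrA.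
- by move=> c u; rewrite /= mul1r.
- by move=> c; exists (char_inv c) => u; rewrite /= mulVf ?char_neq0.
Qed.

(** * Weights as characters of the universal grading group *)

Section GradingCharacters.
Variables (k : closedFieldType) (C : moncat k).
Hypothesis ssC : finite_semisimple C.
Hypothesis rigC : rigid C.
Hypothesis s1 : simple_ob (unit_ob : C).
Variables (U : groupType) (deg : C -> U).
Hypothesis hU : universal_grading deg.

Lemma char_weight (c : mult_char U k) : weight (fun X => c (deg X)).
Proof.
have [[[di dm] _] _] := hU; split.
- by move=> X Y sX e; rewrite (di X Y).
- by move=> X Y Z i sX sY sZ mi; rewrite (dm X Y Z i) // charM.
- by move=> X _; exact: char_neq0.
Qed.

(* Universality only concerns faithful gradings, so the target of the grading
   defined by a weight has to be the group of its values rather than k^*. *)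
Definition weight_values (lam : C -> k) (wl : weight lam) :
  @class_group {X : C | simple_ob X} (fun X Y => lam (sval X) = lam (sval Y))
    (fun X Y Z => lam (sval X) * lam (sval Y) = lam (sval Z)).
Proof.
have [li lm ln] := wl.
apply: (@build_class_group _ _ _ _ _ _ _ _ _ _ (exist _ _ s1)) => /=.
- by [].
- by move=> x y.
- by move=> x y z -> ->.
- move=> [X sX] [Y sY] /=; have [Z [i [sZ mi]]] := simple_sub ssC (simple_tens_neq0 ssC rigC s1 sX sY).
  by exists (exist _ Z sZ); rewrite /= (lm _ _ _ i).
- by move=> x y z z' ->.
- by move=> x x' y y' z -> ->.
- by move=> x y z a b c xy az yz; rewrite -yz mulrA xy.
- by move=> x; rewrite (weight_mul1 s1 wl) mul1r.
- move=> [X sX]; have [Y [sY e]] := weight_inv ssC rigC s1 wl sX.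
  by exists (exist _ Y sY); rewrite /= e (weight_mul1 s1 wl).
Qed.

Lemma weight_char (lam : C -> k) : weight lam ->
  exists c : mult_char U k, forall X, simple_ob X -> c (deg X) = lam X.
Proof.
move=> wl; have [li lm ln] := wl; set G := weight_values wl.
pose val (g : G) := lam (sval (sval (cid (cls_surj g)))).
have valE x : val (cls G x) = lam (sval x) by rewrite /val; case: cid => y /= /cls_eq.
have valM g h : val (g * h)%g = val g * val h.
  have [x <-] := cls_surj g; have [y <-] := cls_surj h.
  have [z ez] := cls_surj (cls G x * cls G y)%g.
  by rewrite -ez !valE; apply/esym/(cls_mul G).
(* Degrees of objects that are not simple do not matter; 1 is a default. *)
pose deg' X : G := if pselect (simple_ob X) is left sX then cls G (exist _ X sX) else 1%g.
have degE X (sX : simple_ob X) : deg' X = cls G (exist _ X sX).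
  by rewrite /deg'; case: pselect => // sX'; apply/cls_eq.
have gr : faithful_grading deg'.
  split; [split=> [X Y sX e|X Y Z i sX sY sZ mi]|move=> g].
  - by rewrite (degE X sX) (degE Y (simple_iso e sX)); apply/cls_eq; exact: li.
  - by rewrite (degE X sX) (degE Y sY) (degE Z sZ); apply/esym/(cls_mul G)/esym/(lm _ _ _ i).
  - by have [[X sX] <-] := cls_surj g; exists X; rewrite (degE X sX).
have [p [pE _]] := hU.2 G deg' gr.
have cn u : val (p u) != 0 by have [[X sX] <-] := cls_surj (p u); rewrite valE; exact: ln.
have cM u v : val (p (u * v)%g) = val (p u) * val (p v) by rewrite gmulfM valM.
exists (Character cn cM) => X sX /=.
by rewrite -pE // (degE X sX) valE.
Qed.

Definition char_ic (c : mult_char U k) : inv_center C :=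
  @central_ic _ _ ssC (unit_braided ssC (fun X => c (deg X)))
    (unit_braided_half_braiding ssC (char_weight c)) (invertible_unit C).

(** Isomorphic half-braidings have equal weights, and since the universal grading is faithful, the
    degrees of simple objects exhaust [U]. This yields injectivity of the first map. *)
Lemma char_ic_ext (c d : mult_char U k) : c =1 d <-> hb_isomorphic (char_ic c) (char_ic d).
Proof.
split=> [e|/(unit_braided_inj s1 (char_weight c) (char_weight d)) e u].
  by apply: unit_braided_ext => X _; exact: e.
by have [[_ /(_ u) [X [sX <-]]] _] := hU; exact: e.
Qed.

Variables (HomU : HomGroup U k) (Pi1 : Pi1BrPicGroup C) (InvZC : InvZGroup C) (InvC : InvGroup C).
Variable Phi : {multiplicative InvZC -> Pi1}.
Hypothesis bijPhi : bijective Phi.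

Lemma char_hom : exists iota : {multiplicative HomU -> Pi1},
  injective iota /\ forall c, iota (cls HomU c) = Phi (cls InvZC (char_ic c)).
Proof.
have mul (c d e : mult_char U k) : (forall u, c u * d u = e u) ->
    hb_isomorphic (hb_tensor (char_ic c) (char_ic d)) (char_ic e).
  move=> h; apply: hb_isomorphic_trans (unit_braided_mul ssC (char_weight c) (char_weight d)) _.
  by apply: unit_braided_ext => X _; exact: h.
have [f fE] := cls_lift HomU InvZC (fun c d => (char_ic_ext c d).1) mul.
exists (Phi \o f : {multiplicative HomU -> Pi1}); split=> [x y|c /=]; last by rewrite fE.
have [c <-] := cls_surj x; have [d <-] := cls_surj y.
move=> /= /(bij_inj bijPhi); rewrite !fE => /cls_eq/char_ic_ext e; exact/cls_eq.
Qed.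

(** A class in the kernel of [delta] comes from a central object whose underlying object is the unit
    up to isomorphism. Its half-braiding is given by a weight, and weights are characters of [U]. *)
Lemma char_kernel (iota : {multiplicative HomU -> Pi1}) (delta : {multiplicative Pi1 -> InvC}) :
  (forall c, iota (cls HomU c) = Phi (cls InvZC (char_ic c))) ->
  (forall (Z : inv_center C) (g : inv_obj C), isomorphic (hb_ob Z) g ->
     delta (Phi (cls InvZC Z)) = cls InvC g) ->
  forall x, delta x = 1%g <-> exists c, iota c = x.
Proof.
move=> iE dE x; pose one := InvObj (invertible_unit C).
have one1 : cls InvC one = 1%g by apply/cls1P; exists (lun unit_ob); exact: is_iso_fwd.
split=> [|[y <-]]; last first.
  have [c <-] := cls_surj y; rewrite iE -one1; apply: dE; exact: isomorphic_refl.
have [psi _ psiK] := bijPhi; rewrite -(psiK x); have [Z <-] := cls_surj (psi x).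
rewrite (dE Z (InvObj (ic_ob_invertible Z))); last exact: isomorphic_refl.
rewrite -one1 => /cls_eq e.
have [lam [wl i]] := half_braided_weight ssC (ic_central Z) e.
have [c cE] := weight_char wl; exists (cls HomU c); rewrite iE; congr (Phi _); apply/cls_eq.
apply: hb_isomorphic_trans (hb_isomorphic_sym i).
by apply: unit_braided_ext => X sX; exact: cE.
Qed.

End GradingCharacters.

Theorem corollary3p7 (R : realType) (C : fusion R[i])
    (U : groupType) (deg : C -> U) (hU : universal_grading deg) :
  exists (HomU : HomGroup U R[i]) (Pi1 : Pi1BrPicGroup C) (InvZC : InvZGroup C)
         (InvC : InvGroup C) (EqC : EqGroup C) (OutC : OutGroup C)
         (Phi : {multiplicative InvZC -> Pi1})
         (iota : {multiplicative HomU -> Pi1})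
         (delta : {multiplicative Pi1 -> InvC})
         (F_ : {multiplicative InvC -> EqC})
         (M_ : {multiplicative EqC -> OutC}),
    [/\ bijective Phi /\
        (forall Z : inv_center C, exists T : bimod_auteq C,
           T = tensoring Z :> bimodfun _ _ /\ Phi (cls InvZC Z) = cls Pi1 T),
        forall chi : mult_char U R[i],
          exists (br : forall X : C, mor C (unit_ob ⊗ X) (X ⊗ unit_ob)) (Z : inv_center C),
            [/\ Z = HalfBraided br :> half_braided C,
                forall X, simple_ob X -> br X = chi (deg X) *: (bwd (run X) ∘ lun X)
              & iota (cls HomU chi) = Phi (cls InvZC Z)],
        forall Z : inv_center C, exists g : inv_obj C,
          g = hb_ob Z :> C /\ delta (Phi (cls InvZC Z)) = cls InvC g,
        forall (g : inv_obj C) (d : left_dual g), exists F : tensor_auteq C,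
          F = conj_functor d :> monfun C C /\ F_ (cls InvC g) = cls EqC F
      & forall F : tensor_auteq C, exists M : out_bimod C,
          M = twist F :> bimod C /\ M_ (cls EqC F) = cls OutC M] /\
    [/\ injective iota,
        forall x, delta x = 1%g <-> exists c, iota c = x,
        forall g, F_ g = 1%g <-> exists x, delta x = g,
        forall f, M_ f = 1%g <-> exists g, F_ g = f
      & forall o, exists f, M_ f = o].
Proof.
have ssC := fus_semisimple C; have rigC := fus_rigid (f := C); have s1 := fus_unit C.
pose HomU := hom_group U R[i]; pose Pi1 := pi1_group ssC; pose InvZC := invz_group ssC.
pose InvC := inv_group C; pose EqC := eq_group C; pose OutC := out_group ssC.
have [Phi [bijPhi PhiE]] := tensoring_hom ssC Pi1 InvZC.
have [delta deltaE] := unit_value_hom ssC Pi1 InvC.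
have [F_ FE] := conj_hom ssC rigC InvC EqC.
have [M_ ME] := twist_hom ssC EqC OutC.
have [iota [iota_inj iotaE]] := char_hom ssC s1 hU HomU bijPhi.
(* The isomorphism $Z\otimes 1\cong Z$ turns evaluation at the unit into the forgetful functor. *)
have dPhi (Z : inv_center C) (g : inv_obj C) :
    isomorphic (hb_ob Z) g -> delta (Phi (cls InvZC Z)) = cls InvC g.
  move=> i; rewrite PhiE; apply: deltaE; apply: isomorphic_trans i.
  by exists (run (hb_ob Z)); exact: is_iso_fwd.
exists HomU, Pi1, InvZC, InvC, EqC, OutC, Phi, iota, delta, F_, M_; split; split.
- by split=> // Z; exists (ic_auteq Z).
- move=> chi; exists (hb_br (unit_braided ssC (fun X => chi (deg X)))), (char_ic ssC hU chi).
  by split=> // X sX; exact: (unit_braided_simple ssC (char_weight hU chi) sX).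
- move=> Z; exists (InvObj (ic_ob_invertible Z)); split=> //; apply: dPhi.
  exact: isomorphic_refl.
- move=> g d; have cd := conjugates_conj d (inv_obP g).
  by exists (TensorAuteq (conjugates_monoidal ssC (inv_obP g) cd)
    (conjugates_equivalence (inv_obP g) cd)); split=> //; exact: FE.
- move=> F; have [M eM] := twist_out ssC F; exists M; split=> //; apply: ME; rewrite eM.
  exact: bimodule_equivalent_refl.
- exact: iota_inj.
- exact: (char_kernel rigC s1 bijPhi iotaE dPhi).
- exact: (conj_kernel ssC rigC deltaE FE).
- exact: (twist_kernel ssC rigC FE ME).
- exact: (twist_surjective ssC ME).
Qed.
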